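(* Let $\Lambda\subset\mathbb{R}^2$ be a lattice with $s(\Lambda)=1$. For $0<q<1$ let $A_q$ denote the optimal lower frame bound of $\mathcal{G}(H_0,q\Lambda)=\{\pi_\lambda H_0:\lambda\in q\Lambda\}$ in $L^2(\mathbb{R})$. Then there is a constant $c>0$, independent of $q$, such that for all $0<q<1$ $$ A_q\ \ge\ c\,(1-q^2)^2=c\,(1-s(q\Lambda))^2. $$
   Context: A lattice is $\Lambda=A\mathbb{Z}^2\subset\mathbb{R}^2$ with $A$ an invertible real $2\times2$ matrix, $s(\Lambda)=|\det A|$, and $q\Lambda=\{q\lambda:\lambda\in\Lambda\}$. For $z=(x,\xi)\in\mathbb{R}^2$, $\pi_zf(t)=e^{2\pi i\xi t}f(t-x)$. $H_0(t)=2^{1/4}e^{-\pi t^2}$ is the $L^2$-normalized Gaussian (the zeroth Hermite function). The optimal lower frame bound of $\mathcal{G}(g,\Lambda)$ is the largest $A\geq 0$ such that $A\|f\|^2\le\sum_{\lambda\in\Lambda}|\langle f,\pi_\lambda g\rangle|^2$ for all $f\in L^2(\mathbb{R})$. The constant $c$ may depend on the fixed lattice $\Lambda$. *)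

(* Defs.v *)
From HB Require Import structures.
From mathcomp Require Import all_boot all_order all_algebra.
From mathcomp Require Import all_classical all_reals all_analysis.
From mathcomp Require Export complex.

Set Implicit Arguments.
Unset Strict Implicit.
Unset Printing Implicit Defensive.

Import Order.TTheory GRing.Theory Num.Theory.
Import numFieldNormedType.Exports.

Local Open Scope classical_set_scope.
Local Open Scope ring_scope.
Local Open Scope complex_scope.

(* Points of the time-frequency plane R^2 are column vectors (x, xi). *)
Definition time_coord (R : realType) (z : 'cV[R]_2) : R := z ord0 ord0.
Definition freq_coord (R : realType) (z : 'cV[R]_2) : R := z ord_max ord0.

Definition lattice_of (R : realType) (A : 'M[R]_2) : set 'cV[R]_2 :=
  [set A *m map_mx intr k | k in [set: 'cV[int]_2]].

Definition is_lattice (R : realType) (L : set 'cV[R]_2) : Prop :=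
  exists2 A : 'M[R]_2, A \in unitmx & L = lattice_of A.

(* |det A| does not depend on the generating matrix A, so the set below is a
   singleton when L is a lattice; the value is 0 when L is not one. *)
Definition covolume (R : realType) (L : set 'cV[R]_2) : R :=
  xget 0 [set s | exists A : 'M[R]_2,
    [/\ A \in unitmx, L = lattice_of A & s = `|\det A|]].

Definition scale_set (R : realType) (q : R) (L : set 'cV[R]_2) :
  set 'cV[R]_2 := [set q *: l | l in L].

Definition expi (R : realType) (theta : R) : R[i] := cos theta +i* sin theta.

Definition tfshift (R : realType) (z : 'cV[R]_2) (f : R -> R[i]) : R -> R[i] :=
  fun t => expi (2 * pi * freq_coord z * t) * f (t - time_coord z).

Definition gaussian (R : realType) : R -> R[i] :=
  fun t => (2 `^ 4^-1 * expR (- pi * t ^+ 2))%:C.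

Definition cintegral (R : realType) (f : R -> R[i]) : R[i] :=
  (\int[lebesgue_measure]_t complex.Re (f t)) +i* (\int[lebesgue_measure]_t complex.Im (f t)).

Definition sqnormL2 (R : realType) (f : R -> R[i]) : \bar R :=
  (\int[lebesgue_measure]_t (ComplexField.Normc.normc (f t) ^+ 2)%:E)%E.

(* Representatives of elements of L^2(R): functions, not a.e. classes.
   Measurability is Borel measurability, which every class has a
   representative for. *)
Definition inL2 (R : realType) (f : R -> R[i]) : Prop :=
  [/\ measurable_fun [set: R] (fun t => complex.Re (f t)),
      measurable_fun [set: R] (fun t => complex.Im (f t)) &
      (sqnormL2 f < +oo)%E].

Definition innerL2 (R : realType) (f g : R -> R[i]) : R[i] :=
  cintegral (fun t => f t * (g t)^*).

Definition lower_frame_bound (R : realType) (g : R -> R[i])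
    (L : set 'cV[R]_2) (A : R) : Prop :=
  0 <= A /\ forall f : R -> R[i], inL2 f ->
    (A%:E * sqnormL2 f <=
     \esum_(l in L) (ComplexField.Normc.normc (innerL2 f (tfshift l g)) ^+ 2)%:E)%E.

(* The largest lower frame bound; 0 if there were no largest one. *)
Definition optimal_lower_frame_bound (R : realType) (g : R -> R[i])
    (L : set 'cV[R]_2) : R :=
  xget 0 [set A | lower_frame_bound g L A /\
                  forall B, lower_frame_bound g L B -> B <= A].

(* Main.v *)
(* Identify (x, xi) with z = x + i xi and write the lattice as q u (Z + tau Z) with |u|^2 Im tau = 1;
   by Gauss reduction Im tau >= 1/2.  With signs chi_p, the weights chi_p exp(-beta |l_p|^2),
   l_p in Z + tau Z and beta = pi / (2 Im tau), annihilate all polynomials, by Poisson summation.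
   Hence F(w) sum_p wt_p / (l_p - w) = sum_p wt_p F(l_p) / (l_p - w) for entire F of small enough
   Gaussian growth.  Multiplying by an odd theta function with zeros on the lattice, which bounds
   the left-hand factor below uniformly in w, turns this into an expansion of F(w) over the F(l_p)
   with Gaussian coefficients.  Up to a Gaussian factor the atoms are such functions F, the slack in
   their growth being a multiple of 1 - q^2, so the short-time Fourier transform V satisfies
   |V(z)| <= C sum_p exp(-a |l_p - z/(q u)|^2) |V(q u l_p)|, a = (pi/2) (1 - q^2) |u|^2.
   The Cauchy-Schwarz inequality and then integration over z each cost a factor of order 1/(1 - q^2). *)

Require Import Defs.
From HB Require Import structures.
From mathcomp Require Import all_boot all_order all_algebra.
From mathcomp Require Import all_classical all_reals all_analysis.
From mathcomp Require Import measurable_realfun.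
From mathcomp Require Import ring lra zify.
Set Implicit Arguments.
Unset Strict Implicit.
Unset Printing Implicit Defensive.

Import Order.TTheory GRing.Theory Num.Theory.
Import numFieldNormedType.Exports.
Import ComplexField.

Local Open Scope classical_set_scope.
Local Open Scope ring_scope.
Local Open Scope complex_scope.

(** Holomorphy enters only through polynomials: exponentials of quadratic polynomials, and then
    dilates of [theta], are reached from them by dominated convergence. The growth is critical:
    [theta] is of order exp(beta |z|^2), exactly the rate at which the weights decay, so the
    interpolation formula cannot be applied to [theta] itself. It is applied to z |-> theta((1 -
    eta) z) and eta tends to 0. Quasi-periodicity turns the sum over the lattice into sum_p exp(-2
    beta eta |l_p|^2) theta(eta l_p) / (l_p - w), up to sign. There theta(eta l_p) is nearly
    theta'(0) eta l_p and l_p / (l_p - w) is nearly 1; what remains, theta'(0) times the sum of eta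
    exp(-2 beta eta |l_p|^2), stays away from 0 and does not involve w. This is the lower bound
    uniform in w. It requires theta'(0) to be nonzero, and that is where Im tau >= 1/2 enters: the
    two central terms of the series then outweigh all others. The coefficients of the expansion
    depend on w but not on the expanded function, so the atoms at all times s share one expansion,
    which can be paired with f. *)

Local Notation Re := complex.Re.
Local Notation Im := complex.Im.
Local Notation normc := ComplexField.Normc.normc.

(** * Complex numbers: components, modulus and sequential limits *)

Section ComplexNumbers.
Context {R : realType}.
Implicit Types (z w : R[i]).

Lemma ReD z w : Re (z + w) = Re z + Re w. Proof. by case: z w => a b [c d]. Qed.
Lemma ImD z w : Im (z + w) = Im z + Im w. Proof. by case: z w => a b [c d]. Qed.
Lemma ReN z : Re (- z) = - Re z. Proof. by case: z. Qed.
Lemma ImN z : Im (- z) = - Im z. Proof. by case: z. Qed.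
Lemma ReM z w : Re (z * w) = Re z * Re w - Im z * Im w.
Proof. by case: z w => a b [c d]. Qed.
Lemma ImM z w : Im (z * w) = Re z * Im w + Im z * Re w.
Proof. by case: z w => a b [c d]. Qed.
Lemma ReJ z : Re (z^*) = Re z. Proof. by case: z. Qed.
Lemma ImJ z : Im (z^*) = - Im z. Proof. by case: z. Qed.

Definition ReImE := (ReD, ImD, ReN, ImN, ReM, ImM, ReJ, ImJ).

Lemma complexP z w : Re z = Re w -> Im z = Im w -> z = w.
Proof. by case: z w => a b [c d] /= -> ->. Qed.

Lemma normcD z w : normc (z + w) <= normc z + normc w.
Proof. exact: le_normcD. Qed.
Lemma normcN z : normc (- z) = normc z.
Proof. exact: normcN. Qed.
Lemma normcM z w : normc (z * w) = normc z * normc w.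
Proof. exact: Normc.normcM. Qed.
Lemma normcV z : normc z^-1 = (normc z)^-1.
Proof. exact: Normc.normcV. Qed.
Lemma normc_ge0 z : 0 <= normc z.
Proof. by case: z => a b /=; rewrite sqrtr_ge0. Qed.
Lemma normc_sqr z : normc z ^+ 2 = Re z ^+ 2 + Im z ^+ 2.
Proof. by case: z => a b /=; rewrite sqr_sqrtr // addr_ge0 // sqr_ge0. Qed.
Lemma normc0 : normc (0 : R[i]) = 0. Proof. exact: Normc.normc0. Qed.
Lemma normc1 : normc (1 : R[i]) = 1. Proof. exact: Normc.normc1. Qed.
Lemma normc_eq0 z : (normc z == 0) = (z == 0).
Proof. by apply/eqP/eqP => [/Normc.eq0_normc|->] //; rewrite normc0. Qed.
Lemma normc_gt0 z : (0 < normc z) = (z != 0).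
Proof. by rewrite lt_def normc_eq0 normc_ge0 andbT. Qed.
Lemma normcX z n : normc (z ^+ n) = normc z ^+ n.
Proof. by elim: n => [|n IH]; rewrite ?expr0 ?normc1 // !exprS normcM IH. Qed.
Lemma normcR (x : R) : normc x%:C = `|x|.
Proof. by rewrite /= expr0n /= addr0 sqrtr_sqr. Qed.
Lemma normcJ z : normc (z^*) = normc z.
Proof. by case: z => a b /=; rewrite sqrrN. Qed.
Lemma normcB z w : normc (z - w) = normc (w - z).
Proof. by rewrite -opprB normcN. Qed.
Lemma normc_triangle u z w : normc (z - w) <= normc (z - u) + normc (u - w).
Proof. by apply: le_trans (normcD _ _); rewrite addrA subrK. Qed.
Lemma normr_Re z : `|Re z| <= normc z.
Proof.
rewrite -ler_sqr ?nnegrE ?normc_ge0 // normc_sqr real_normK ?num_real //.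
by rewrite lerDl sqr_ge0.
Qed.
Lemma normr_Im z : `|Im z| <= normc z.
Proof.
rewrite -ler_sqr ?nnegrE ?normc_ge0 // normc_sqr real_normK ?num_real //.
by rewrite lerDr sqr_ge0.
Qed.
Lemma normc_le_ReIm z : normc z <= `|Re z| + `|Im z|.
Proof.
rewrite -ler_sqr ?nnegrE ?normc_ge0 ?addr_ge0 // normc_sqr sqrrD.
rewrite !real_normK ?num_real // -addrA lerD2l lerDr mulrn_wge0 // mulr_ge0 //.
Qed.
Lemma mulcJ z : z * z^* = (normc z ^+ 2)%:C.
Proof. by rewrite normc_sqr; apply: complexP; rewrite !ReImE /=; ring. Qed.

Lemma cvg0_squeeze (a b : nat -> R) : (forall n, 0 <= a n <= b n) ->
  b n @[n --> \oo] --> (0 : R) -> a n @[n --> \oo] --> (0 : R).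
Proof.
move=> ab b0; apply: (squeeze_cvgr (f := fun=> 0 : R) (h := b)) => //.
  exact: nearW.
exact: cvg_cst.
Qed.

Definition ccvg (u : nat -> R[i]) (l : R[i]) := normc (u n - l) @[n --> \oo] --> (0 : R).

Lemma ccvg_unique u l l' : ccvg u l -> ccvg u l' -> l = l'.
Proof.
move=> ul ul'; apply/eqP; rewrite -subr_eq0 -normc_eq0 eq_le normc_ge0 andbT.
have : normc (u n - l) + normc (u n - l') @[n --> \oo] --> (0 + 0 : R) by exact: cvgD.
rewrite addr0 => h; apply: (@ler_cvg_to _ \oo _ _ (fun=> normc (l - l')) _ _ _ (cvg_cst _) h).
by apply: nearW => n /=; apply: le_trans (normc_triangle (u n) _ _) _; rewrite (normcB l).
Qed.

Lemma ccvg_ReIm u l : ccvg u l <->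
  (Re (u n) @[n --> \oo] --> Re l /\ Im (u n) @[n --> \oo] --> Im l).
Proof.
split=> [ul|[h1 h2]].
  split; apply/cvgrPdist_le => e e0; have /cvgrPdist_le /(_ _ e0) := ul;
    apply: filterS => n; rewrite sub0r normrN ger0_norm ?normc_ge0 // => h;
    apply: le_trans h.
    by rewrite -ReN -ReD; apply: le_trans (normr_Re _) _; rewrite normcB.
  by rewrite -ImN -ImD; apply: le_trans (normr_Im _) _; rewrite normcB.
have h1' : `|Re (u n) - Re l| @[n --> \oo] --> (0 : R).
  by apply/norm_cvg0P; apply/subr_cvg0.
have h2' : `|Im (u n) - Im l| @[n --> \oo] --> (0 : R).
  by apply/norm_cvg0P; apply/subr_cvg0.
have h : `|Re (u n) - Re l| + `|Im (u n) - Im l| @[n --> \oo] --> (0 : R).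
  by rewrite -[X in _ --> X](addr0 0); exact: cvgD.
apply: cvg0_squeeze h => n; rewrite normc_ge0 /=.
by apply: le_trans (normc_le_ReIm _) _; rewrite !ReImE.
Qed.

End ComplexNumbers.

(** * Integrals of complex-valued functions *)

Section ComplexIntegral.
Context d (T : measurableType d) (R : realType).
Implicit Types (f g : T -> R[i]).

Definition cmeas f :=
  measurable_fun setT (fun x => Re (f x)) /\ measurable_fun setT (fun x => Im (f x)).

Lemma cmeas_cst c : cmeas (fun=> c).
Proof. by split; exact: measurable_cst. Qed.
Lemma cmeasJ f : cmeas f -> cmeas (fun x => (f x)^*).
Proof.
move=> [f1 f2]; split.
  by under eq_fun do rewrite ReJ.
by under eq_fun do rewrite ImJ; exact: measurableT_comp.
Qed.
Lemma cmeasM f g : cmeas f -> cmeas g -> cmeas (fun x => f x * g x).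
Proof.
move=> [f1 f2] [g1 g2]; split.
  under eq_fun do rewrite ReM.
  by apply: measurable_funB; exact: measurable_funM.
under eq_fun do rewrite ImM.
by apply: measurable_funD; exact: measurable_funM.
Qed.
Lemma cmeas_real (h : T -> R) : measurable_fun setT h -> cmeas (fun x => (h x)%:C).
Proof. by move=> mh; split => //=; exact: measurable_cst. Qed.
Lemma cmeas_norm f : cmeas f -> measurable_fun setT (fun x => normc (f x)).
Proof.
move=> [f1 f2].
rewrite (_ : (fun x => _) = (fun x => Num.sqrt (Re (f x) ^+ 2 + Im (f x) ^+ 2))); last first.
  by apply/funext => x; case: (f x).
apply: (@measurableT_comp _ _ _ _ _ _ (@Num.sqrt R)).
  by apply: continuous_measurable_fun; exact: sqrt_continuous.
by apply: measurable_funD; exact: measurable_funX.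
Qed.
Lemma cmeas_normE f : cmeas f -> measurable_fun setT (fun x => (normc (f x))%:E).
Proof. by move=> /cmeas_norm mf; exact/measurable_EFinP. Qed.

Context (mu : {measure set T -> \bar R}).

(** For Lebesgue measure this unfolds to [cintegral]; the measure is left arbitrary so that
    integrals and lattice sums share one theory. *)
Definition cint f : R[i] := (\int[mu]_x Re (f x)) +i* (\int[mu]_x Im (f x)).

Definition cintg f :=
  mu.-integrable setT (fun x => (Re (f x))%:E) /\ mu.-integrable setT (fun x => (Im (f x))%:E).

Lemma cintg_meas f : cintg f -> cmeas f.
Proof.
by move=> [/integrableP[/measurable_EFinP h1 _] /integrableP[/measurable_EFinP h2 _]].
Qed.

Lemma cintg_le f (h : T -> R) : cmeas f -> mu.-integrable setT (fun x => (h x)%:E) ->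
  (forall x, normc (f x) <= h x) -> cintg f.
Proof.
move=> [f1 f2] ih fh; split; apply: le_integrable ih => //; try exact/measurable_EFinP.
  move=> x _; rewrite /= lee_fin; apply: le_trans (normr_Re _) _.
  by apply: le_trans (fh x) _; exact: ler_norm.
move=> x _; rewrite /= lee_fin; apply: le_trans (normr_Im _) _.
by apply: le_trans (fh x) _; exact: ler_norm.
Qed.

Lemma cintg_norm f : cintg f -> mu.-integrable setT (fun x => (normc (f x))%:E).
Proof.
move=> If; have [i1 i2] := If; have mf := cintg_meas If.
have := integrableD measurableT (integrable_abse i1) (integrable_abse i2).
apply: le_integrable => //; first exact: cmeas_normE.
move=> x _ /=; rewrite lee_fin (ger0_norm (normc_ge0 _)).
by apply: le_trans (normc_le_ReIm _) _; exact: ler_norm.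
Qed.

Lemma integrable_normc_lty f : cmeas f ->
  (\int[mu]_x (normc (f x))%:E < +oo)%E -> mu.-integrable setT (fun x => (normc (f x))%:E).
Proof.
move=> mf h; apply/integrableP; split; first exact: cmeas_normE.
by under eq_integral => x _ do rewrite /= ger0_norm ?normc_ge0 //.
Qed.

Lemma cintg_lty f : cmeas f -> (\int[mu]_x (normc (f x))%:E < +oo)%E -> cintg f.
Proof. by move=> mf h; apply: cintg_le (integrable_normc_lty mf h) _. Qed.

Lemma eq_cint f g : f =1 g -> cint f = cint g.
Proof. by move=> /funext ->. Qed.

Lemma cintgD f g : cintg f -> cintg g -> cintg (fun x => f x + g x).
Proof.
move=> [f1 f2] [g1 g2]; split.
  by under eq_fun do rewrite ReD EFinD; exact: integrableD.
by under eq_fun do rewrite ImD EFinD; exact: integrableD.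
Qed.

Lemma cintD f g : cintg f -> cintg g -> cint (fun x => f x + g x) = cint f + cint g.
Proof.
move=> [f1 f2] [g1 g2]; rewrite /cint; apply: complexP; rewrite ?ReD ?ImD /=.
  by under eq_Rintegral do rewrite ReD; rewrite RintegralD.
by under eq_Rintegral do rewrite ImD; rewrite RintegralD.
Qed.

Lemma cintgZ c f : cintg f -> cintg (fun x => c * f x).
Proof.
move=> If; apply: (cintg_le (h := fun x => normc c * normc (f x))).
- by apply: cmeasM; [exact: cmeas_cst|exact: cintg_meas].
- exact: (integrableZl measurableT (normc c) (cintg_norm If)).
- by move=> x; rewrite normcM.
Qed.

Lemma cintZ c f : cintg f -> cint (fun x => c * f x) = c * cint f.
Proof.
move=> [f1 f2]; rewrite /cint; apply: complexP; rewrite ?ReM ?ImM /=.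
  under eq_Rintegral do rewrite ReM.
  rewrite RintegralB //= ?RintegralZl //.
    exact: (integrableZl measurableT (Re c) f1).
  exact: (integrableZl measurableT (Im c) f2).
under eq_Rintegral do rewrite ImM.
rewrite RintegralD //= ?RintegralZl //.
  exact: (integrableZl measurableT (Re c) f2).
exact: (integrableZl measurableT (Im c) f1).
Qed.

Lemma cintgZr c f : cintg f -> cintg (fun x => f x * c).
Proof. by move=> If; under eq_fun do rewrite mulrC; exact: cintgZ. Qed.

Lemma cintZr c f : cintg f -> cint (fun x => f x * c) = cint f * c.
Proof. by move=> If; rewrite mulrC -cintZ //; apply: eq_cint => x; rewrite mulrC. Qed.

Lemma cintgN f : cintg f -> cintg (fun x => - f x).
Proof. by move=> If; under eq_fun do rewrite -mulN1r; exact: cintgZ. Qed.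

Lemma cintN f : cintg f -> cint (fun x => - f x) = - cint f.
Proof. by move=> If; under eq_cint do rewrite -mulN1r; rewrite cintZ // mulN1r. Qed.

Lemma cintgB f g : cintg f -> cintg g -> cintg (fun x => f x - g x).
Proof. by move=> If Ig; apply: cintgD => //; exact: cintgN. Qed.

Lemma cintB f g : cintg f -> cintg g -> cint (fun x => f x - g x) = cint f - cint g.
Proof. by move=> If Ig; rewrite cintD ?cintN //; exact: cintgN. Qed.

Lemma cint0 : cint (fun=> 0) = 0.
Proof. by rewrite /cint /Rintegral integral0. Qed.

Lemma cintg0 : cintg (fun=> 0).
Proof. by split; exact: integrable0. Qed.

Lemma cintgJ f : cintg f -> cintg (fun x => (f x)^*).
Proof.
move=> [f1 f2]; split; first by under eq_fun do rewrite ReJ.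
by under eq_fun do rewrite ImJ EFinN; exact: integrableN.
Qed.

Lemma cintJ f : cintg f -> cint (fun x => (f x)^*) = (cint f)^*.
Proof.
move=> [f1 f2]; apply: complexP; rewrite ?ReJ ?ImJ /=.
  by apply: eq_Rintegral => x _; rewrite ReJ.
under eq_Rintegral do rewrite ImJ -mulN1r.
by rewrite RintegralZl // mulN1r.
Qed.

Lemma cintg_sum (I : Type) (s : seq I) (F : I -> T -> R[i]) :
  (forall i, cintg (F i)) -> cintg (fun x => \sum_(i <- s) F i x).
Proof.
move=> IF; elim: s => [|i s IH]; first by under eq_fun do rewrite big_nil; exact: cintg0.
by under eq_fun do rewrite big_cons; exact: cintgD.
Qed.

Lemma cint_sum (I : Type) (s : seq I) (F : I -> T -> R[i]) :
  (forall i, cintg (F i)) -> cint (fun x => \sum_(i <- s) F i x) = \sum_(i <- s) cint (F i).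
Proof.
move=> IF; elim: s => [|i s IH].
  by under eq_cint do rewrite big_nil; rewrite big_nil cint0.
under eq_cint do rewrite big_cons.
by rewrite big_cons cintD ?IH //; exact: cintg_sum.
Qed.

(* Rotating the value of the integral onto the positive axis reduces the bound
   to the real one. *)
Lemma normc_cint f : cintg f -> normc (cint f) <= \int[mu]_x normc (f x).
Proof.
move=> If; have [->|I0] := eqVneq (cint f) 0.
  by rewrite normc0; apply: Rintegral_ge0 => x _; exact: normc_ge0.
rewrite -(ler_pM2l (_ : 0 < normc (cint f))) ?normc_gt0 //.
have IJ := cintgZ (cint f)^* If.
have -> : normc (cint f) * normc (cint f) = Re (cint (fun x => (cint f)^* * f x)).
  by rewrite cintZ // [X in Re X]mulrC mulcJ -expr2.
rewrite /= -RintegralZl //; last exact: cintg_norm.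
apply: le_Rintegral => //; first by case: IJ.
  exact: (integrableZl measurableT (normc (cint f)) (cintg_norm If)).
move=> x _; apply: le_trans (ler_norm _) _; apply: le_trans (normr_Re _) _.
by rewrite normcM normcJ.
Qed.

Lemma Rintegral_dominated (fn : nat -> T -> R) (f h : T -> R) :
  (forall n, measurable_fun setT (fn n)) -> measurable_fun setT f ->
  mu.-integrable setT (fun x => (h x)%:E) ->
  (forall n x, `|fn n x| <= h x) -> (forall x, fn n x @[n --> \oo] --> f x) ->
  \int[mu]_x fn n x @[n --> \oo] --> \int[mu]_x f x.
Proof.
move=> mfn mf ih fnh fnf; apply: fine_cvg.
have m1 n : measurable_fun setT (fun x => (fn n x)%:E) by exact/measurable_EFinP.
have m2 : measurable_fun setT (fun x => (f x)%:E) by exact/measurable_EFinP.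
have c1 : {ae mu, forall x, setT x -> (fn n x)%:E @[n --> \oo] --> (f x)%:E}.
  by apply: aeW => x _; apply: cvg_EFin; [exact: nearW|exact: fnf].
have c2 : {ae mu, forall x n, setT x -> (`|(fn n x)%:E| <= (h x)%:E)%E}.
  by apply: aeW => x n _; rewrite lee_fin.
have [i1 _ c] := dominated_convergence measurableT m1 m2 c1 ih c2.
by rewrite fineK //; exact: (integrable_fin_num measurableT).
Qed.

Lemma cint_dominated (fn : nat -> T -> R[i]) f (h : T -> R) :
  (forall n, cmeas (fn n)) -> mu.-integrable setT (fun x => (h x)%:E) ->
  (forall n x, normc (fn n x) <= h x) -> (forall x, ccvg (fn ^~ x) (f x)) ->
  ccvg (fun n => cint (fn n)) (cint f).
Proof.
move=> mfn ih fnh fnf.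
have cf x : Re (fn n x) @[n --> \oo] --> Re (f x) /\ Im (fn n x) @[n --> \oo] --> Im (f x).
  by apply/ccvg_ReIm; exact: fnf.
have mf : cmeas f.
  split.
    apply: (measurable_fun_cvg (h := fun n x => Re (fn n x))) => [n|x _].
      by case: (mfn n).
    by case: (cf x).
  apply: (measurable_fun_cvg (h := fun n x => Im (fn n x))) => [n|x _].
    by case: (mfn n).
  by case: (cf x).
apply/ccvg_ReIm; split.
  apply: (Rintegral_dominated (h := h)) => // [n||n x|x]; [by case: (mfn n)|by case: mf|..].
    exact: le_trans (normr_Re _) _.
  by case: (cf x).
apply: (Rintegral_dominated (h := h)) => // [n||n x|x]; [by case: (mfn n)|by case: mf|..].
  exact: le_trans (normr_Im _) _.
by case: (cf x).
Qed.

End ComplexIntegral.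

(** * Fubini's theorem for complex integrands *)

Section ComplexFubini.
Context d1 d2 (T1 : measurableType d1) (T2 : measurableType d2) (R : realType).
Context (m1 : {sigma_finite_measure set T1 -> \bar R}) (m2 : {sigma_finite_measure set T2 -> \bar R}).

(** Integrability is asked of every section, not of almost every one: the inner real-valued integral
    then agrees everywhere with the extended one. *)
Lemma Rintegral_fubini (f : T1 * T2 -> R) :
  (m1 \x m2)%E.-integrable setT (EFin \o f) ->
  (forall x, m2.-integrable setT (fun y => (f (x, y))%:E)) ->
  (forall y, m1.-integrable setT (fun x => (f (x, y))%:E)) ->
  [/\ m1.-integrable setT (fun x => (\int[m2]_y f (x, y))%:E),
      \int[m1]_x \int[m2]_y f (x, y) = \int[(m1 \x m2)%E]_z f z,
      \int[m1]_x \int[m2]_y f (x, y) = \int[m2]_y \int[m1]_x f (x, y) &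
      m2.-integrable setT (fun y => (\int[m1]_x f (x, y))%:E)].
Proof.
move=> If I1 I2.
have E1 x : (\int[m2]_y f (x, y))%:E = (\int[m2]_y (f (x, y))%:E)%E.
  by rewrite fineK //; exact: (integrable_fin_num measurableT).
have E2 y : (\int[m1]_x f (x, y))%:E = (\int[m1]_x (f (x, y))%:E)%E.
  by rewrite fineK //; exact: (integrable_fin_num measurableT).
split.
- under eq_fun do rewrite E1.
  exact: integrable_fubini_F If.
- congr fine; under eq_integral do rewrite E1; exact: integral12_prod_meas1.
- congr fine; under eq_integral do rewrite E1; under [RHS]eq_integral do rewrite E2.
  exact: Fubini If.
- under eq_fun do rewrite E2.
  have mf := measurable_int _ If.
  apply/integrableP; split; first exact: measurable_fubini_G If.
  apply: (le_lt_trans _ ((integrable21ltyP m1 m2 mf).1 If)).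
  apply: ge0_le_integral => //.
  + by apply: measurableT_comp => //; exact: measurable_fubini_G If.
  + apply: (@measurable_fun_fubini_tonelli_G _ _ T1 T2 R m1 (fun z => `|(f z)%:E|%E)) => //.
    exact: measurableT_comp.
  + move=> y _; apply: le_abse_integral => //.
    by have /integrableP[] := I2 y.
Qed.

Lemma cint_fubini (f : T1 * T2 -> R[i]) : cmeas f ->
  (forall x, cintg m2 (fun y => f (x, y))) ->
  (forall y, cintg m1 (fun x => f (x, y))) ->
  (\int[m1]_x \int[m2]_y (normc (f (x, y)))%:E < +oo)%E ->
  [/\ cintg (m1 \x m2)%E f,
      cintg m1 (fun x => cint m2 (fun y => f (x, y))),
      cint m1 (fun x => cint m2 (fun y => f (x, y))) = cint (m1 \x m2)%E f,
      cint m1 (fun x => cint m2 (fun y => f (x, y))) = cint m2 (fun y => cint m1 (fun x => f (x, y))) &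
      cintg m2 (fun y => cint m1 (fun x => f (x, y)))].
Proof.
move=> mf I1 I2 fin.
have [Ir Ii] : cintg (m1 \x m2)%E f.
  apply: cintg_lty => //; rewrite fubini_tonelli1 //; first exact: cmeas_normE.
  by move=> x; rewrite lee_fin normc_ge0.
have [||a1 b1 c1 e1] := @Rintegral_fubini (fun z => Re (f z)) Ir.
- by move=> x; case: (I1 x).
- by move=> x; case: (I2 x).
have [||a2 b2 c2 e2] := @Rintegral_fubini (fun z => Im (f z)) Ii.
- by move=> x; case: (I1 x).
- by move=> x; case: (I2 x).
by split => //; rewrite /cint; apply: complexP.
Qed.

End ComplexFubini.

(** * Integrals under measure-preserving maps *)

Section MeasurePreserving.
Local Open Scope ereal_scope.
Context d1 d2 (X : measurableType d1) (Y : measurableType d2) (R : realType).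
Context (mu : {measure set X -> \bar R}) (nu : {measure set Y -> \bar R}) (phi : X -> Y).
Context (mphi : measurable_fun setT phi).
Context (phiE : forall A, measurable A -> mu (phi @^-1` A) = nu A).

Let mphi_mixin := isMeasurableFun.Build _ _ _ _ _ mphi.
Let mphi_pack : {mfun X >-> Y} := HB.pack phi mphi_mixin.

Lemma ge0_integral_preserving (f : Y -> \bar R) :
  measurable_fun setT f -> (forall y, 0 <= f y) ->
  \int[mu]_x f (phi x) = \int[nu]_y f y.
Proof.
move=> mf f0; transitivity (\int[pushforward mu mphi_pack]_y f y).
  by rewrite ge0_integral_pushforward.
by apply: eq_measure_integral => A mA _; exact: phiE.
Qed.

Lemma integral_preserving (f : Y -> \bar R) : measurable_fun setT f ->
  mu.-integrable setT (f \o phi) ->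
  \int[mu]_x f (phi x) = \int[nu]_y f y.
Proof.
move=> mf If; transitivity (\int[pushforward mu mphi_pack]_y f y).
  by rewrite integral_pushforward.
by apply: eq_measure_integral => A mA _; exact: phiE.
Qed.

Lemma cint_preserving (f : Y -> R[i]) : cintg nu f ->
  cintg mu (fun x => f (phi x)) /\ cint mu (fun x => f (phi x)) = cint nu f.
Proof.
move=> If; have mf := cintg_meas If.
have mf' : cmeas (fun x => f (phi x)).
  by case: mf => m1 m2; split; [exact: (measurableT_comp m1)|exact: (measurableT_comp m2)].
have If' : cintg mu (fun x => f (phi x)).
  apply: cintg_lty => //.
  rewrite (ge0_integral_preserving (f := fun x => (normc (f x))%:E)) //.
  - have /integrableP [_] := cintg_norm If.
    by under eq_integral do rewrite /= ger0_norm ?normc_ge0 //.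
  - exact: cmeas_normE.
  - by move=> y; rewrite lee_fin normc_ge0.
split => //; have [i1 i2] := If'; have [m1 m2] := mf.
apply: complexP; rewrite /cint /=; congr fine.
  by apply: (integral_preserving (f := fun x => (Re (f x))%:E)) => //; exact/measurable_EFinP.
by apply: (integral_preserving (f := fun x => (Im (f x))%:E)) => //; exact/measurable_EFinP.
Qed.

End MeasurePreserving.

(** * The integers as a discrete measurable space *)

HB.instance Definition _ := isPointed.Build int 0.
HB.instance Definition _ := @isMeasurable.Build default_measure_display
  int discrete_measurable discrete_measurable0
  discrete_measurableC discrete_measurableU.

Section Countable.
Context d1 d2 d3 (T1 : measurableType d1) (T2 : measurableType d2) (T3 : measurableType d3).
Context (cT1 : countable [set: T1]) (mT1 : forall x : T1, measurable [set x]).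

Lemma measurable_fun_countable (f : T1 -> T3) : measurable_fun setT f.
Proof.
move=> _ Y mY; rewrite setTI.
rewrite (_ : _ @^-1` _ = \bigcup_x ([set x] `&` (f @^-1` Y))); last first.
  by apply/seteqP; split => [x Yx|x [y _ [-> Yy]]] //; exists x.
apply: countable_bigcupT_measurable => // x.
have [Yx|nYx] := pselect (Y (f x)).
  by rewrite (_ : _ `&` _ = [set x]) //; apply/seteqP; split => [z [] //|z ->].
by rewrite (_ : _ `&` _ = set0) //; apply/seteqP; split => // z [-> /nYx].
Qed.

(** The preimage is the countable union of the products of a singleton with a section. *)
Lemma measurable_fun_countable_prod (f : T1 * T2 -> T3) :
  (forall x, measurable_fun setT (fun t => f (x, t))) -> measurable_fun setT f.
Proof.
move=> mf _ Y mY; rewrite setTI.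
rewrite (_ : _ @^-1` _ = \bigcup_(x in [set: T1]) ([set x] `*` ((fun t => f (x, t)) @^-1` Y))); last first.
  by apply/seteqP; split => [[x t] Yx|[x t] [y _ [/= -> //]]]; exists x.
apply: countable_bigcupT_measurable => // x; apply: measurableX => //.
by rewrite -[X in measurable X]setTI; exact: mf.
Qed.

End Countable.

(** Lists the integers as 0, -1, 1, -2, 2, ...; it carries series over the naturals to sums over the
    integers. *)
Definition nat_int (n : nat) : int := if odd n then Negz n./2 else Posz n./2.
Lemma bijective_nat_int : bijective nat_int.
Proof.
exists (fun z : int => match z with Posz n => n.*2 | Negz n => n.*2.+1 end).
  by move=> n; rewrite /nat_int; case: ifP => on; rewrite -[RHS](odd_double_half n) on.
by case=> n; rewrite /nat_int /= ?odd_double /= ?doubleK ?uphalf_double.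
Qed.

(* An alias: [counting] already carries the sigma-finite structure of [nat]. *)
Definition zcount (R : realType) : set int -> \bar R := @counting int R.
HB.instance Definition _ (R : realType) := Measure.copy (@zcount R) (@counting int R).

(** * Sums over the integers and over pairs of integers as integrals *)

Section IntegerSums.
Context (R : realType).
Local Notation cnt := (@zcount R).

Lemma countable_int : countable [set: int]. Proof. exact: countableP. Qed.
Lemma countable_int2 : countable [set: int * int]. Proof. exact: countableP. Qed.
Lemma measurable_int2 (x : int * int) : measurable [set x].
Proof.
case: x => a b; rewrite (_ : [set (a, b)] = [set a] `*` [set b]); first exact: measurableX.
by apply/seteqP; split => [_ -> //|[x y] [/= -> ->]].
Qed.

Lemma sigma_finite_counting_int : sigma_finite [set: int] cnt.
Proof.
exists (fun n => [set x : int | (`|x| <= n)%N]).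
  by apply/seteqP; split => // x _; exists `|x|%N => //=.
move=> n; split => //; rewrite /zcount /counting asboolT ?ltry //.
apply: (@sub_finite_set _ _ ((fun k : nat => k%:Z) @` `I_n.+1 `|` (fun k : nat => - k%:Z) @` `I_n.+1)).
  move=> x /= xn; have [x0|x0] := leP 0 x.
    by left; exists `|x|%N => //=; rewrite gez0_abs.
  by right; exists `|x|%N => //=; rewrite ltz0_abs ?opprK.
by rewrite finite_setU; split; apply: finite_image; exact: finite_II.
Qed.
HB.instance Definition _ :=
  @Measure_isSigmaFinite.Build _ _ _ cnt sigma_finite_counting_int.

Lemma measurable_fun_int2 d (T : measurableType d) (f : int * int -> T) : measurable_fun setT f.
Proof. by apply: measurable_fun_countable; [exact: countable_int2|exact: measurable_int2]. Qed.

Lemma cmeas_int (f : int -> R[i]) : cmeas f. Proof. by split. Qed.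
Lemma cmeas_int2 (f : int * int -> R[i]) : cmeas f.
Proof. by split; exact: measurable_fun_int2. Qed.

Lemma counting_bij (T T' : choiceType) (e : T -> T') (A : set T') : bijective e ->
  counting (e @^-1` A) = counting A :> \bar R.
Proof.
move=> [g eK gK]; rewrite /counting.
have E : e @^-1` A = g @` A.
  apply/seteqP; split => [x Ax|_ [y Ay <-]] /=; first by exists (e x).
  by rewrite gK.
have [fA|iA] := pselect (finite_set A).
  have fA' : finite_set (e @^-1` A) by rewrite E; exact: finite_image.
  rewrite !asboolT //; congr (_ %:R)%:E.
  by rewrite E fset_set_image // finmap.card_imfset //; exact: (can_inj gK).
rewrite !asboolF //; apply: contra_not iA => fA.
rewrite (_ : A = e @` (e @^-1` A)); first exact: finite_image.
by apply/seteqP; split => [x Ax|_ [y Ay <-]] //; exists (g x) => /=; rewrite gK.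
Qed.

Lemma cint_cnt_bij (e : int -> int) (f : int -> R[i]) : bijective e ->
  cintg cnt f -> cintg cnt (fun k => f (e k)) /\ cint cnt (fun k => f (e k)) = cint cnt f.
Proof.
by move=> be If; apply: cint_preserving => // A _; exact: counting_bij.
Qed.

(** Links the integral, for which Tonelli is available, to the [\esum] in which frame bounds are
    stated. *)
Lemma integral_cnt_esum (f : int -> \bar R) : (forall k, 0 <= f k)%E ->
  (\int[cnt]_k f k = \esum_(k in [set: int]) f k)%E.
Proof.
move=> f0.
have [g eK gK] := bijective_nat_int.
rewrite -(ge0_integral_preserving (mu := @counting nat R) (phi := nat_int)) //; last first.
  by move=> A _; apply: counting_bij; exact: bijective_nat_int.
rewrite ge0_integral_count // nneseries_esumT //.
rewrite (reindex_esum setT setT nat_int) //; split => //.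
- by move=> x y _ _; exact: (can_inj eK).
- by move=> x _; exists (g x).
Qed.

Lemma integral_cnt2_esum (f : int * int -> \bar R) : (forall k, 0 <= f k)%E ->
  (\int[(cnt \x cnt)%E]_k f k = \esum_(k in [set: int * int]) f k)%E.
Proof.
move=> f0; rewrite fubini_tonelli1 //; last exact: measurable_fun_int2.
rewrite /fubini_F; under eq_integral => m _ do rewrite integral_cnt_esum //.
rewrite integral_cnt_esum; last by move=> m; exact: esum_ge0.
rewrite (esum_esum (a := fun i j => f (i, j)) (J := fun=> setT)) //.
rewrite (_ : _ `*`` _ = setT); last by apply/seteqP; split.
by apply: eq_esum => -[].
Qed.

End IntegerSums.

(** * The complex exponential and its polynomial approximants *)

Section ComplexExponential.
Context {R : realType}.
Implicit Types (z w : R[i]).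

Definition cexp z : R[i] := (expR (Re z) * cos (Im z)) +i* (expR (Re z) * sin (Im z)).

Lemma cexp0 : cexp 0 = 1.
Proof. by rewrite /cexp /= expR0 cos0 sin0 mulr1 mulr0. Qed.
Lemma cexpD z w : cexp (z + w) = cexp z * cexp w.
Proof. by apply: complexP; rewrite !ReImE /= ReD ImD expRD ?cosD ?sinD; ring. Qed.
Lemma normc_cexp z : normc (cexp z) = expR (Re z).
Proof.
rewrite /cexp /= !exprMn -mulrDr cos2Dsin2 mulr1 sqrtr_sqr ger0_norm //; exact: expR_ge0.
Qed.
Lemma cexp_neq0 z : cexp z != 0.
Proof. by rewrite -normc_gt0 normc_cexp expR_gt0. Qed.
Lemma cexpN z : cexp (- z) = (cexp z)^-1.
Proof.
by apply: (mulfI (cexp_neq0 z)); rewrite -cexpD subrr cexp0 divff // cexp_neq0.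
Qed.
Lemma cexpMn z n : cexp (z *+ n) = cexp z ^+ n.
Proof. by elim: n => [|n IH]; rewrite ?mulr0n ?cexp0 ?expr0 // mulrS cexpD IH exprS. Qed.
Lemma cexp_real (x : R) : cexp x%:C = (expR x)%:C.
Proof. by rewrite /cexp /= cos0 sin0 mulr1 mulr0. Qed.
Lemma cexpJ z : cexp (z^*) = (cexp z)^*.
Proof. by apply: complexP; rewrite /cexp /= !ReImE /= ?cosN ?sinN ?mulrN. Qed.
Lemma expi_cexp (t : R) : expi t = cexp (0 +i* t).
Proof. by rewrite /expi /cexp /= expR0 !mul1r. Qed.
Lemma cexp_pi : cexp (0 +i* pi) = -1 :> R[i].
Proof. by apply: complexP; rewrite /cexp /= expR0 ?cospi ?sinpi mul1r ?oppr0. Qed.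

Lemma cmeas_cexp d (T : measurableType d) (f : T -> R[i]) : cmeas f -> cmeas (fun x => cexp (f x)).
Proof.
move=> [m1 m2]; have m3 : measurable_fun setT (fun x => expR (Re (f x))).
  exact: (measurableT_comp (@measurable_expR R) m1).
split => /=; apply: measurable_funM => //.
  apply: (measurableT_comp _ m2); apply: continuous_measurable_fun; exact: continuous_cos.
apply: (measurableT_comp _ m2); apply: continuous_measurable_fun; exact: continuous_sin.
Qed.

(* Mean value inequality: project [f 1 - f 0] on its own direction. *)
Lemma normc_mvt (f df : R -> R[i]) (M : R) :
  (forall t : R, is_derive t 1 (fun x => Re (f x)) (Re (df t))) ->
  (forall t : R, is_derive t 1 (fun x => Im (f x)) (Im (df t))) ->
  (forall t, 0 <= t <= 1 -> normc (df t) <= M) -> normc (f 1 - f 0) <= M.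
Proof.
move=> d1 d2 dM; set c : R[i] := f 1 - f 0.
have [c0|c0] := eqVneq c 0.
  by rewrite c0 normc0; apply: le_trans (dM 0 _); rewrite ?normc_ge0 ?lexx ?ler01.
pose p x := Re c * Re (f x) + Im c * Im (f x).
have dp (t : R) : is_derive t (1 : R) p (Re c * Re (df t) + Im c * Im (df t)).
  have e1 := d1 t; have e2 := d2 t; rewrite /p.
  by apply: is_deriveD; apply: is_deriveZ.
have cp : {within `[0, 1], continuous p}.
  by apply: derivable_within_continuous => t _; exact: ex_derive.
have [x x01] := @MVT R p _ 0 1 ltr01 (fun x _ => dp x) cp.
rewrite subr0 mulr1 => E.
rewrite -(ler_pM2l (_ : 0 < normc c)) ?normc_gt0 //.
have <- : p 1 - p 0 = normc c * normc c.
  by rewrite -expr2 normc_sqr /p {5 6}/c !ReImE; ring.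
rewrite E.
have -> : Re c * Re (df x) + Im c * Im (df x) = Re (c^* * df x) by rewrite !ReImE; ring.
apply: le_trans (ler_norm _) _; apply: le_trans (normr_Re _) _.
rewrite normcM normcJ ler_wpM2l ?normc_ge0 // dM //.
by move: x01; rewrite in_itv /= => /andP[/ltW -> /ltW ->].
Qed.

Lemma is_derive_mul (a t : R) : is_derive t (1 : R) (fun x : R => a * x) a.
Proof.
by have := is_deriveZ (f := id) a (is_derive_id t (1 : R)); rewrite /GRing.scale /= mulr1.
Qed.

Lemma is_derive_cexpM z (t : R) :
  is_derive t 1 (fun x : R => Re (cexp (x%:C * z))) (Re (z * cexp (t%:C * z))) /\
  is_derive t 1 (fun x : R => Im (cexp (x%:C * z))) (Im (z * cexp (t%:C * z))).
Proof.
case: z => a b.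
have E1 : (fun x : R => Re (cexp (x%:C * (a +i* b)))) = (fun x => expR (a * x) * cos (b * x)).
  by apply/funext => x; rewrite /cexp /= !mul0r subr0 addr0 !(mulrC x).
have E2 : (fun x : R => Im (cexp (x%:C * (a +i* b)))) = (fun x => expR (a * x) * sin (b * x)).
  by apply/funext => x; rewrite /cexp /= !mul0r subr0 addr0 !(mulrC x).
rewrite E1 E2 !ReImE /cexp /= !mul0r subr0 addr0.
have da := is_derive_mul a t; have db := is_derive_mul b t.
have de : is_derive t 1 (fun x : R => expR (a * x)) (expR (a * t) * a).
  by apply: (@is_derive1_comp _ expR).
have dc : is_derive t 1 (fun x : R => cos (b * x)) (- sin (b * t) * b).
  by apply: (@is_derive1_comp _ cos).
have ds : is_derive t 1 (fun x : R => sin (b * x)) (cos (b * t) * b).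
  by apply: (@is_derive1_comp _ sin).
split.
  apply: (is_derive_eq (is_deriveM de dc)).
  by rewrite !(mulrC t) /GRing.scale /=; ring.
apply: (is_derive_eq (is_deriveM de ds)).
by rewrite !(mulrC t) /GRing.scale /=; ring.
Qed.

Lemma normc_scaled (t : R) z : 0 <= t <= 1 -> normc (t%:C * z) <= normc z.
Proof.
move=> /andP[t0 t1]; rewrite normcM normcR ger0_norm //.
by rewrite ler_piMl // normc_ge0.
Qed.

Lemma normc_cexp_le z : normc (cexp z) <= expR (normc z).
Proof. by rewrite normc_cexp ler_expR; apply: le_trans (normr_Re z); exact: ler_norm. Qed.

Lemma cexp_sub1_le z : normc (cexp z - 1) <= normc z * expR (normc z).
Proof.
have := @normc_mvt (fun t => cexp (t%:C * z)) (fun t => z * cexp (t%:C * z))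
  (normc z * expR (normc z)).
rewrite mul1r mul0r cexp0; apply => [t|t|t t01].
- by case: (is_derive_cexpM z t).
- by case: (is_derive_cexpM z t).
rewrite normcM ler_wpM2l ?normc_ge0 //; apply: le_trans (normc_cexp_le _) _.
by rewrite ler_expR normc_scaled.
Qed.

(** The mean value inequality for t |-> e^(t z) - t z, with the first-order bound inserted for its
    derivative. *)
Lemma cexp_sub1z_le z : normc (cexp z - 1 - z) <= normc z ^+ 2 * expR (normc z).
Proof.
have := @normc_mvt (fun t => cexp (t%:C * z) - t%:C * z) (fun t => z * cexp (t%:C * z) - z)
  (normc z ^+ 2 * expR (normc z)).
rewrite mul1r mul0r cexp0 subr0 addrAC; apply => [t|t|t t01].
- have [e1 _] := is_derive_cexpM z t.
  have e2 : is_derive t 1 (fun x : R => Re (x%:C * z)) (Re z).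
    under eq_fun do rewrite ReM /= mul0r subr0 mulrC.
    exact: is_derive_mul.
  under eq_fun do rewrite ReD ReN.
  by rewrite ReD ReN; exact: is_deriveB.
- have [_ e1] := is_derive_cexpM z t.
  have e2 : is_derive t 1 (fun x : R => Im (x%:C * z)) (Im z).
    under eq_fun do rewrite ImM /= mul0r addr0 mulrC.
    exact: is_derive_mul.
  under eq_fun do rewrite ImD ImN.
  by rewrite ImD ImN; exact: is_deriveB.
rewrite (_ : _ - z = z * (cexp (t%:C * z) - 1)); last by ring.
rewrite normcM expr2 -mulrA ler_wpM2l ?normc_ge0 //.
apply: le_trans (cexp_sub1_le _) _.
by apply: ler_pM; rewrite ?normc_ge0 ?expR_ge0 ?normc_scaled // ler_expR normc_scaled.
Qed.

Lemma normc_subX_le z w (M : R) n : normc z <= M -> normc w <= M ->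
  normc (z ^+ n - w ^+ n) <= n%:R * M ^+ n.-1 * normc (z - w).
Proof.
move=> zM wM; have M0 : 0 <= M by exact: le_trans (normc_ge0 _) zM.
elim: n => [|n IH]; first by rewrite !expr0 subrr normc0 !mul0r.
rewrite !exprS (_ : _ - _ = z * (z ^+ n - w ^+ n) + (z - w) * w ^+ n); last by ring.
apply: le_trans (normcD _ _) _; rewrite !normcM normcX /=.
rewrite -natr1 !mulrDl mul1r; apply: lerD.
  case: n IH => [_|n IH]; first by rewrite !expr0 subrr normc0 mulr0 !mul0r.
  apply: le_trans (ler_pM _ _ zM IH) _; rewrite ?normc_ge0 //.
  by rewrite /= mulrA mulrCA -exprS.
rewrite mulrC ler_wpM2r ?normc_ge0 //.
by apply: lerXn2r; rewrite ?nnegrE ?normc_ge0.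
Qed.

(** For these powers the bound by e^|z|, uniform in n, is immediate, and a polynomial substituted
    for z leaves a polynomial. *)
Definition cexp_approx (z : R[i]) (n : nat) := (1 + z / n.+1%:R%:C) ^+ n.+1.

Lemma cexp_approx_le z n : normc (cexp_approx z n) <= expR (normc z).
Proof.
rewrite /cexp_approx normcX.
have -> : expR (normc z) = expR (normc z / n.+1%:R) ^+ n.+1.
  by rewrite -expRM_natl mulrC divfK // pnatr_eq0.
apply: lerXn2r; rewrite ?nnegrE ?normc_ge0 ?expR_ge0 //.
apply: le_trans (normcD _ _) _; rewrite normc1 normcM normcV normcR ger0_norm //.
exact: expR_ge1Dx.
Qed.

(** Compare the (n+1)-th powers of 1 + a and e^a with a = z / (n + 1): both have modulus at most
    e^|a| and they differ by O(|a|^2), so the powers differ by O(1/n). *)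
Lemma cvg_cexp_approx z : ccvg (cexp_approx z) (cexp z).
Proof.
have H n : normc (cexp_approx z n - cexp z) <=
   (expR (normc z) * normc z ^+ 2 * expR (normc z)) * n.+1%:R^-1.
  set a := z / n.+1%:R%:C.
  have na : normc a = normc z / n.+1%:R by rewrite /a normcM normcV normcR ger0_norm.
  have n0 : (n.+1%:R : R) != 0 by rewrite pnatr_eq0.
  have -> : cexp z = cexp a ^+ n.+1.
    rewrite -cexpMn -mulr_natr /a; congr cexp.
    rewrite -mulrA (_ : n.+1%:R = n.+1%:R%:C :> R[i]) ?mulVf ?mulr1 //; last by rewrite rmorph_nat.
    by rewrite -(inj_eq (@complexI R)) /= in n0 *; apply: contra_neq n0 => -[->].
  have h1 : normc (1 + a) <= expR (normc a).
    by apply: le_trans (normcD _ _) _; rewrite normc1 expR_ge1Dx.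
  apply: le_trans (normc_subX_le n.+1 h1 (normc_cexp_le a)) _.
  have h2 : expR (normc a) ^+ n.+1.-1 <= expR (normc z).
    rewrite -expRM_natl ler_expR na /= mulrCA ler_piMr ?normc_ge0 //.
    by rewrite ler_pdivrMr ?ltr0n // mul1r ler_nat.
  have h3 : normc (1 + a - cexp a) <= normc a ^+ 2 * expR (normc a).
    by rewrite normcB opprD addrA; exact: cexp_sub1z_le.
  have h4 : expR (normc a) <= expR (normc z).
    by rewrite ler_expR na ler_piMr ?normc_ge0 // invf_le1 ?ltr0n // ler1n.
  apply: (@le_trans _ _ (n.+1%:R * expR (normc z) * (normc a ^+ 2 * expR (normc z)))).
    apply: ler_pM; rewrite ?normc_ge0 ?mulr_ge0 ?exprn_ge0 ?expR_ge0 //.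
      by rewrite ler_wpM2l.
    by apply: le_trans h3 _; rewrite ler_wpM2l // exprn_ge0 // normc_ge0.
  by rewrite na le_eqVlt; apply/orP; left; apply/eqP; field.
apply: (cvg0_squeeze (b := fun n => (expR (normc z) * normc z ^+ 2 * expR (normc z)) * n.+1%:R^-1)).
  by move=> n; rewrite normc_ge0 H.
rewrite -[X in _ --> X](mulr0 (expR (normc z) * normc z ^+ 2 * expR (normc z))).
apply: cvgM; first exact: cvg_cst.
exact: cvg_harmonic.
Qed.

End ComplexExponential.

(** * Measurability of elementary real functions *)

Section RealMeasurability.
Context d (T : measurableType d) (R : realType).
Implicit Types f : T -> R.

Lemma measurable_fun_opp f : measurable_fun setT f -> measurable_fun setT (fun x => - f x).
Proof. by move=> mf; exact: measurableT_comp. Qed.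
Lemma measurable_fun_expR f : measurable_fun setT f -> measurable_fun setT (fun x => expR (f x)).
Proof. by move=> mf; exact: measurableT_comp. Qed.
Lemma measurable_fun_cos f : measurable_fun setT f -> measurable_fun setT (fun x => cos (f x)).
Proof.
move=> mf; apply: (measurableT_comp _ mf); apply: continuous_measurable_fun; exact: continuous_cos.
Qed.
Lemma measurable_fun_sin f : measurable_fun setT f -> measurable_fun setT (fun x => sin (f x)).
Proof.
move=> mf; apply: (measurableT_comp _ mf); apply: continuous_measurable_fun; exact: continuous_sin.
Qed.
Lemma measurable_fun_norm f : measurable_fun setT f -> measurable_fun setT (fun x => `|f x|).
Proof. by move=> mf; exact: measurableT_comp. Qed.

End RealMeasurability.

Ltac rmeas := repeat (first
  [ exact: measurable_cst | exact: measurable_id | assumption | exact: measurable_fst | exact: measurable_snd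
  | apply: measurable_fun_expR | apply: measurable_fun_cos | apply: measurable_fun_sin
  | apply: measurable_fun_norm | apply: measurable_fun_opp
  | apply: measurable_funD | apply: measurable_funB | apply: measurable_funM
  | apply: measurable_funX ]).

(** * Lebesgue measure: translations, Gaussian integrals, unfolding over the integers *)

Section LebesgueGaussian.
Context (R : realType).
Local Notation leb := (@lebesgue_measure R).
Local Notation cnt := (@zcount R).

(** The image of the measure under the shift agrees with it on half-open intervals, which determine
    it. *)
Lemma lebesgue_measure_shift (c : R) (A : set (measurableTypeR R)) : measurable A ->
  leb ((fun x : R => x + c) @^-1` A) = leb A.
Proof.
move=> mA.
have mc : measurable_fun setT (fun x : measurableTypeR R => (x + c : measurableTypeR R)).
  by apply: measurable_funD => //; exact: measurable_cst.
pose mixin := isMeasurableFun.Build _ _ _ _ _ mc.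
pose p : {mfun measurableTypeR R >-> measurableTypeR R} := HB.pack (fun x : measurableTypeR R => (x + c : measurableTypeR R)) mixin.
symmetry; apply: (@lebesgue_measure_unique _ (pushforward leb p)) => // _ [[a b]] _ <-.
have E : (fun x : R => x + c) @^-1` [set` `]a, b]] = [set` `]a - c, b - c]].
  by apply/seteqP; split => x /=; rewrite !in_itv /= ltrBlDr lerBrDr.
transitivity (leb [set` `]a - c, b - c]]); last by congr (leb _); rewrite -E.
rewrite !lebesgue_measure_itv /= !lte_fin ltrD2r; case: ifP => // _.
by rewrite -!EFinB; congr EFin; ring.
Qed.

Lemma ge0_integral_shift (c : R) (f : R -> \bar R) : measurable_fun setT f ->
  (forall x, 0 <= f x)%E -> (\int[leb]_x f (x + c)%R = \int[leb]_x f x)%E.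
Proof.
move=> mf f0; apply: (ge0_integral_preserving (mu := leb) (nu := leb) (phi := fun x : R => x + c) _ _ mf f0).
  exact: measurable_funD.
by move=> A mA; exact: lebesgue_measure_shift.
Qed.

Lemma cint_shift (c : R) (f : R -> R[i]) : cintg leb f ->
  cintg leb (fun x => f (x + c)) /\ cint leb (fun x => f (x + c)) = cint leb f.
Proof.
move=> If; apply: (cint_preserving (mu := leb) (nu := leb) (phi := fun x : R => x + c) _ _ If).
  exact: measurable_funD.
by move=> A mA; exact: lebesgue_measure_shift.
Qed.

Lemma measurable_gauss (a m : R) : measurable_fun setT (fun x : R => expR (- (a * (x - m) ^+ 2))).
Proof. by rmeas. Qed.

(** A rescaled normal density of mean m and variance 1 / (2 a). *)
Lemma integral_gauss (a m : R) : 0 < a ->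
  (\int[leb]_x (expR (- (a * (x - m) ^+ 2)))%:E)%E = (Num.sqrt (pi / a))%:E.
Proof.
move=> a0; pose s := Num.sqrt (2 * a)^-1.
have s2 : s ^+ 2 = (2 * a)^-1 by rewrite sqr_sqrtr // invr_ge0 mulr_ge0 // ltW.
have s0 : s != 0 by rewrite sqrtr_eq0 -ltNge invr_gt0 mulr_gt0.
have pk : normal_peak s != 0 by rewrite gt_eqF // normal_peak_gt0.
have := integral_normal_pdf m s; rewrite normal_pdfE // => H.
transitivity ((normal_peak s)^-1%:E * \int[leb]_x (normal_peak s * normal_fun m s x)%:E)%E.
  rewrite -ge0_integralZl //.
  - apply: eq_integral => x _; rewrite -EFinM (mulrA (normal_peak s)^-1) mulVf // mul1r /normal_fun s2.
    by congr (expR _)%:E; rewrite -mulr_natl; field; rewrite gt_eqF.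
  - apply/measurable_EFinP; apply: measurable_funM => //; exact: measurable_normal_fun.
  - by move=> x _; rewrite lee_fin mulr_ge0 ?normal_peak_ge0 ?normal_fun_ge0.
  - by rewrite lee_fin invr_ge0 normal_peak_ge0.
rewrite H mule1 /normal_peak invrK s2 -mulr_natl; congr (Num.sqrt _)%:E.
by field; rewrite gt_eqF.
Qed.

Lemma integrable_gauss (a m : R) : 0 < a ->
  leb.-integrable setT (fun x : R => (expR (- (a * (x - m) ^+ 2)))%:E).
Proof.
move=> a0; apply/integrableP; split; first by apply/measurable_EFinP; exact: measurable_gauss.
under eq_integral do rewrite /= ger0_norm ?expR_ge0 //.
by rewrite integral_gauss // ltry.
Qed.

Lemma zcount_set1 (k : int) : @zcount R [set k] = 1%E.
Proof.
rewrite /zcount /counting asboolT; last exact: finite_set1.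
by rewrite fset_set1 finmap.cardfs1.
Qed.

(** Half-open, so that the integer translates partition the line. *)
Definition ind01 (t : R) : R := \1_(`[0, 1[%classic : set R) t.

Lemma ind01_ge0 t : 0 <= ind01 t. Proof. by rewrite /ind01 indicE ler0n. Qed.
Lemma ind01_itv t : ind01 t = (0 <= t < 1)%R%:R.
Proof. by rewrite /ind01 indicE; congr (nat_of_bool _)%:R; apply/idP/idP; rewrite inE /= in_itv. Qed.

Lemma sum_indic_unit (x : R) : (\int[cnt]_m (ind01 (x - m%:~R))%:E = 1)%E.
Proof.
rewrite (_ : (fun m : int => _) = (fun m => (\1_[set Num.floor x] m)%:E)); last first.
  apply/funext => m; rewrite /ind01 !indicE; congr (_ %:R)%:E; congr nat_of_bool.
  apply/idP/idP; rewrite !inE /= in_itv /=; [move=> /andP[h1 h2]|move=> ->].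
    apply/esym/floor_def; rewrite intrD; apply/andP; split.
      by rewrite -subr_ge0.
    by rewrite -ltrBlDl.
  by rewrite subr_ge0 floor_le /= ltrBlDl -intrD1 (andP (floor_itv x)).2.
by rewrite integral_indic // setIT; exact: zcount_set1.
Qed.

Lemma measurable_indic01 : measurable_fun setT ind01.
Proof. exact: measurable_indic. Qed.

(** The integer translates of [ind01] sum to one; Tonelli and translation invariance do the rest. *)
Lemma ge0_integral_unfold (f : R -> \bar R) : measurable_fun setT f -> (forall x, 0 <= f x)%E ->
  (\int[leb]_x f x = \int[cnt]_m \int[leb]_t ((ind01 t)%:E * f (t + m%:~R)%R))%E.
Proof.
move=> mf f0.
have fm m : (\int[leb]_t ((ind01 t)%:E * f (t + m%:~R)%R) =
   \int[leb]_t ((ind01 (t - m%:~R)%R)%:E * f t))%E.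
  rewrite -(ge0_integral_shift m%:~R (f := fun t => ((ind01 (t - m%:~R)%R)%:E * f t)%E)).
  - by apply: eq_integral => t _; rewrite addrK.
  - apply: emeasurable_funM => //; apply/measurable_EFinP.
    by apply: (measurableT_comp measurable_indic01); exact: measurable_funB.
  - by move=> x; rewrite mule_ge0 // lee_fin ind01_ge0.
under [RHS]eq_integral do rewrite fm.
have mh : measurable_fun setT (fun z : int * R => ((ind01 (z.2 - z.1%:~R)%R)%:E * f z.2)%E).
  apply: measurable_fun_countable_prod; [exact: countable_int|by []|].
  move=> m /=; apply: emeasurable_funM => //; apply/measurable_EFinP.
  by apply: (measurableT_comp measurable_indic01); exact: measurable_funB.
rewrite (@fubini_tonelli _ _ _ _ R cnt leb _ mh); last first.
  by move=> z; rewrite mule_ge0 // lee_fin ind01_ge0.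
apply: eq_integral => x _ /=; rewrite ge0_integralZr //.
  by rewrite sum_indic_unit mul1e.
by move=> m _; rewrite lee_fin ind01_ge0.
Qed.

Lemma cint_unfold (f : R -> R[i]) : cintg leb f ->
  (forall t, cintg cnt (fun m : int => f (t + m%:~R))) ->
  cintg leb (fun t => (ind01 t)%:C * cint cnt (fun m : int => f (t + m%:~R))) /\
  cint leb f = cint leb (fun t => (ind01 t)%:C * cint cnt (fun m : int => f (t + m%:~R))).
Proof.
move=> If Ifm; have mf := cintg_meas If.
have n1 (x : R) : normc ((ind01 x)%:C) = ind01 x.
  by rewrite normcR ger0_norm // ind01_ge0.
have n1le (x : R) (z : R[i]) : normc ((ind01 x)%:C * z) <= normc z.
  by rewrite normcM n1 /ind01 indicE; case: (_ \in _); rewrite ?mul1r // mul0r normc_ge0.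
have mI c : cmeas (fun t : R => (ind01 (t + c))%:C).
  apply: cmeas_real; apply: (measurableT_comp measurable_indic01); exact: measurable_funD.
have mI0 : cmeas (fun t : R => (ind01 t)%:C).
  exact: cmeas_real measurable_indic01.
have fin : (\int[leb]_x (normc (f x))%:E < +oo)%E.
  have /integrableP [_] := cintg_norm If.
  by under eq_integral do rewrite /= ger0_norm ?normc_ge0 //.
have Is m := (cint_shift m%:~R If).1.
have mg : cmeas (fun z : int * R => (ind01 z.2)%:C * f (z.2 + z.1%:~R)).
  by split; (apply: measurable_fun_countable_prod; [exact: countable_int|by []|]) => m /=;
    case: (cmeasM mI0 (cintg_meas (Is m))).
(* Fubini for the translates of f over the unit interval: exchanges the sum over m with the integral
   over t. *)
have [|||a1 a2 a3 a4 a5] := @cint_fubini _ _ _ _ R cnt leb _ mg.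
- move=> m /=; apply: cintg_le (cintg_norm (Is m)) _ => [|t]; last exact: n1le.
  by apply: cmeasM => //; exact: cintg_meas.
- by move=> t /=; apply: cintgZ; exact: Ifm.
- rewrite /= (_ : (\int[_]_x _)%E = (\int[leb]_x (normc (f x))%:E)%E) //.
  rewrite (ge0_integral_unfold (f := fun x => (normc (f x))%:E)).
  + by apply: eq_integral => m _; apply: eq_integral => t _; rewrite normcM n1 EFinM.
  + exact: cmeas_normE.
  + by move=> x; rewrite lee_fin normc_ge0.
have mg' : cmeas (fun z : int * R => (ind01 (z.2 - z.1%:~R))%:C * f z.2).
  by split; (apply: measurable_fun_countable_prod; [exact: countable_int|by []|]) => m /=;
    case: (cmeasM (mI (- m%:~R)) mf).
have i01 x : cintg cnt (fun m : int => (ind01 (x - m%:~R))%:C).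
  apply: cintg_lty; first exact: cmeas_int.
  by under eq_integral do rewrite n1; rewrite sum_indic_unit ltry.
(* Fubini for the untranslated f: cuts its integral into the pieces over [m, m + 1). *)
have [|||b1 b2 b3 b4 b5] := @cint_fubini _ _ _ _ R cnt leb _ mg'.
- move=> m /=; apply: cintg_le (cintg_norm If) _ => [|t]; last exact: n1le.
  by apply: cmeasM => //; exact: mI.
- by move=> t /=; apply: cintgZr; exact: i01.
- rewrite /= (_ : (\int[_]_x _)%E = (\int[leb]_x (normc (f x))%:E)%E) //.
  rewrite (ge0_integral_unfold (f := fun x => (normc (f x))%:E)).
  + apply: eq_integral => m _.
    rewrite -(ge0_integral_shift m%:~R (f := fun t => (normc ((ind01 (t - m%:~R))%:C * f t))%:E)).
    * by apply: eq_integral => t _; rewrite addrK normcM n1 EFinM.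
    * by apply: cmeas_normE; apply: cmeasM (mI _) mf.
    * by move=> x; rewrite lee_fin normc_ge0.
  + exact: cmeas_normE.
  + by move=> x; rewrite lee_fin normc_ge0.
have s1 x : cint cnt (fun m : int => (ind01 (x - m%:~R))%:C) = 1.
  by apply: complexP; rewrite /cint /= /Rintegral ?sum_indic_unit // integral0.
have E : cint leb f = cint cnt (fun m : int => cint leb (fun t => (ind01 t)%:C * f (t + m%:~R))).
  transitivity (cint leb (fun x => cint cnt (fun m : int => (ind01 (x - m%:~R))%:C * f x))).
    by apply: eq_cint => x; rewrite cintZr ?s1 ?mul1r //; exact: i01.
  rewrite -[LHS]b4; apply: eq_cint => m /=.
  have If' : cintg leb (fun x => (ind01 (x - m%:~R))%:C * f x).
    apply: cintg_le (cintg_norm If) _ => [|t]; last exact: n1le.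
    by apply: cmeasM => //; exact: mI.
  by rewrite -(cint_shift m%:~R If').2; apply: eq_cint => t; rewrite addrK.
have E2 t : cint cnt (fun m : int => (ind01 t)%:C * f (t + m%:~R)) =
   (ind01 t)%:C * cint cnt (fun m : int => f (t + m%:~R)).
  by rewrite cintZ //; exact: Ifm.
split; last by rewrite E a4; apply: eq_cint => t; rewrite /= E2.
by move: a5; under eq_fun do rewrite /= E2.
Qed.

End LebesgueGaussian.

(** * Gaussian sums over the integers compared with integrals *)

Section GaussianTransform.
Context (R : realType).
Local Notation leb := (@lebesgue_measure R).
Local Notation cnt := (@zcount R).

Lemma integral_ind01 : (\int[leb]_t (ind01 t)%:E = 1)%E.
Proof.
by rewrite /ind01 integral_indic //= setIT lebesgue_measure_itv /= lte01 oppr0 adde0.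
Qed.

(** Since (p + t)^2 <= 2 p^2 + 2 t^2, moving an integer by t in [0, 1) costs at most the factor e^a
    once the exponent is halved. *)
Lemma zsum_gauss_le (a x : R) : 0 < a ->
  (\int[cnt]_m (expR (- (a * (m%:~R - x) ^+ 2)))%:E <= (expR a * Num.sqrt (pi / (a / 2)))%:E)%E.
Proof.
move=> a0; have a20 : 0 < a / 2 by rewrite divr_gt0.
pose h t := expR a * expR (- (a / 2 * (t - x) ^+ 2)).
have mh : measurable_fun setT (fun t => (h t)%:E).
  by apply/measurable_EFinP; rewrite /h; rmeas.
have h0 t : 0 <= h t by rewrite mulr_ge0 ?expR_ge0.
rewrite EFinM -(integral_gauss x a20) -ge0_integralZl //; last first.
  by apply/measurable_EFinP; exact: measurable_gauss.
rewrite [leRHS](_ : _ = (\int[leb]_t (h t)%:E)%E) //.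
rewrite (ge0_integral_unfold mh); last by move=> t; rewrite lee_fin.
apply: ge0_le_integral => // m _.
have mi : measurable_fun setT (fun t => (ind01 t)%:E : \bar R).
  by apply/measurable_EFinP; exact: measurable_indic01.
apply: (@le_trans _ _ (\int[leb]_t ((ind01 t)%:E * (expR (- (a * (m%:~R - x) ^+ 2)))%:E))%E).
  rewrite ge0_integralZr //; last by move=> t _; rewrite lee_fin ind01_ge0.
  by rewrite integral_ind01 mul1e.
apply: ge0_le_integral => //.
- by move=> t _; rewrite mule_ge0 // lee_fin ?ind01_ge0 ?expR_ge0.
- by apply: emeasurable_funM => //; apply/measurable_EFinP.
- apply: emeasurable_funM => //; apply/measurable_EFinP; rewrite /h; rmeas.
- move=> t _; rewrite -!EFinM lee_fin ind01_itv.
  have [/andP[t0 t1]|] := boolP (0 <= t < 1); last by rewrite !mul0r.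
  rewrite !mul1r /h -expRD ler_expR -subr_ge0.
  set p := m%:~R - x.
  rewrite (_ : _ - - _ = a * ((p - t) ^+ 2 / 2 + (1 - t ^+ 2))); last by rewrite /p; field.
  rewrite mulr_ge0 ?(ltW a0) // addr_ge0 // ?divr_ge0 ?sqr_ge0 //.
  by rewrite subr_ge0 expr_le1 // ltW.
Qed.

(** The reverse comparison: p^2 <= 2 (p + t)^2 + 2 t^2, hence the doubled exponent and the factor
    e^(-2 a). *)
Lemma zsum_gauss_ge (a : R) : 0 < a ->
  ((expR (- (2 * a)) * Num.sqrt (pi / (2 * a)))%:E <= \int[cnt]_m (expR (- (a * m%:~R ^+ 2)))%:E)%E.
Proof.
move=> a0; have a20 : 0 < 2 * a by rewrite mulr_gt0.
pose h t := expR (- (2 * a)) * expR (- (2 * a * (t - 0) ^+ 2)).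
have mh : measurable_fun setT (fun t => (h t)%:E).
  by apply/measurable_EFinP; rewrite /h; rmeas.
have h0 t : 0 <= h t by rewrite mulr_ge0 ?expR_ge0.
rewrite EFinM -(integral_gauss 0 a20) -ge0_integralZl //; last first.
  by apply/measurable_EFinP; exact: measurable_gauss.
rewrite [leLHS](_ : _ = (\int[leb]_t (h t)%:E)%E) //.
rewrite (ge0_integral_unfold mh); last by move=> t; rewrite lee_fin.
have mi : measurable_fun setT (fun t => (ind01 t)%:E : \bar R).
  by apply/measurable_EFinP; exact: measurable_indic01.
apply: ge0_le_integral => // m _.
  by apply: integral_ge0 => t _; rewrite mule_ge0 // lee_fin ?ind01_ge0.
apply: (@le_trans _ _ (\int[leb]_t ((ind01 t)%:E * (expR (- (a * m%:~R ^+ 2)))%:E))%E); last first.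
  rewrite ge0_integralZr //; last by move=> t _; rewrite lee_fin ind01_ge0.
  by rewrite integral_ind01 mul1e.
apply: ge0_le_integral => //.
- by move=> t _; rewrite mule_ge0 // lee_fin ?ind01_ge0 ?expR_ge0.
- apply: emeasurable_funM => //; apply/measurable_EFinP; rewrite /h; rmeas.
- by apply: emeasurable_funM => //; apply/measurable_EFinP.
- move=> t _; rewrite -!EFinM lee_fin ind01_itv.
  have [/andP[t0 t1]|] := boolP (0 <= t < 1); last by rewrite !mul0r.
  rewrite !mul1r /h -expRD ler_expR -subr_ge0.
  set p := m%:~R.
  rewrite (_ : _ - _ = a * ((p + 2 * t) ^+ 2 + 2 * (1 - t ^+ 2))); last by rewrite /p; ring.
  have t2 : t ^+ 2 <= 1 by rewrite expr_le1 // ltW.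
  by apply: mulr_ge0; [exact: ltW|apply: addr_ge0; [exact: sqr_ge0|rewrite mulr_ge0 // subr_ge0]].
Qed.

End GaussianTransform.

(** * The Fourier transform of a Gaussian *)

Section GaussianFourier.
Context (R : realType).
Local Notation leb := (@lebesgue_measure R).

(** The fundamental theorem of calculus on [-n, n], followed by dominated convergence. *)
Lemma Rintegral_derive0 (F f : R -> R) :
  (forall t : R, is_derive t (1 : R) F (f t)) -> continuous f ->
  leb.-integrable setT (fun t => (f t)%:E) ->
  F n%:R @[n --> \oo] --> (0 : R) -> F (- n%:R) @[n --> \oo] --> (0 : R) ->
  \int[leb]_t f t = 0.
Proof.
move=> dF cf If Fp Fn.
pose g n t := (\1_(`[- n%:R, n%:R]%classic : set R) t : R) * f t.
have mf : measurable_fun setT f by case/integrableP: If => /measurable_EFinP.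
have mg n : measurable_fun setT (g n).
  by apply: measurable_funM => //; exact: measurable_indic.
have gn n : \int[leb]_t g n.+1 t = F n.+1%:R - F (- n.+1%:R).
  rewrite /g /Rintegral.
  transitivity (fine (\int[leb]_(t in `[(- n.+1%:R)%R, n.+1%:R%R]) (f t)%:E)%E).
    rewrite [in RHS]integral_mkcond; congr fine; apply: eq_integral => t _.
    rewrite patchE indicE; case: ifP => _; by rewrite ?mul1r ?mul0r.
  rewrite (@continuous_FTC2 _ f F) //.
  - by rewrite -subr_gt0 opprK addr_gt0.
  - by apply: continuous_subspaceT.
  - have cF : continuous F.
      by move=> x; apply: differentiable_continuous; apply/derivable1_diffP; exact: ex_derive.
    split.
    + by move=> x _; exact: ex_derive.
    + by apply: cvg_at_right_filter; exact: cF.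
    + by apply: cvg_at_left_filter; exact: cF.
  - by move=> x _; rewrite derive1E; exact: derive_val.
have L1 : \int[leb]_t g n t @[n --> \oo] --> \int[leb]_t f t.
  apply: (Rintegral_dominated (mu := leb) (fn := g) (f := f) (h := fun t => `|f t|)) => //.
  - exact: integrable_norm.
  - by move=> n t; rewrite /g normrM indicE; case: (_ \in _); rewrite ?normr1 ?mul1r // normr0 mul0r.
  - move=> t; apply: cvg_near_cst; exists (Num.bound `|t|) => //= n /= tn.
    rewrite /g indicE mem_set ?mul1r //= in_itv /= -ler_norml.
    by apply: le_trans (ltW (archi_boundP (normr_ge0 t))) _; rewrite ler_nat.
have L2 : \int[leb]_t g n.+1 t @[n --> \oo] --> (0 : R).
  under eq_fun do rewrite gn.
  rewrite -(subr0 0); apply: cvgB.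
    by have := Fp; rewrite -(cvg_shiftS (fun n => F n%:R)).
  by have := Fn; rewrite -(cvg_shiftS (fun n => F (- n%:R))).
have L3 : \int[leb]_t g n.+1 t @[n --> \oo] --> \int[leb]_t f t.
  by have := L1; rewrite -(cvg_shiftS (fun n => \int[leb]_t g n t)).
by apply: (cvg_unique _ L3 L2).
Qed.

(** Trades half of the Gaussian decay for the factor [|t|]. *)
Lemma absr_gauss_le (a t : R) : 0 < a ->
  `|t| * expR (- (a * t ^+ 2)) <= (1 + a^-1) * expR (- (a / 2 * t ^+ 2)).
Proof.
move=> a0.
have -> : - (a * t ^+ 2) = - (a / 2 * t ^+ 2) + - (a / 2 * t ^+ 2) by field.
rewrite expRD mulrA ler_wpM2r ?expR_ge0 //.
set u := a / 2 * t ^+ 2.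
have u0 : 0 <= u by rewrite mulr_ge0 ?sqr_ge0 // divr_ge0 // ltW.
rewrite expRN ler_pdivrMr ?expR_gt0 //.
apply: (@le_trans _ _ ((1 + a^-1) * (1 + u))); last first.
  by rewrite ler_wpM2l ?expR_ge1Dx // addr_ge0 // invr_ge0 ltW.
have ai : 0 < a^-1 by rewrite invr_gt0.
have e : a^-1 * u = t ^+ 2 / 2 by rewrite /u; field; rewrite gt_eqF.
have -> : (1 + a^-1) * (1 + u) = 1 + a^-1 + u + t ^+ 2 / 2 by rewrite -e; ring.
rewrite -(real_normK (num_real t)).
have := sqr_ge0 (`|t| - 1); rewrite sqrrB1 => h; nra.
Qed.

Lemma integrable_gauss0 (a : R) : 0 < a ->
  leb.-integrable setT (fun x : R => (expR (- (a * x ^+ 2)))%:E).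
Proof. by move=> /(integrable_gauss 0); under eq_fun do rewrite subr0. Qed.

Lemma measurable_gauss0 (a : R) : measurable_fun setT (fun x : R => expR (- (a * x ^+ 2))).
Proof. by rmeas. Qed.

Lemma integrable_gauss_bounded (a : R) (h : R -> R) (M : R) : 0 < a ->
  measurable_fun setT h -> (forall t, `|h t| <= M * expR (- (a * t ^+ 2))) ->
  leb.-integrable setT (fun t => (h t)%:E).
Proof.
move=> a0 mh hM.
have M0 : 0 <= M.
  have := le_trans (normr_ge0 _) (hM 0).
  by rewrite expr0n /= mulr0 oppr0 expR0 mulr1.
apply: (le_integrable measurableT _ _ (integrableZl measurableT M (integrable_gauss0 a0))).
  exact/measurable_EFinP.
by move=> t _; rewrite /= lee_fin (ger0_norm (mulr_ge0 M0 (expR_ge0 _))).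
Qed.

Lemma gauss_sin_cvg0 (a c : R) : 0 < a ->
  expR (- (a * n%:R ^+ 2)) * sin (c * n%:R) @[n --> \oo] --> (0 : R).
Proof.
move=> a0; apply/norm_cvg0P.
apply: (cvg0_squeeze (b := fun n => (1 + a^-1) * n.+1%:R^-1)) => [n|]; last first.
  rewrite -[X in _ --> X](mulr0 (1 + a^-1)); apply: cvgM; first exact: cvg_cst.
  exact: cvg_harmonic.
rewrite normr_ge0 /= normrM (ger0_norm (expR_ge0 _)).
apply: (@le_trans _ _ (expR (- (a * n%:R ^+ 2)))).
  by rewrite ler_piMr ?expR_ge0 // ler_norml sin_geN1 sin_le1.
have u0 : 0 <= a * n%:R ^+ 2 by rewrite mulr_ge0 ?sqr_ge0 // ltW.
have ai : 0 < a^-1 by rewrite invr_gt0.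
apply: (@le_trans _ _ (1 + a * n%:R ^+ 2)^-1).
  rewrite expRN lef_pV2 ?posrE ?expR_gt0 ?expR_ge1Dx //; lra.
rewrite ler_pdivlMr ?ltr0n // ler_pdivrMl; last lra.
rewrite -natr1.
have -> : (1 + a * n%:R ^+ 2) * (1 + a^-1) = 1 + a * n%:R ^+ 2 + a^-1 + n%:R ^+ 2.
  by field; rewrite gt_eqF.
have : (n%:R : R) <= n%:R ^+ 2 by rewrite -natrX ler_nat; case: (n) => // m; rewrite leq_pmulr.
lra.
Qed.

Lemma is_derive_sqr (t : R) : is_derive t (1 : R) (fun x : R => x ^+ 2) (2 * t).
Proof.
apply: DeriveDef; first exact: exprn_derivable.
by rewrite exp_derive expr1 /GRing.scale /= mulr1.
Qed.

(** As a function J of c the integral satisfies J' = - c J / (2 a): differentiate under the integral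
    sign, then integrate by parts. Hence J(c) exp(c^2 / (4 a)) is constant. *)
Lemma gauss_cos (a : R) : 0 < a -> forall c : R,
  \int[leb]_t (expR (- (a * t ^+ 2)) * cos (c * t)) =
  Num.sqrt (pi / a) * expR (- (c ^+ 2 / (4 * a))).
Proof.
move=> a0.
have cos1 (x : R) : `|cos x| <= 1 by rewrite ler_norml cos_geN1 cos_le1.
have sin1 (x : R) : `|sin x| <= 1 by rewrite ler_norml sin_geN1 sin_le1.
have a20 : 0 < a / 2 by rewrite divr_gt0.
pose f (c t : R) := expR (- (a * t ^+ 2)) * cos (c * t).
pose J c := \int[leb]_t f c t.
have mf c : measurable_fun setT (f c) by rewrite /f; rmeas.
have If c : leb.-integrable setT (fun t => (f c t)%:E).
  apply: (integrable_gauss_bounded (M := 1) a0) => // t.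
  by rewrite /f normrM (ger0_norm (expR_ge0 _)) mul1r ler_piMr ?expR_ge0.
have df (c t : R) : is_derive c (1 : R) (f ^~ t) (- (t * expR (- (a * t ^+ 2)) * sin (c * t))).
  have d1 : is_derive c (1 : R) (fun x : R => x * t) t.
    by under eq_fun do rewrite mulrC; exact: is_derive_mul.
  have d2 : is_derive c (1 : R) (fun x : R => cos (x * t)) (- sin (c * t) * t).
    by apply: (@is_derive1_comp _ cos).
  apply: (is_derive_eq (is_deriveZ (f := fun x : R => cos (x * t)) (expR (- (a * t ^+ 2))) d2)).
  by rewrite /GRing.scale /=; ring.
pose s (c t : R) := t * expR (- (a * t ^+ 2)) * sin (c * t).
have ms c : measurable_fun setT (s c) by rewrite /s; rmeas.
have sle c t : `|s c t| <= (1 + a^-1) * expR (- (a / 2 * t ^+ 2)).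
  rewrite /s normrM normrM (ger0_norm (expR_ge0 _)); apply: le_trans (absr_gauss_le t a0).
  by rewrite ler_piMr // mulr_ge0 ?expR_ge0.
have Is c : leb.-integrable setT (fun t => (s c t)%:E).
  exact: (integrable_gauss_bounded a20 (ms c) (sle c)).
have d1f c t : partial1of2 f c t = - s c t.
  by rewrite partial1of2E; exact: derive_val.
have JE c : is_derive c (1 : R) J (- \int[leb]_t s c t).
  have cI : `](c - 1), (c + 1)[%classic c by rewrite /= in_itv /= ltrBlDr !ltrDl ltr01.
  have H1 := @derivable_under_integral R _ _ leb f setT measurableT c (c - 1) (c + 1) cI
    (fun x _ => If x) (fun x y _ _ => @ex_derive _ _ _ _ _ _ _ (df x y))
    (fun t => (1 + a^-1) * expR (- (a / 2 * t ^+ 2))).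
  have H2 := @differentiation_under_integral R _ _ leb f setT measurableT c (c - 1) (c + 1) cI
    (fun x _ => If x) (fun x y _ _ => @ex_derive _ _ _ _ _ _ _ (df x y))
    (fun t => (1 + a^-1) * expR (- (a / 2 * t ^+ 2))).
  have p1 : forall y, 0 <= (1 + a^-1) * expR (- (a / 2 * y ^+ 2)).
    by move=> y; rewrite mulr_ge0 ?expR_ge0 // addr_ge0 // invr_ge0 ltW.
  have p2 : leb.-integrable setT (EFin \o (fun t => (1 + a^-1) * expR (- (a / 2 * t ^+ 2)))).
    apply: (integrable_gauss_bounded (M := 1 + a^-1) a20); first by rmeas.
    by move=> t; rewrite ger0_norm.
  have p3 : forall x y, `](c - 1), (c + 1)[%classic x -> setT y ->
      `|partial1of2 f x y| <= (1 + a^-1) * expR (- (a / 2 * y ^+ 2)).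
    by move=> x y _ _; rewrite d1f normrN.
  apply: DeriveDef; first exact: H1.
  rewrite -derive1E; have := H2 p1 p2 p3; rewrite -/(J) => ->.
  rewrite -mulN1r -(RintegralZl (mu := leb) (-1) measurableT (Is c)). apply: eq_Rintegral => t _; by rewrite d1f mulN1r.
(* Integration by parts, as the vanishing of the integral of the derivative of exp(-a t^2) sin(c
   t). *)
have parts c : 2 * a * \int[leb]_t s c t = c * J c.
  pose F t := expR (- (a * t ^+ 2)) * sin (c * t).
  pose g t := - (2 * a) * s c t + c * f c t.
  have i1 : leb.-integrable setT (fun t => (- (2 * a) * s c t)%:E) := integrableZl measurableT (- (2 * a)) (Is c).
  have i2 : leb.-integrable setT (fun t => (c * f c t)%:E) := integrableZl measurableT c (If c).
  have Ig : leb.-integrable setT (fun t => (g t)%:E).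
    have i3 := integrableD measurableT i1 i2.
    by apply: eq_integrable i3.
  have dF (t : R) : is_derive t (1 : R) F (g t).
    have e1 : is_derive t (1 : R) (fun x : R => - (a * x ^+ 2)) (- (a * (2 * t))).
      apply: is_deriveN; exact: (is_deriveZ (f := fun x : R => x ^+ 2) a (is_derive_sqr t)).
    have e2 : is_derive t (1 : R) (fun x : R => expR (- (a * x ^+ 2))) (expR (- (a * t ^+ 2)) * - (a * (2 * t))).
      by apply: (@is_derive1_comp _ expR).
    have e3 := is_derive_mul c t.
    have e4 : is_derive t (1 : R) (fun x : R => sin (c * x)) (cos (c * t) * c).
      by apply: (@is_derive1_comp _ sin).
    apply: (is_derive_eq (is_deriveM e2 e4)).
    by rewrite /g /s /f /GRing.scale /=; ring.
  have cg : continuous g.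
    move=> t; rewrite /g /s /f.
    have ce : {for t, continuous (fun x : R => expR (- (a * x ^+ 2)))}.
      apply: (@continuous_comp _ _ _ (fun x : R => - (a * x ^+ 2)) expR); last exact: continuous_expR.
      by apply: cvgN; apply: cvgM; [exact: cvg_cst|exact: exprn_continuous].
    have cc : {for t, continuous (fun x : R => cos (c * x))}.
      apply: (@continuous_comp _ _ _ (fun x : R => c * x) cos); last exact: continuous_cos.
      by apply: cvgM; [exact: cvg_cst|exact: cvg_id].
    have cs : {for t, continuous (fun x : R => sin (c * x))}.
      apply: (@continuous_comp _ _ _ (fun x : R => c * x) sin); last exact: continuous_sin.
      by apply: cvgM; [exact: cvg_cst|exact: cvg_id].
    apply: cvgD; apply: cvgM; try exact: cvg_cst.
      by apply: cvgM => //; apply: cvgM => //; exact: cvg_id.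
    by apply: cvgM.
  have F1 : F n%:R @[n --> \oo] --> (0 : R) by rewrite /F; exact: gauss_sin_cvg0.
  have F2 : F (- n%:R) @[n --> \oo] --> (0 : R).
    by rewrite /F; under eq_fun do rewrite sqrrN mulrN -mulNr; exact: gauss_sin_cvg0.
  have := Rintegral_derive0 dF cg Ig F1 F2.
  rewrite (RintegralD (mu := leb) measurableT i1 i2).
  rewrite (RintegralZl (mu := leb) _ measurableT (Is c)) (RintegralZl (mu := leb) _ measurableT (If c)).
  by rewrite -/(J c) => h; lra.
have J0 : J 0 = Num.sqrt (pi / a).
  rewrite /J /f; have := integral_gauss 0 a0.
  under eq_integral do rewrite subr0.
  by move=> E; rewrite /Rintegral; under eq_integral do rewrite mul0r cos0 mulr1; rewrite E.
move=> c; rewrite -/(J c).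
pose K (x : R) := J x * expR (x ^+ 2 / (4 * a)).
have a4 : 4 * a != 0 by rewrite gt_eqF // mulr_gt0.
have dK (x : R) : is_derive x (1 : R) K 0.
  have e1 : is_derive x (1 : R) (fun x : R => x ^+ 2 / (4 * a)) (2 * x / (4 * a)).
    under eq_fun do rewrite mulrC.
    apply: (is_derive_eq (is_deriveZ (f := fun x : R => x ^+ 2) (4 * a)^-1 (is_derive_sqr x))).
    by rewrite /GRing.scale /= mulrC.
  have e2 : is_derive x (1 : R) (fun x : R => expR (x ^+ 2 / (4 * a))) (expR (x ^+ 2 / (4 * a)) * (2 * x / (4 * a))).
    by apply: (@is_derive1_comp _ expR).
  apply: (is_derive_eq (is_deriveM (JE x) e2)).
  rewrite /GRing.scale /=.
  have -> : \int[leb]_t s x t = x * J x / (2 * a).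
    by rewrite -parts; field; rewrite gt_eqF.
  by field; rewrite gt_eqF.
have := is_derive_0_is_cst c 0 dK.
rewrite /K expr0n /= mul0r expR0 mulr1 J0 => E.
by rewrite -E -mulrA -expRD subrr expR0 mulr1.
Qed.

Lemma gauss_sin (a c : R) : 0 < a -> \int[leb]_t (expR (- (a * t ^+ 2)) * sin (c * t)) = 0.
Proof.
have aux (x : R) : x = - x -> x = 0 by move=> ?; lra.
move=> a0; pose h t := expR (- (a * t ^+ 2)) * sin (c * t).
have mh : measurable_fun setT h by rewrite /h; rmeas.
have Ih : leb.-integrable setT (fun t => (h t)%:E).
  apply: (integrable_gauss_bounded (M := 1) a0) => // t.
  by rewrite /h normrM (ger0_norm (expR_ge0 _)) mul1r ler_piMr ?expR_ge0 // ler_norml sin_geN1 sin_le1.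
have hN t : h (- t) = - h t by rewrite /h sqrrN mulrN sinN mulrN.
have mh' : measurable_fun setT (fun t => (h t)%:E) by exact/measurable_EFinP.
have Ih' : leb.-integrable setT ((fun t => (h t)%:E) \o (fun t : R => - t)).
  apply: eq_integrable (integrableN Ih) => // t _.
  by rewrite /= hN EFinN.
have := integral_preserving (mu := leb) (nu := leb) (phi := fun t : R => - t) _ _ mh' Ih'.
have m1 : measurable_fun setT (fun t : R => - t) by exact: measurable_fun_opp.
move=> /(_ m1 (fun A mA => lebesgue_measureN mA)) E.
rewrite -/(Rintegral leb setT h).
have E2 : \int[leb]_t h t = - \int[leb]_t h t.
  rewrite {1}/Rintegral -E -mulN1r -(RintegralZl (mu := leb) (-1) measurableT Ih).
  by congr fine; apply: eq_integral => t _; rewrite hN mulN1r.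
exact: aux E2.
Qed.

Lemma cintg_gauss_cexp (a : R) (c : R) : 0 < a ->
  cintg leb (fun t : R => (expR (- (a * t ^+ 2)))%:C * cexp (0 +i* (c * t))).
Proof.
move=> a0; apply: (cintg_le _ (integrable_gauss0 a0)).
  apply: cmeasM; first by apply: cmeas_real; rmeas.
  by apply: cmeas_cexp; split => /=; rmeas.
move=> t; rewrite normcM normcR ger0_norm ?expR_ge0 //.
by rewrite normc_cexp expR0 mulr1.
Qed.

Lemma cint_gauss_cexp (a c : R) : 0 < a ->
  cint leb (fun t : R => (expR (- (a * t ^+ 2)))%:C * cexp (0 +i* (c * t))) =
  (Num.sqrt (pi / a) * expR (- (c ^+ 2 / (4 * a))))%:C.
Proof.
move=> a0; apply: complexP; rewrite /cint /=.
  rewrite -(gauss_cos a0 c); apply: eq_Rintegral => t _.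
  by rewrite expR0 mul1r mul0r subr0.
rewrite -[RHS](gauss_sin c a0); apply: eq_Rintegral => t _.
by rewrite expR0 mul1r mul0r addr0.
Qed.

End GaussianFourier.

(** * Uniqueness of Fourier coefficients *)

Section FourierUniqueness.
Context (R : realType).
Local Notation leb := (@lebesgue_measure R).

Lemma conjcM (z w : R[i]) : conjc (z * w) = conjc z * conjc w.
Proof. exact: rmorphM. Qed.

Definition e2pi (x : R) : R[i] := cexp (0 +i* (2 * pi * x)).

Lemma e2piD x y : e2pi (x + y) = e2pi x * e2pi y.
Proof. by rewrite /e2pi -cexpD; congr cexp; apply: complexP; rewrite !ReImE /= ?addr0 // mulrDr. Qed.
Lemma e2pi0 : e2pi 0 = 1.
Proof. by rewrite /e2pi mulr0 -[RHS]cexp0. Qed.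
Lemma e2piN x : e2pi (- x) = conjc (e2pi x).
Proof. by rewrite /e2pi -cexpJ; congr cexp; apply: complexP; rewrite !ReImE /= ?oppr0 // mulrN. Qed.
Lemma normc_e2pi x : normc (e2pi x) = 1.
Proof. by rewrite /e2pi normc_cexp expR0. Qed.
Lemma e2pi_int (m : int) : e2pi m%:~R = 1.
Proof.
have e1 : e2pi 1 = 1.
  have -> : e2pi 1 = cexp (0 +i* pi + 0 +i* pi).
    by rewrite /e2pi; congr cexp; apply: complexP; rewrite !ReImE /=; ring.
  by rewrite cexpD cexp_pi mulrNN mulr1.
have H (n : nat) : e2pi n%:R = 1.
  by elim: n => [|n IH]; rewrite ?e2pi0 // -natr1 e2piD IH e1 mulr1.
case: m => n; first by rewrite -pmulrn H.
by rewrite NegzE mulrNz e2piN -pmulrn H conjc1.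
Qed.
Lemma e2pi_shift x (m : int) : e2pi (x + m%:~R) = e2pi x.
Proof. by rewrite e2piD e2pi_int mulr1. Qed.
Lemma cmeas_e2pi (c : R) : cmeas (fun t : R => e2pi (c * t)).
Proof. by apply: cmeas_cexp; split => /=; rmeas. Qed.

Lemma cos_e2pi x : (cos (2 * pi * x))%:C = 2^-1 * (e2pi x + e2pi (- x)).
Proof.
rewrite e2piN /e2pi /cexp /= expR0 !mul1r.
have n2 : (2 : R[i]) != 0 by rewrite pnatr_eq0.
apply: (mulfI n2); rewrite mulrA divff // mul1r.
by apply: complexP; rewrite -[2]/(1 + 1) !ReImE /=; ring.
Qed.

Lemma periodic_int (u : R -> R) : (forall t, u (t + 1) = u t) -> forall t (m : int), u (t + m%:~R) = u t.
Proof.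
move=> up t m; have H (n : nat) s : u (s + n%:R) = u s.
  by elim: n => [|n IH]; rewrite ?addr0 // -natr1 addrA up.
case: m => n; first by rewrite -pmulrn H.
by rewrite NegzE mulrNz -pmulrn; have := H n.+1 (t - n.+1%:R); rewrite subrK => ->.
Qed.

(* [((1 + cos (2 pi (t - x0))) / 2) ^ N] concentrates at [x0] and is a trigonometric polynomial. *)
Lemma fourier_unique_real (u : R -> R) : continuous u -> (forall t, u (t + 1) = u t) ->
  leb.-integrable setT (fun t => (ind01 t * u t)%:E) ->
  (forall j : int, cint leb (fun t => (ind01 t * u t)%:C * e2pi (j%:~R * t)) = 0) ->
  forall x, u x <= 0.
Proof.
move=> cu up Iu u0 x; rewrite leNgt; apply/negP => ux.
have upi := periodic_int up.
pose x0 := x - (Num.floor x)%:~R.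
have ux0 : 0 < u x0 by rewrite /x0 -mulrNz upi.
have /andP[x00 x01] : 0 <= x0 < 1.
  by rewrite /x0 subr_ge0 floor_le ltrBlDl -intrD1 (andP (floor_itv x)).2.
pose e := u x0 / 2.
have e0 : 0 < e by rewrite divr_gt0.
have [d1 /= d10 hd1] : \forall t \near x0, e <= u t.
  have /cvgrPdist_lt /(_ _ e0) := cu x0; apply: filterS => t.
  by rewrite ltr_distl /e => /andP[h1 h2]; lra.
(* The bound 1/2 keeps 2 pi d in [0, pi], where the cosine decreases. *)
pose d := Num.min d1 2^-1.
have d0 : 0 < d by rewrite /d lt_min d10 /= invr_gt0 ltr0n.
have dh : d <= 2^-1 by rewrite ge_min lexx orbT.
have hd t : `|t - x0| < d -> e <= u t.
  move=> td; apply: hd1; rewrite /ball /= distrC; apply: lt_le_trans td _.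
  by rewrite ge_min lexx.
pose c t := (1 + cos (2 * pi * (t - x0))) / 2.
(* The values of the kernel [c] at distance d and d/2 from x0; the final limit rests on rho / rho' <
   1. *)
pose rho := (1 + cos (2 * pi * d)) / 2.
pose rho' := (1 + cos (pi * d)) / 2.
have pi0 := pi_gt0 R.
have cosle (a b : R) : 0 <= a -> a < b -> b <= pi -> cos b < cos a.
  move=> a0 ab b1; rewrite ltr_cos //; rewrite in_itv /=; apply/andP; split; lra.
have c01 t : 0 <= c t <= 1.
  have := cos_le1 (2 * pi * (t - x0)); have := cos_geN1 (2 * pi * (t - x0)).
  by rewrite /c => *; apply/andP; split; lra.
have rho01 : 0 <= rho < rho'.
  have := cos_geN1 (2 * pi * d) => h1.
  have h2 : cos (2 * pi * d) < cos (pi * d) by apply: cosle; nra.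
  by rewrite /rho /rho'; apply/andP; split; lra.
(* The kernel exceeds rho only at points closer than d to x0 modulo 1; s is the signed distance to
   x0 modulo 1. *)
have cu0 t : rho < c t -> e <= u t.
  move=> ct; pose m := Num.floor (t - x0 + 2^-1); pose s := t - x0 - m%:~R.
  have sh : `|s| <= 2^-1.
    have /andP[h1 h2] := floor_itv (t - x0 + 2^-1); rewrite -/m intrD1 in h1 h2.
    by rewrite ler_norml /s; apply/andP; split; lra.
  have cs : cos (2 * pi * (t - x0)) = cos (2 * pi * `|s|).
    apply: (@complexI R); rewrite !cos_e2pi.
    have -> : e2pi `|s| + e2pi (- `|s|) = e2pi s + e2pi (- s).
      by have [s0|s0] := leP 0 s; rewrite ?(ger0_norm s0) ?(ltr0_norm s0) // opprK addrC.
    have es : e2pi s = e2pi (t - x0) by rewrite /s -mulrNz e2pi_shift.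
    by rewrite !e2piN es.
  have ds : `|s| < d.
    rewrite ltNge; apply/negP => ds; move: ct; rewrite /c cs /rho.
    have : cos (2 * pi * `|s|) <= cos (2 * pi * d).
      move: ds; rewrite le_eqVlt => /predU1P[-> //|ds]; apply/ltW/cosle; nra.
    lra.
  have := hd (x0 + s); rewrite [x0 + s - x0]addrAC subrr add0r => /(_ ds).
  rewrite (_ : x0 + s = t + (- m)%:~R) ?upi //.
  by rewrite /s mulrNz; ring.
(* The interval J starts at x0 and stays inside [0, 1), so it does not wrap around the period. *)
pose eta := Num.min (d / 2) (1 - x0).
have eta0 : 0 < eta by rewrite lt_min divr_gt0 //= subr_gt0.
pose J := `[x0, x0 + eta[%classic : set R.
have J01 t : J t -> 0 <= t < 1 /\ rho' <= c t.
  rewrite /J /= in_itv /= => /andP[t0 t1].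
  have h1 : eta <= d / 2 by rewrite ge_min lexx.
  have h2 : eta <= 1 - x0 by rewrite ge_min lexx orbT.
  split; first by apply/andP; split; lra.
  rewrite /c /rho'.
  have : cos (pi * d) <= cos (2 * pi * (t - x0)).
    have [/eqP E|E] := boolP (2 * pi * (t - x0) == pi * d); first by rewrite E.
    apply/ltW/cosle; [nra| |nra].
    rewrite lt_neqAle E /=; nra.
  lra.
have ind1 t : `|ind01 t| <= 1.
  by rewrite ind01_itv; case: (_ && _); rewrite ?normr1 ?normr0.
pose I N (j : int) t : R[i] := (ind01 t * u t)%:C * (c t ^+ N)%:C * e2pi (j%:~R * t).
have mu : measurable_fun setT (fun t => ind01 t * u t) by case/integrableP: Iu => /measurable_EFinP.
have mc : measurable_fun setT c.
  by rewrite /c; apply: measurable_funM => //; apply: measurable_funD => //; rmeas.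
have II N j : cintg leb (I N j).
  apply: (cintg_le _ (integrable_norm Iu)).
    apply: cmeasM; last exact: cmeas_e2pi.
    by apply: cmeasM; apply: cmeas_real => //; exact: measurable_funX.
  move=> t; rewrite !normcM !normcR normc_e2pi mulr1 ler_piMr //.
  by have /andP[? ?] := c01 t; rewrite ger0_norm ?exprn_ge0 // exprn_ile1.
(* One more factor c is a combination of the frequencies -1, 0 and 1, so it only shifts j. *)
have I0 N j : cint leb (I N j) = 0.
  elim: N j => [|N IH] j.
    rewrite -[RHS](u0 j); apply: eq_cint => t.
    by rewrite /I expr0 mulr1.
  have E t : I N.+1 j t = 2^-1 * I N j t + ((2^-1 * 2^-1 * e2pi (- x0)) * I N (j + 1) t +
      (2^-1 * 2^-1 * e2pi x0) * I N (j - 1) t).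
    have E1 : (c t)%:C = 2^-1 * (1 + 2^-1 * (e2pi t * e2pi (- x0) + e2pi (- t) * e2pi x0)).
      rewrite -!e2piD (_ : - t + x0 = - (t - x0)); last by ring.
      by rewrite -cos_e2pi /c rmorphM rmorphD fmorphV rmorph1 rmorph_nat mulrC.
    have E2 : (c t ^+ N.+1)%:C = (c t)%:C * (c t ^+ N)%:C by rewrite exprS rmorphM.
    rewrite /I E2 E1 intrD intrB !mulrDl mulNr mul1r !e2piD; ring.
  rewrite (eq_cint leb E) cintD; [|exact: cintgZ|by apply: cintgD; exact: cintgZ].
  by rewrite cintD ?cintZ ?IH ?mulr0 ?addr0 //; exact: cintgZ.
pose M := \int[leb]_t `|ind01 t * u t|.
(* The integral of u c^N over the period is 0. Where c > rho the integrand is nonnegative, and on J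
   it is at least e rho'^N; elsewhere it is at least - rho^N |u|. *)
have key N : e * rho' ^+ N * eta <= rho ^+ N * M.
  have IR : leb.-integrable setT (fun t => (ind01 t * u t * c t ^+ N)%:E).
    have [h _] := II N 0; apply: eq_integrable h => // t _.
    rewrite /I (_ : e2pi _ = 1) ?mulr1; last by (rewrite mulr0z mul0r; exact: e2pi0).
    by rewrite /= mulr0 subr0.
  have R0 : \int[leb]_t (ind01 t * u t * c t ^+ N) = 0.
    transitivity (Re (cint leb (I N 0))); last by rewrite I0.
    apply: eq_Rintegral => t _; rewrite /I (_ : e2pi _ = 1) ?mulr1; last by (rewrite mulr0z mul0r; exact: e2pi0).
    by rewrite /= mulr0 subr0.
  have mJ : measurable J by exact: measurable_itv.
  have jJ : leb J = eta%:E.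
    rewrite /J lebesgue_measure_itv /= lte_fin ltrDl eta0 -EFinB; congr EFin; ring.
  have IJ : leb.-integrable setT (fun t => (\1_J t : R)%:E).
    apply/integrableP; split; first by apply/measurable_EFinP; exact: measurable_indic.
    under eq_integral do rewrite /= ger0_norm ?indicE ?ler0n // -indicE.
    have lJ : (leb J < +oo)%E by rewrite jJ ltry.
    by rewrite integral_indic // setIT; exact: lJ.
  have IJ' := integrableZl measurableT (e * rho' ^+ N) IJ.
  have IM : leb.-integrable setT (fun t => `|ind01 t * u t|%:E) by exact: integrable_norm.
  have IM' := integrableZl measurableT (rho ^+ N) IM.
  have lhs : e * rho' ^+ N * eta = \int[leb]_t (e * rho' ^+ N * (\1_J t : R)).
    rewrite (RintegralZl (mu := leb) _ measurableT IJ); congr (_ * _).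
    transitivity (fine (leb J)); first by rewrite jJ.
    by rewrite /Rintegral integral_indic // setIT.
  have rhs : rho ^+ N * M = \int[leb]_t (rho ^+ N * `|ind01 t * u t|).
    by rewrite (RintegralZl (mu := leb) _ measurableT IM).
  have -> : rho ^+ N * M = \int[leb]_t (ind01 t * u t * c t ^+ N + rho ^+ N * `|ind01 t * u t|).
    by rewrite (RintegralD (mu := leb) measurableT IR IM') R0 add0r.
  rewrite lhs; apply: le_Rintegral => //; first exact: (integrableD measurableT IR IM').
  move=> t _.
  have /andP[ct0 ct1] := c01 t; have /andP[r0 rr] := rho01.
  have r'0 : 0 <= rho' by exact: ltW (le_lt_trans r0 rr).
  have [ct|ct] := leP (c t) rho.
    have -> : (\1_J t : R) = 0.
      rewrite indicE memNset // => /J01[_ h]; move: ct; rewrite leNgt (lt_le_trans rr) //.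
    rewrite mulr0 addrC -lerBlDr sub0r.
    apply: le_trans (_ : `|ind01 t * u t| * c t ^+ N <= _).
      rewrite -mulNr; apply: ler_wpM2r; first exact: exprn_ge0.
      by rewrite -normrN; exact: ler_norm.
    by rewrite mulrC ler_wpM2r // lerXn2r // nnegrE.
  have ut := cu0 t ct.
  rewrite -[leLHS]addr0; apply: lerD; last by rewrite mulr_ge0 // exprn_ge0.
  have [tJ|tJ] := pselect (J t); last first.
    rewrite indicE memNset // mulr0 mulr_ge0 ?exprn_ge0 // mulr_ge0 ?ind01_ge0 //.
    exact: le_trans (ltW e0) ut.
  have [t01 rc] := J01 t tJ.
  rewrite indicE mem_set // mulr1 ind01_itv t01 mul1r.
  by apply: ler_pM => //; rewrite ?exprn_ge0 ?(ltW e0) // lerXn2r // nnegrE.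
have /andP[r0 rr] := rho01.
have r'0 : 0 < rho' by exact: le_lt_trans r0 rr.
have lim : (rho / rho') ^+ n * M @[n --> \oo] --> (0 * M).
  apply: cvgM; last exact: cvg_cst.
  by apply: cvg_expr; rewrite ger0_norm ?divr_ge0 ?(ltW r'0) // ltr_pdivrMr // mul1r.
have : e * eta <= 0 * M.
  apply: (ler_cvg_to (cvg_cst (e * eta)) lim); apply: nearW => n /=.
  have -> : (rho / rho') ^+ n * M = rho ^+ n * M / rho' ^+ n by rewrite expr_div_n mulrAC.
  rewrite ler_pdivlMr ?exprn_gt0 //; apply: le_trans (key n).
  by rewrite mulrAC.
by rewrite mul0r leNgt mulr_gt0.
Qed.

End FourierUniqueness.

Section ComplexFourierUniqueness.
Context (R : realType).
Local Notation leb := (@lebesgue_measure R).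
Local Notation e2pi := (@e2pi R).

(** The coefficients at j and - j determine those of the conjugate, hence those of the real and
    imaginary parts. *)
Lemma fourier_unique (h : R -> R[i]) : continuous (fun t => Re (h t)) -> continuous (fun t => Im (h t)) ->
  (forall t, h (t + 1) = h t) -> cintg leb (fun t => (ind01 t)%:C * h t) ->
  (forall j : int, cint leb (fun t => (ind01 t)%:C * h t * e2pi (j%:~R * t)) = 0) ->
  forall x, h x = 0.
Proof.
move=> cr ci hp Ih h0.
have Ihj j : cintg leb (fun t => (ind01 t)%:C * h t * e2pi (j%:~R * t)).
  apply: (cintg_le _ (cintg_norm Ih)); first by apply: cmeasM; [exact: (cintg_meas Ih)|exact: cmeas_e2pi].
  by move=> t; rewrite normcM normc_e2pi mulr1.
have h0' j : cint leb (fun t => conjc ((ind01 t)%:C * h t) * e2pi (j%:~R * t)) = 0.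
  have := cintJ (Ihj (- j)); rewrite h0 conjc0 => E; rewrite -[RHS]E; apply: eq_cint => t.
  by rewrite [X in _ = X]conjcM mulrNz mulNr e2piN conjcK.
have IhJ j : cintg leb (fun t => conjc ((ind01 t)%:C * h t) * e2pi (j%:~R * t)).
  apply: (cintg_le _ (cintg_norm Ih)).
    by apply: cmeasM; [apply: cmeasJ; exact: (cintg_meas Ih)|exact: cmeas_e2pi].
  by move=> t; rewrite normcM normc_e2pi mulr1 normcJ.
have n2 : (2 : R[i]) != 0 by rewrite pnatr_eq0.
have [I1 I2] := Ih.
have Ir : leb.-integrable setT (fun t => (ind01 t * Re (h t))%:E).
  by apply: eq_integrable I1 => // t _; rewrite ReM /= mul0r subr0.
have Ii : leb.-integrable setT (fun t => (ind01 t * Im (h t))%:E).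
  by apply: eq_integrable I2 => // t _; rewrite ImM /= mul0r addr0.
have r0 j : cint leb (fun t => (ind01 t * Re (h t))%:C * e2pi (j%:~R * t)) = 0.
  transitivity (cint leb (fun t => 2^-1 * ((ind01 t)%:C * h t * e2pi (j%:~R * t) + conjc ((ind01 t)%:C * h t) * e2pi (j%:~R * t)))).
    apply: eq_cint => t; rewrite -mulrDl mulrA; congr (_ * _).
    apply: (mulfI n2); rewrite mulrA divff // mul1r.
    by apply: complexP; rewrite -[2]/(1 + 1) !ReImE /=; ring.
  rewrite cintZ; last exact: cintgD.
  by rewrite cintD // h0 h0' addr0 mulr0.
have i0 j : cint leb (fun t => (ind01 t * Im (h t))%:C * e2pi (j%:~R * t)) = 0.
  transitivity (cint leb (fun t => (2^-1 * (0 -i* 1)) * ((ind01 t)%:C * h t * e2pi (j%:~R * t) - conjc ((ind01 t)%:C * h t) * e2pi (j%:~R * t)))).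
    apply: eq_cint => t; rewrite -mulrBl mulrA; congr (_ * _).
    apply: (mulfI n2); rewrite !mulrA divff // mul1r.
    by apply: complexP; rewrite -[2]/(1 + 1) !ReImE /=; ring.
  rewrite cintZ; last exact: cintgB.
  by rewrite cintB // h0 h0' subrr mulr0.
have N (u : R -> R) : continuous u -> (forall t, u (t + 1) = u t) ->
    leb.-integrable setT (fun t => (ind01 t * u t)%:E) ->
    (forall j : int, cint leb (fun t => (ind01 t * u t)%:C * e2pi (j%:~R * t)) = 0) ->
    forall x, u x = 0.
  move=> cu up Iu u0 x; apply/eqP; rewrite eq_le (fourier_unique_real cu up Iu u0) /=.
  rewrite -oppr_le0; apply: (@fourier_unique_real R (fun t => - u t)).
  - by move=> t; apply: cvgN; exact: cu.
  - by move=> t; rewrite up.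
  - by apply: eq_integrable (integrableN Iu) => // t _; rewrite mulrN EFinN.
  - move=> j; have Iuj : cintg leb (fun t => (ind01 t * u t)%:C * e2pi (j%:~R * t)).
      apply: (cintg_le _ (integrable_norm Iu)); last first.
        by move=> t; rewrite normcM normcR normc_e2pi mulr1.
      apply: cmeasM; last exact: cmeas_e2pi.
      by apply: cmeas_real; case/integrableP: Iu => /measurable_EFinP.
    rewrite -[RHS]oppr0 -(u0 j) -cintN //; apply: eq_cint => t.
    by rewrite mulrN rmorphN mulNr.
move=> x; apply: complexP => /=.
  by apply: (N (fun t => Re (h t))) => // t; rewrite hp.
by apply: (N (fun t => Im (h t))) => // t; rewrite hp.
Qed.

End ComplexFourierUniqueness.

(** * Limits and continuity of complex-valued series *)

Section ComplexConvergence.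
Context (R : realType).
Implicit Types (u v : nat -> R[i]) (x : R).
Local Notation cnt := (@zcount R).

Lemma ccvg_cst (l : R[i]) : ccvg (fun=> l) l.
Proof. by apply/ccvg_ReIm; split; exact: cvg_cst. Qed.
Lemma ccvgR (a : nat -> R) (l : R) : a n @[n --> \oo] --> l -> ccvg (fun n => (a n)%:C) l%:C.
Proof. by move=> al; apply/ccvg_ReIm; split => //=; exact: cvg_cst. Qed.
Lemma ccvgI (a : nat -> R) (l : R) : a n @[n --> \oo] --> l -> ccvg (fun n => 0 +i* (a n)) (0 +i* l).
Proof. by move=> al; apply/ccvg_ReIm; split => //=; exact: cvg_cst. Qed.
Lemma ccvgD u v l m : ccvg u l -> ccvg v m -> ccvg (fun n => u n + v n) (l + m).
Proof.
move=> /ccvg_ReIm[a b] /ccvg_ReIm[c d]; apply/ccvg_ReIm; split.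
  by under eq_fun do rewrite ReD; rewrite ReD; exact: cvgD.
by under eq_fun do rewrite ImD; rewrite ImD; exact: cvgD.
Qed.
Lemma ccvgM u v l m : ccvg u l -> ccvg v m -> ccvg (fun n => u n * v n) (l * m).
Proof.
move=> /ccvg_ReIm[a b] /ccvg_ReIm[c d]; apply/ccvg_ReIm; split.
  by under eq_fun do rewrite ReM; rewrite ReM; apply: cvgB; exact: cvgM.
by under eq_fun do rewrite ImM; rewrite ImM; apply: cvgD; exact: cvgM.
Qed.
Lemma ccvgZ (c : R[i]) u l : ccvg u l -> ccvg (fun n => c * u n) (c * l).
Proof. by apply: ccvgM; exact: ccvg_cst. Qed.
Lemma ccvgX u l k : ccvg u l -> ccvg (fun n => u n ^+ k) (l ^+ k).
Proof.
move=> ul; elim: k => [|k IH]; first by under eq_fun do rewrite expr0; exact: ccvg_cst.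
by under eq_fun do rewrite exprS; rewrite exprS; exact: ccvgM.
Qed.
Lemma ccvg_cexp u l : ccvg u l -> ccvg (fun n => cexp (u n)) (cexp l).
Proof.
move=> /ccvg_ReIm[a b]; apply/ccvg_ReIm; split; rewrite /cexp /=; apply: cvgM.
- exact: (cvg_comp _ _ a (@continuous_expR R _)).
- exact: (cvg_comp _ _ b (@continuous_cos R _)).
- exact: (cvg_comp _ _ a (@continuous_expR R _)).
- exact: (cvg_comp _ _ b (@continuous_sin R _)).
Qed.

Definition ccont (f : R -> R[i]) :=
  continuous (fun t => Re (f t)) /\ continuous (fun t => Im (f t)).

Lemma ccont_seq (f : R -> R[i]) :
  (forall x (u : nat -> R), u n @[n --> \oo] --> x -> ccvg (fun n => f (u n)) (f x)) -> ccont f.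
Proof.
by move=> H; split => x; apply/(@cvg_nbhsP _ R^o) => u ux; have /ccvg_ReIm[] := H x u ux.
Qed.

Lemma ccontB (f g : R -> R[i]) : ccont f -> ccont g -> ccont (fun t => f t - g t).
Proof.
move=> [a b] [c d]; split.
  rewrite (_ : (fun t => _) = (fun t => Re (f t) - Re (g t))); last first.
    by apply/funext => t; rewrite ReD ReN.
  by move=> x; apply: cvgB; [exact: a|exact: c].
rewrite (_ : (fun t => _) = (fun t => Im (f t) - Im (g t))); last first.
  by apply/funext => t; rewrite ImD ImN.
by move=> x; apply: cvgB; [exact: b|exact: d].
Qed.

(** The majorant may depend on x and hold only at distance at most 1 from it, since a tail of any
    sequence tending to x stays that close. *)
Lemma ccont_zsum (F : int -> R -> R[i]) (g : R -> int -> R) :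
  (forall m x (u : nat -> R), u n @[n --> \oo] --> x -> ccvg (fun n => F m (u n)) (F m x)) ->
  (forall x, cnt.-integrable setT (fun m => (g x m)%:E)) ->
  (forall m x y, `|y - x| <= 1 -> normc (F m y) <= g x m) ->
  ccont (fun x => cint cnt (fun m => F m x)).
Proof.
move=> cF ig Fg; apply: ccont_seq => x u ux.
have /cvgrPdist_le /(_ _ ltr01) [N _ HN] := ux.
have : ccvg (fun n => cint cnt (fun m => F m (u (n + N)%N))) (cint cnt (fun m => F m x)).
  apply: (cint_dominated (mu := cnt) (fn := fun n m => F m (u (n + N)%N)) (h := g x)).
  - by move=> n; exact: cmeas_int.
  - exact: ig.
  - by move=> n m; apply: Fg; rewrite distrC; apply: HN => /=; exact: leq_addl.
  - by move=> m; apply: (cF m x (fun n => u (n + N)%N)); rewrite (cvg_shiftn N).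
move=> h; rewrite /ccvg -(cvg_shiftn N); exact: h.
Qed.

End ComplexConvergence.

(** * Poisson summation for Gaussians *)

Section Poisson.
Context (R : realType).
Local Notation leb := (@lebesgue_measure R).
Local Notation cnt := (@zcount R).
Local Notation e2pi := (@e2pi R).

Lemma integrable_zgauss (a x : R) : 0 < a ->
  cnt.-integrable setT (fun m : int => (expR (- (a * (m%:~R - x) ^+ 2)))%:E).
Proof.
move=> a0; apply/integrableP; split => //.
under eq_integral do rewrite /= ger0_norm ?expR_ge0 //.
exact: le_lt_trans (zsum_gauss_le x a0) (ltry _).
Qed.

Lemma cvg_expR_seq (u : nat -> R) (x : R) : u n @[n --> \oo] --> x -> expR (u n) @[n --> \oo] --> expR x.
Proof. by move=> ux; exact: (cvg_comp _ _ ux (@continuous_expR R _)). Qed.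

Lemma ccvg_e2pi (u : nat -> R) (x : R) : u n @[n --> \oo] --> x -> ccvg (fun n => e2pi (u n)) (e2pi x).
Proof.
move=> ux; apply: (@ccvg_cexp R (fun n => 0 +i* (2 * pi * u n))); apply: ccvgI.
by apply: cvgM => //; exact: cvg_cst.
Qed.

Lemma integrable_ind01 : leb.-integrable setT (fun t => (ind01 t)%:E).
Proof.
apply/integrableP; split; first by apply/measurable_EFinP; exact: measurable_indic01.
by under eq_integral do rewrite /= ger0_norm ?ind01_ge0 //; rewrite integral_ind01 ltry.
Qed.

Lemma cintg_ind01 (f : R -> R[i]) (M : R) : cmeas f -> (forall t, normc (f t) <= M) ->
  cintg leb (fun t => (ind01 t)%:C * f t).
Proof.
move=> mf fM; have Ih := integrableZl measurableT M integrable_ind01.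
apply: (cintg_le _ Ih); first by apply: cmeasM => //; apply: cmeas_real; exact: measurable_indic01.
move=> t; rewrite normcM normcR ger0_norm ?ind01_ge0 // mulrC.
by apply: ler_wpM2r; [exact: ind01_ge0|exact: fM].
Qed.

Lemma Rintegral_ind01_derive (F f : R -> R) :
  (forall t : R, is_derive t (1 : R) F (f t)) -> continuous f ->
  \int[leb]_t (ind01 t * f t) = F 1 - F 0.
Proof.
move=> dF cf; rewrite /Rintegral.
transitivity (fine (\int[leb]_(t in `[0%R, 1%R]) (f t)%:E)%E).
  have mf : measurable_fun [set` Interval (BLeft (0 : R)) (BLeft 1)] (EFin \o f).
    by apply: measurable_funTS; apply/measurable_EFinP; exact: continuous_measurable_fun.
  have E := integral_itv_bndo_bndc mf.
  rewrite -[RHS](congr1 fine E).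
  rewrite [in RHS]integral_mkcond; congr fine; apply: eq_integral => t _.
  by rewrite patchE /ind01 indicE; case: ifP => _; rewrite ?mul1r ?mul0r.
rewrite (@continuous_FTC2 _ f F) //.
- by apply: continuous_subspaceT.
- have cF : continuous F.
    by move=> x; apply: differentiable_continuous; apply/derivable1_diffP; exact: ex_derive.
  split.
  + by move=> x _; exact: ex_derive.
  + by apply: cvg_at_right_filter; exact: cF.
  + by apply: cvg_at_left_filter; exact: cF.
- by move=> x _; rewrite derive1E; exact: derive_val.
Qed.

Lemma cint_ind01_e2pi (j : int) : cint leb (fun t => (ind01 t)%:C * e2pi (j%:~R * t)) = (j == 0)%:R.
Proof.
have [->|j0] := eqVneq j 0.
  transitivity (cint leb (fun t => (ind01 t)%:C)).
    apply: eq_cint => t; rewrite (_ : e2pi _ = 1) ?mulr1 //.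
    by rewrite mulr0z mul0r; exact: e2pi0.
  apply: complexP; rewrite /cint /=; first by rewrite /Rintegral integral_ind01.
  by rewrite /Rintegral integral0.
pose c : R := 2 * pi * j%:~R.
have c0 : c != 0 by rewrite /c !mulf_neq0 ?pnatr_eq0 ?intr_eq0 // gt_eqF // pi_gt0.
have ec t : e2pi (j%:~R * t) = cos (c * t) +i* sin (c * t).
  by rewrite /e2pi /cexp /= expR0 !mul1r /c !mulrA.
have ccos : continuous (fun t => cos (c * t)).
  move=> x; apply: (@continuous_comp _ _ _ (fun t => c * t) cos x); last exact: continuous_cos.
  by apply: cvgM; [exact: cvg_cst|exact: cvg_id].
have csin : continuous (fun t => sin (c * t)).
  move=> x; apply: (@continuous_comp _ _ _ (fun t => c * t) sin x); last exact: continuous_sin.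
  by apply: cvgM; [exact: cvg_cst|exact: cvg_id].
have e1 : e2pi (j%:~R * 1) = 1 by rewrite mulr1 e2pi_int.
have [c1 s1] : cos c = 1 /\ sin c = 0 by move: e1; rewrite ec !mulr1 => -[-> ->].
rewrite (eq_cint leb (g := fun t => (ind01 t * cos (c * t)) +i* (ind01 t * sin (c * t)))); last first.
  by move=> t; rewrite ec; apply: complexP; rewrite !ReImE /= ?mul0r ?subr0 ?addr0.
apply: complexP; rewrite /cint /=.
  have dF (t : R) : is_derive t (1 : R) (fun x => c^-1 * sin (c * x)) (cos (c * t)).
    have d1 := @is_derive1_comp _ sin (fun x : R => c * x) t _ _ (is_derive_sin _) (is_derive_mul c t).
    have d2 := is_deriveZ c^-1 d1.
    by apply: is_derive_eq d2 _; rewrite /GRing.scale /= mulrCA mulVf // mulr1.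
  by rewrite (Rintegral_ind01_derive dF ccos) !mulr1 mulr0 s1 sin0 subrr.
have dF (t : R) : is_derive t (1 : R) (fun x => - c^-1 * cos (c * x)) (sin (c * t)).
  have d1 := @is_derive1_comp _ cos (fun x : R => c * x) t _ _ (is_derive_cos _) (is_derive_mul c t).
  have d2 := is_deriveZ (- c^-1) d1.
  by apply: is_derive_eq d2 _; rewrite /GRing.scale /=; field.
by rewrite (Rintegral_ind01_derive dF csin) !mulr1 mulr0 c1 cos0 subrr.
Qed.

(** [h] is the periodization of the modulated Gaussian [phi] and [H] the Fourier series with the
    coefficients [hc]. Both are continuous, of period one, and have the same Fourier coefficients,
    so they agree at X. *)
Lemma poisson_gauss (A X b : R) : 0 < A ->
  cint cnt (fun m : int => (expR (- (pi * A * (m%:~R + X) ^+ 2)))%:C * e2pi (b * m%:~R)) =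
  (Num.sqrt A^-1)%:C *
  cint cnt (fun j : int => (expR (- (pi / A * (j%:~R - b) ^+ 2)))%:C * e2pi (X * (j%:~R - b))).
Proof.
move=> A0; have pi0 := pi_gt0 R.
have pin : (pi : R) != 0 by rewrite gt_eqF.
have An : A != 0 by rewrite gt_eqF.
have a0 : 0 < pi * A by rewrite mulr_gt0.
have a0' : 0 < pi / A by rewrite divr_gt0.
have a02 : 0 < pi * A / 2 by rewrite divr_gt0.
pose phi t := (expR (- (pi * A * t ^+ 2)))%:C * e2pi (b * t).
pose hc (j : int) := (Num.sqrt A^-1 * expR (- (pi / A * (j%:~R - b) ^+ 2)))%:C.
pose h x := cint cnt (fun m : int => phi (x + m%:~R)).
pose H x := cint cnt (fun j : int => hc j * e2pi (j%:~R * x)).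
have nphi t : normc (phi t) = expR (- (pi * A * t ^+ 2)).
  by rewrite normcM normc_e2pi mulr1 normcR ger0_norm ?expR_ge0.
have nhc j : normc (hc j) = Num.sqrt A^-1 * expR (- (pi / A * (j%:~R - b) ^+ 2)).
  by rewrite normcR ger0_norm // mulr_ge0 ?expR_ge0 ?sqrtr_ge0.
have Ig x : cnt.-integrable setT (fun m : int => (expR (pi * A) * expR (- (pi * A / 2 * (m%:~R - x) ^+ 2)))%:E).
  exact: (integrableZl measurableT _ (integrable_zgauss _ a02)).
have phile (m : int) x y : `|y - x| <= 1 -> normc (phi (y + m%:~R)) <= expR (pi * A) * expR (- (pi * A / 2 * (m%:~R - - x) ^+ 2)).
  move=> yx; rewrite nphi -expRD ler_expR opprK -subr_ge0.
  have yx2 : (y - x) ^+ 2 <= 1 by rewrite -[_ ^+ 2]real_normK ?num_real // expr_le1.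
  rewrite (_ : _ - - _ = pi * A * ((1 - (y - x) ^+ 2) + (m%:~R + 2 * y - x) ^+ 2 / 2)); last by field.
  by rewrite mulr_ge0 ?(ltW a0) // addr_ge0 ?subr_ge0 // divr_ge0 ?sqr_ge0.
have ch : ccont h.
  apply: (ccont_zsum (g := fun x (m : int) => expR (pi * A) * expR (- (pi * A / 2 * (m%:~R - - x) ^+ 2)))) => //.
  move=> m x u ux; have uxm : u n + m%:~R @[n --> \oo] --> x + m%:~R by apply: cvgD => //; exact: cvg_cst.
  apply: ccvgM; last by apply: ccvg_e2pi; apply: cvgM => //; exact: cvg_cst.
  apply: ccvgR; apply: cvg_expR_seq; apply: cvgN; apply: cvgM; first exact: cvg_cst.
  by rewrite expr2; under eq_fun do rewrite expr2; exact: cvgM.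
have IH : cnt.-integrable setT (fun j : int => (Num.sqrt A^-1 * expR (- (pi / A * (j%:~R - b) ^+ 2)))%:E).
  exact: (integrableZl measurableT _ (integrable_zgauss _ a0')).
have cH : ccont H.
  apply: (ccont_zsum (g := fun _ (j : int) => Num.sqrt A^-1 * expR (- (pi / A * (j%:~R - b) ^+ 2)))) => //.
    by move=> j x u ux; apply: ccvgZ; apply: ccvg_e2pi; apply: cvgM => //; exact: cvg_cst.
  by move=> j x y _; rewrite normcM normc_e2pi mulr1 nhc.
have Iphi x : cintg cnt (fun m : int => phi (x + m%:~R)).
  by apply: (cintg_le _ (Ig (- x))) => [|m]; [exact: cmeas_int|apply: phile; rewrite subrr normr0].
have IHx x : cintg cnt (fun j : int => hc j * e2pi (j%:~R * x)).
  by apply: (cintg_le _ IH) => [|m]; [exact: cmeas_int|rewrite normcM normc_e2pi mulr1 nhc].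
have hp t : h (t + 1) = h t.
  rewrite /h -(cint_cnt_bij (e := fun m : int => m + 1) _ (Iphi t)).2; last first.
    by exists (fun m => m - 1) => m; rewrite ?addrK ?subrK.
  by apply: eq_cint => m; rewrite -addrA intrD [1 + _]addrC.
have Hp t : H (t + 1) = H t.
  by apply: eq_cint => j; rewrite mulrDr mulr1 e2pi_shift.
have fourier_h (k : int) : cintg leb (fun t => (ind01 t)%:C * (h t * e2pi (k%:~R * t))) /\
    cint leb (fun t => (ind01 t)%:C * (h t * e2pi (k%:~R * t))) = hc (- k).
  (* Unfolding turns the k-th coefficient of the periodization into an integral over the line, a
     Gaussian transform at the frequency b + k. *)
  pose f t := phi t * e2pi (k%:~R * t).
  have fE t : f t = (expR (- (pi * A * t ^+ 2)))%:C * cexp (0 +i* (2 * pi * (b + k%:~R) * t)).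
    rewrite /f /phi -mulrA -e2piD /e2pi; congr (_ * cexp (0 +i* _)); ring.
  have If : cintg leb f.
    by rewrite (funext fE); exact: (cintg_gauss_cexp _ a0).
  have fm t m : f (t + m%:~R) = phi (t + m%:~R) * e2pi (k%:~R * t).
    by rewrite /f mulrDr -intrM e2pi_shift.
  have Ifm t : cintg cnt (fun m : int => f (t + m%:~R)).
    rewrite (_ : (fun m : int => _) = (fun m => phi (t + m%:~R) * e2pi (k%:~R * t))); last first.
      by apply/funext => m; exact: fm.
    exact: cintgZr (Iphi t).
  have [u1 u2] := cint_unfold If Ifm.
  have E t : cint cnt (fun m : int => f (t + m%:~R)) = h t * e2pi (k%:~R * t).
    by rewrite -cintZr //; apply: eq_cint => m; exact: fm.
  have E' : (fun t => (ind01 t)%:C * cint cnt (fun m : int => f (t + m%:~R))) =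
      (fun t => (ind01 t)%:C * (h t * e2pi (k%:~R * t))).
    by apply/funext => t; rewrite E.
  rewrite E' in u1 u2; split => //; rewrite -u2 (eq_cint leb fE) cint_gauss_cexp //.
  rewrite /hc; congr (_ * expR (- _))%:C; first by congr (Num.sqrt _); rewrite invfM mulrA divff ?mul1r.
  rewrite mulrNz; move: (pi : R) pin => p pin; field; rewrite An; exact: pin.
have fourier_H (k : int) : cintg leb (fun t => (ind01 t)%:C * (H t * e2pi (k%:~R * t))) /\
    cint leb (fun t => (ind01 t)%:C * (H t * e2pi (k%:~R * t))) = hc (- k).
  pose F (z : int * R) := hc z.1 * ((ind01 z.2)%:C * e2pi ((z.1 + k)%:~R * z.2)).
  have I01 (j : int) : cintg leb (fun t => (ind01 t)%:C * e2pi (j%:~R * t)).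
    by apply: (cintg_ind01 (M := 1)); [exact: cmeas_e2pi|move=> t; rewrite normc_e2pi].
  have nF j t : normc (F (j, t)) = (Num.sqrt A^-1 * expR (- (pi / A * (j%:~R - b) ^+ 2))) * ind01 t.
    by rewrite /F normcM nhc normcM normc_e2pi mulr1 normcR ger0_norm ?ind01_ge0.
  have mF : cmeas F.
    by split; (apply: measurable_fun_countable_prod; [exact: countable_int|by []|]) => j /=;
      case: (cintg_meas (cintgZ (hc j) (I01 (j + k)))).
  have FE t : cint cnt (fun j => F (j, t)) = (ind01 t)%:C * (H t * e2pi (k%:~R * t)).
    rewrite mulrA -cintZ // -cintZr; last exact: cintgZ.
    apply: eq_cint => j; rewrite /F /= intrD mulrDl e2piD; ring.
  have [|||f1 f2 f3 f4 f5] := @cint_fubini _ _ _ _ R cnt leb F mF.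
  - by move=> j; exact: (cintgZ (hc j) (I01 (j + k))).
  - move=> t; rewrite (_ : (fun j => _) = (fun j => (ind01 t)%:C * (hc j * e2pi (j%:~R * t)) * e2pi (k%:~R * t))).
      exact: (cintgZr _ (cintgZ _ (IHx t))).
    by apply/funext => j; rewrite /F /= intrD mulrDl e2piD; ring.
  - have /integrableP[_] := IH; apply: le_lt_trans; apply: ge0_le_integral => //.
    + by move=> j _; apply: integral_ge0 => t _; rewrite lee_fin normc_ge0.
    + move=> j _; under eq_integral do rewrite nF EFinM.
      rewrite ge0_integralZl //; last 2 first.
      * by apply/measurable_EFinP; exact: measurable_indic01.
      * by move=> t _; rewrite lee_fin ind01_ge0.
      by rewrite integral_ind01 mule1 lee_fin ler_norm.
  have FE' : (fun t => cint cnt (fun j => F (j, t))) = (fun t => (ind01 t)%:C * (H t * e2pi (k%:~R * t))).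
    by apply/funext => t; exact: FE.
  rewrite FE' in f4 f5; split => //; rewrite -f4.
  transitivity (cint cnt (fun j : int => hc (- k) * (\1_[set - k] j : R)%:C)).
    apply: eq_cint => j; rewrite /F /= cintZ // cint_ind01_e2pi indicE.
    have [/eqP jk|jk] := boolP (j + k == 0).
      by rewrite (_ : j = - k) ?mem_set ?mulr1 //; apply/eqP; rewrite -addr_eq0 jk.
    by rewrite memNset ?mulr0 //= => jk'; rewrite jk' addNr eqxx in jk.
  have int1 : (\int[cnt]_j (\1_[set - k] j : R)%:E = 1)%E by rewrite integral_indic // setIT; exact: zcount_set1.
  have I1 : cintg cnt (fun j : int => (\1_[set - k] j : R)%:C).
    apply: cintg_lty; first exact: cmeas_int.
    by under eq_integral do rewrite normcR ger0_norm ?indicE ?ler0n // -indicE; rewrite int1 ltry.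
  rewrite cintZ // (_ : cint _ _ = 1) ?mulr1 //.
  by apply: complexP; rewrite /cint /= /Rintegral ?int1 // integral0.
have D0 : forall t, h t - H t = 0.
  apply: (fourier_unique (h := fun t => h t - H t)).
  - by case: (ccontB ch cH).
  - by case: (ccontB ch cH).
  - by move=> t; rewrite hp Hp.
  - have := cintgB (fourier_h 0).1 (fourier_H 0).1; congr cintg; apply/funext => t.
    by rewrite mulr0z mul0r (_ : e2pi 0 = 1) ?mulr1 ?mulrBr //; exact: e2pi0.
  - move=> k; rewrite -[RHS](subrr (hc (- k))) -{1}(fourier_h k).2 -(fourier_H k).2 -cintB.
    + by apply: eq_cint => t; ring.
    + exact: (fourier_h k).1.
    + exact: (fourier_H k).1.
have hH : h X = H X by apply/eqP; rewrite -subr_eq0 D0.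
(* The phase passes from the modulation of m + X in [phi] to the modulation of m in the
   statement. *)
transitivity (e2pi (- (b * X)) * h X).
  rewrite -cintZ //; apply: eq_cint => m; rewrite /phi [RHS]mulrCA -e2piD.
  by rewrite [X + _]addrC; congr (_ * e2pi _); ring.
rewrite hH -cintZ // -cintZ.
  apply: eq_cint => j; rewrite /hc rmorphM mulrCA -!mulrA -e2piD; congr (_ * (_ * e2pi _)); ring.
apply: (cintg_le _ (integrable_zgauss b a0')) => [|m]; first exact: cmeas_int.
by rewrite normcM normc_e2pi mulr1 normcR ger0_norm ?expR_ge0.
Qed.

End Poisson.

(** * Gaussian sums over the lattice and the vanishing of the signed sums *)

Section LatticeSums.
Context (R : realType).
Local Notation cnt := (@zcount R).
Local Notation cnt2 := (@zcount R \x @zcount R)%E.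

Lemma le_integral_cnt (f : int -> \bar R) (m : int) : (forall k, 0 <= f k)%E ->
  (f m <= \int[cnt]_k f k)%E.
Proof.
move=> f0; rewrite integral_cnt_esum // (esumID [set m]) // setTI esum_set1 //.
by rewrite leeDl // esum_ge0.
Qed.

Lemma cintg_cnt2 (f : int * int -> R[i]) : cintg cnt2 f ->
  [/\ forall m, cintg cnt (fun n => f (m, n)), forall n, cintg cnt (fun m => f (m, n)) &
      cint cnt2 f = cint cnt (fun n => cint cnt (fun m => f (m, n)))].
Proof.
move=> If.
have fin : (\int[cnt2]_z (normc (f z))%:E < +oo)%E.
  have /integrableP [_] := cintg_norm If.
  by under eq_integral do rewrite /= ger0_norm ?normc_ge0 //.
have mf : cmeas f by exact: cmeas_int2.
have nf0 z : (0 <= (normc (f z))%:E)%E by rewrite lee_fin normc_ge0.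
have I1 m : cintg cnt (fun n => f (m, n)).
  apply: cintg_lty; first exact: cmeas_int.
  apply: le_lt_trans fin; rewrite fubini_tonelli1 //; last exact: cmeas_normE.
  rewrite /fubini_F.
  apply: (le_integral_cnt (f := fun m => (\int[cnt]_n (normc (f (m, n)))%:E)%E)) => k.
  by apply: integral_ge0.
have I2 n : cintg cnt (fun m => f (m, n)).
  apply: cintg_lty; first exact: cmeas_int.
  apply: le_lt_trans fin; rewrite fubini_tonelli2 //; last exact: cmeas_normE.
  rewrite /fubini_G.
  apply: (le_integral_cnt (f := fun n => (\int[cnt]_m (normc (f (m, n)))%:E)%E)) => k.
  by apply: integral_ge0.
split => //.
have fin' : (\int[cnt]_m \int[cnt]_n (normc (f (m, n)))%:E < +oo)%E.
  by move: fin; rewrite fubini_tonelli1 //; exact: cmeas_normE.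
by have [_ _ <- <- _] := @cint_fubini _ _ _ _ R cnt cnt f mf I1 I2 fin'.
Qed.

Context (t y : R) (y0 : 0 < y).

(** The point m + n tau of the lattice Z + tau Z, with tau = t + i y. *)
Definition lat (p : int * int) : R[i] := (p.1%:~R + p.2%:~R * t) +i* (p.2%:~R * y).

(** Row by row: the horizontal sum is bounded independently of the offset of the row. The bound is
    of order 1/a as a tends to 0 and does not depend on w. *)
Lemma lgauss_le (a : R) (w : R[i]) : 0 < a ->
  (\int[cnt2]_p (expR (- (a * normc (lat p - w) ^+ 2)))%:E <=
   (expR (a * (1 + y ^+ 2)) * (2 * pi / (a * y)))%:E)%E.
Proof.
move=> a0; have ay0 : 0 < a * y ^+ 2 by rewrite mulr_gt0 ?exprn_gt0.
have yn : y != 0 by rewrite gt_eqF.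
rewrite fubini_tonelli2 //; last by apply: measurable_fun_int2.
rewrite /fubini_G.
pose c := expR a * Num.sqrt (pi / (a / 2)).
pose c' := expR (a * y ^+ 2) * Num.sqrt (pi / (a * y ^+ 2 / 2)).
have -> : expR (a * (1 + y ^+ 2)) * (2 * pi / (a * y)) = c * c'.
  rewrite /c /c' mulrACA -expRD mulrDr mulr1; congr (_ * _).
  have pi0 := pi_ge0 R.
  rewrite -sqrtrM; last by rewrite divr_ge0 // divr_ge0 // ltW.
  rewrite (_ : pi / (a / 2) * (pi / (a * y ^+ 2 / 2)) = (2 * pi / (a * y)) ^+ 2); last first.
    by move: (pi : R) => p; field; rewrite yn (gt_eqF a0).
  by rewrite sqrtr_sqr ger0_norm // divr_ge0 ?mulr_ge0 // ltW.
rewrite (EFinM c); apply: (@le_trans _ _ (c%:E * \int[cnt]_n (expR (- (a * y ^+ 2 * (n%:~R - Im w / y) ^+ 2)))%:E)%E); last first.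
  by rewrite lee_wpmul2l ?lee_fin ?mulr_ge0 ?expR_ge0 ?sqrtr_ge0 // zsum_gauss_le.
rewrite -ge0_integralZl //; last by rewrite lee_fin mulr_ge0 ?expR_ge0 ?sqrtr_ge0.
apply: ge0_le_integral => // n _.
  by apply: integral_ge0 => m _; rewrite lee_fin expR_ge0.
have E (m : int) : (expR (- (a * normc (lat (m, n) - w) ^+ 2)))%:E =
    ((expR (- (a * y ^+ 2 * (n%:~R - Im w / y) ^+ 2)))%:E * (expR (- (a * (m%:~R - (Re w - n%:~R * t)) ^+ 2)))%:E)%E.
  by rewrite -EFinM -expRD normc_sqr !ReImE /=; congr (expR _)%:E; field.
under eq_integral do rewrite E.
rewrite ge0_integralZl // muleC lee_wpmul2r ?lee_fin ?expR_ge0 //.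
exact: zsum_gauss_le.
Qed.

Lemma integrable_lgauss (a : R) (w : R[i]) : 0 < a ->
  cnt2.-integrable setT (fun p => (expR (- (a * normc (lat p - w) ^+ 2)))%:E).
Proof.
move=> a0; apply/integrableP; split; first exact: measurable_fun_int2.
under eq_integral do rewrite /= ger0_norm ?expR_ge0 //.
exact: le_lt_trans (lgauss_le w a0) (ltry _).
Qed.

Lemma integrable_lgauss0 (a : R) : 0 < a ->
  cnt2.-integrable setT (fun p => (expR (- (a * normc (lat p) ^+ 2)))%:E).
Proof. by move=> a0; have := integrable_lgauss 0 a0; under eq_fun do rewrite subr0. Qed.

Lemma cintg_lgauss (a M : R) (f : int * int -> R[i]) : 0 < a ->
  (forall p, normc (f p) <= M * expR (- (a * normc (lat p) ^+ 2))) -> cintg cnt2 f.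
Proof.
move=> a0 fM; apply: (cintg_le _ (integrableZl measurableT M (integrable_lgauss0 a0))) => //.
exact: cmeas_int2.
Qed.

(** By |m + n tau|^2 <= 2 (1 + t^2 + y^2) (m^2 + n^2) the sum dominates a product of two sums over
    the integers. *)
Lemma lgauss_ge (a : R) : 0 < a ->
  ((expR (- (8 * a * (1 + t ^+ 2 + y ^+ 2))) * (pi / (4 * a * (1 + t ^+ 2 + y ^+ 2))))%:E <=
   \int[cnt2]_p (expR (- (a * normc (lat p) ^+ 2)))%:E)%E.
Proof.
move=> a0; have s0 : 0 < 1 + t ^+ 2 + y ^+ 2.
  by rewrite ltr_wpDr ?sqr_ge0 // ltr_wpDr ?sqr_ge0.
set s := 1 + t ^+ 2 + y ^+ 2 in s0 *.
have as0 : 0 < 2 * a * s by rewrite !mulr_gt0.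
rewrite fubini_tonelli2 //; last by apply: measurable_fun_int2.
rewrite /fubini_G.
pose c := expR (- (2 * (2 * a * s))) * Num.sqrt (pi / (2 * (2 * a * s))).
have c0 : 0 <= c by rewrite mulr_ge0 ?expR_ge0 ?sqrtr_ge0.
have -> : expR (- (8 * a * s)) * (pi / (4 * a * s)) = c * c.
  rewrite /c mulrACA -expRD -expr2 sqr_sqrtr; last by rewrite divr_ge0 ?pi_ge0 // mulr_ge0 // ltW.
  by congr (expR _ * (_ / _)); ring.
rewrite (EFinM c); apply: (@le_trans _ _ (c%:E * \int[cnt]_n (expR (- (2 * a * s * n%:~R ^+ 2)))%:E)%E).
  by rewrite lee_wpmul2l ?lee_fin // zsum_gauss_ge.
rewrite -ge0_integralZl //.
apply: ge0_le_integral => // n _; first by rewrite mule_ge0 ?lee_fin ?expR_ge0.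
rewrite muleC; apply: (@le_trans _ _ ((expR (- (2 * a * s * n%:~R ^+ 2)))%:E * \int[cnt]_m (expR (- (2 * a * s * m%:~R ^+ 2)))%:E)%E).
  by rewrite lee_wpmul2l ?lee_fin ?expR_ge0 // zsum_gauss_ge.
rewrite -ge0_integralZl ?lee_fin ?expR_ge0 //.
apply: ge0_le_integral => // m _.
rewrite -EFinM lee_fin -expRD ler_expR -subr_ge0 normc_sqr /=.
rewrite (_ : _ - _ = a * ((m%:~R - n%:~R * t) ^+ 2 + (n%:~R * y) ^+ 2 + 2 * (n%:~R ^+ 2 + m%:~R ^+ 2 * (t ^+ 2 + y ^+ 2)))); last by rewrite /s; ring.
rewrite mulr_ge0 ?(ltW a0) // !addr_ge0 ?sqr_ge0 // mulr_ge0 // addr_ge0 ?sqr_ge0 //.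
by rewrite mulr_ge0 ?addr_ge0 ?sqr_ge0.
Qed.

(** The critical exponent of a lattice of covolume y: |theta(z)| exp(- beta |z|^2) will be periodic
    under the lattice. *)
Definition beta : R := pi / (2 * y).
(** The sign (-1)^(m + n + m n), equal to 1 on twice the lattice and to -1 elsewhere. *)
Definition chi (p : int * int) : R[i] :=
  e2pi ((p.1%:~R + p.2%:~R + p.1%:~R * p.2%:~R) / 2).
(** By the quasi-periodicity of [theta] this is theta'(0) / theta'(l_p) whenever theta'(0) is
    nonzero: the weights of Lagrange interpolation at the zeros of [theta]. *)
Definition wt (p : int * int) : R[i] := chi p * (expR (- (beta * normc (lat p) ^+ 2)))%:C.

Lemma beta_gt0 : 0 < beta. Proof. by rewrite divr_gt0 ?pi_gt0 // mulr_gt0. Qed.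

Lemma normc_wt p : normc (wt p) = expR (- (beta * normc (lat p) ^+ 2)).
Proof. by rewrite normcM normc_e2pi mul1r normcR ger0_norm ?expR_ge0. Qed.

Lemma expR_lin_le (b A r : R) : 0 < b -> expR (A * r - b * r ^+ 2) <= expR (A ^+ 2 / (2 * b)) * expR (- (b / 2 * r ^+ 2)).
Proof.
move=> b0; have bn : b != 0 by rewrite gt_eqF.
rewrite -expRD ler_expR -subr_ge0.
rewrite (_ : _ - _ = (b * r - A) ^+ 2 / (2 * b)); last by field.
by rewrite divr_ge0 ?sqr_ge0 // mulr_ge0 // ltW.
Qed.

Lemma cintg_wt (A M : R) (f : int * int -> R[i]) :
  (forall p, normc (f p) <= M * expR (A * normc (lat p))) -> cintg cnt2 (fun p => wt p * f p).
Proof.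
move=> fM; have b0 := beta_gt0.
have b20 : 0 < beta / 2 by rewrite divr_gt0.
have M0 : 0 <= M.
  have := le_trans (normc_ge0 _) (fM (0, 0)); by rewrite pmulr_lge0 ?expR_gt0.
apply: (@cintg_lgauss (beta / 2) (M * expR (A ^+ 2 / (2 * beta)))) => // p.
rewrite normcM normc_wt mulrC; apply: le_trans (ler_wpM2r (expR_ge0 _) (fM p)) _.
have H := expR_lin_le A (normc (lat p)) b0.
by rewrite -[leLHS]mulrA -[leRHS]mulrA; apply: (ler_wpM2l M0); rewrite -[leLHS]expRD.
Qed.

Lemma e2pi_expRM (a x b z : R) : (e2pi a * (expR x)%:C) * (e2pi b * (expR z)%:C) =
  e2pi (a + b) * (expR (x + z))%:C.
Proof. by rewrite mulrACA -e2piD -rmorphM -expRD. Qed.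

(* Summing first over the horizontal direction by Poisson gives a double series
   that changes sign under (n, j) |-> (n + 1 - 2 j, 1 - j). *)
Lemma sum_wt_exp (s : R) : cint cnt2 (fun p => wt p * cexp ((0 +i* (2 * pi * s)) * lat p)) = 0.
Proof.
have pi0 := pi_gt0 R.
have pin : (pi : R) != 0 by rewrite gt_eqF.
have yn : y != 0 by rewrite gt_eqF.
have py0 : 0 < pi * y by rewrite mulr_gt0.
have If : cintg cnt2 (fun p => wt p * cexp ((0 +i* (2 * pi * s)) * lat p)).
  apply: (@cintg_wt (2 * pi * `|s|) 1) => p; rewrite mul1r.
  apply: le_trans (normc_cexp_le _) _; rewrite ler_expR normcM; apply: ler_wpM2r; first exact: normc_ge0.
  by apply: le_trans (normc_le_ReIm _) _; rewrite /= normr0 add0r !normrM (gtr0_norm pi0) normr_nat.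
have [_ _ ->] := cintg_cnt2 If.
(* The dual variable of Poisson summation, centred: the substitution (n, j) |-> (n + 1 - 2 j, 1 - j)
   sends (n, k) to (- k, - n) and thus preserves the modulus of [T]. *)
pose k (n j : int) : R := 2 * j%:~R - n%:~R - 1.
pose T (z : int * int) := e2pi (z.1%:~R / 2 + t * z.1%:~R * k z.1 z.2 / 2) *
  (expR (- (pi * y / 2 * (z.1%:~R ^+ 2 + k z.1 z.2 ^+ 2)) - 2 * pi * s * y * (z.1%:~R - k z.1 z.2) - 2 * pi * y * s ^+ 2))%:C.
pose M := expR (6 * pi * y * s ^+ 2).
have nT n j : normc (T (n, j)) <= M * expR (- (pi * y / 4 * n%:~R ^+ 2)) * expR (- (pi * y / 4 * k n j ^+ 2)).
  rewrite /T normcM normc_e2pi mul1r normcR ger0_norm ?expR_ge0 // -!expRD ler_expR -subr_ge0 /=.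
  rewrite [X in 0 <= X](_ : _ = pi * y / 4 * ((n%:~R + 4 * s) ^+ 2 + (k n j - 4 * s) ^+ 2)); last by move: (pi : R) => p; field.
  by rewrite mulr_ge0 ?addr_ge0 ?sqr_ge0 // divr_ge0 // ltW.
have py40 : 0 < pi * y / 4 by rewrite divr_gt0.
have In : cnt.-integrable setT (fun n : int => (expR (- (pi * y / 4 * n%:~R ^+ 2)))%:E).
  by have := integrable_zgauss 0 py40; under eq_fun do rewrite subr0.
have kE n j : pi * y / 4 * k n j ^+ 2 = pi * y * (j%:~R - (n%:~R + 1) / 2) ^+ 2 by rewrite /k; move: (pi : R) => p; field.
have Ij n : cnt.-integrable setT (fun j : int => (expR (- (pi * y / 4 * k n j ^+ 2)))%:E).
  by under eq_fun do rewrite kE; exact: integrable_zgauss.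
have IT n : cintg cnt (fun j => T (n, j)).
  by apply: (cintg_le _ (integrableZl measurableT _ (Ij n)) (nT n)); exact: cmeas_int.
have IT' j : cintg cnt (fun n => T (n, j)).
  apply: (cintg_le _ (integrableZl measurableT M In)); first exact: cmeas_int.
  move=> n; apply: le_trans (nT n j) _; rewrite ler_piMr //; first by rewrite mulr_ge0 ?expR_ge0.
  by rewrite -[leRHS]expR0 ler_expR oppr_le0; apply: mulr_ge0; [exact: ltW|exact: sqr_ge0].
have E n : cint cnt (fun m => wt (m, n) * cexp ((0 +i* (2 * pi * s)) * lat (m, n))) =
    (Num.sqrt (2 * y))%:C * cint cnt (fun j => T (n, j)).
  have A0 : 0 < (2 * y)^-1 by rewrite invr_gt0 mulr_gt0.
  pose b := (n%:~R + 1) / 2 + s.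
  pose c := e2pi (n%:~R / 2 + s * n%:~R * t) * (expR (- (beta * n%:~R ^+ 2 * y ^+ 2) - 2 * pi * s * n%:~R * y))%:C.
  pose G (m : int) := (expR (- (pi * (2 * y)^-1 * (m%:~R + n%:~R * t) ^+ 2)))%:C * e2pi (b * m%:~R).
  pose J (j : int) := (expR (- (pi / (2 * y)^-1 * (j%:~R - b) ^+ 2)))%:C * e2pi (n%:~R * t * (j%:~R - b)).
  have IG : cintg cnt G.
    have A0' : 0 < pi * (2 * y)^-1 by rewrite mulr_gt0.
    apply: (cintg_le _ (integrable_zgauss (- (n%:~R * t)) A0')); first exact: cmeas_int.
    by move=> m; rewrite normcM normc_e2pi mulr1 normcR ger0_norm ?expR_ge0 // opprK.
  have IJ : cintg cnt J.
    have A0' : 0 < pi / (2 * y)^-1 by rewrite divr_gt0.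
    apply: (cintg_le _ (integrable_zgauss b A0')); first exact: cmeas_int.
    by move=> m; rewrite normcM normc_e2pi mulr1 normcR ger0_norm ?expR_ge0.
  have e1 m : wt (m, n) * cexp ((0 +i* (2 * pi * s)) * lat (m, n)) = c * G m.
    have -> : cexp ((0 +i* (2 * pi * s)) * lat (m, n)) = e2pi (s * (m%:~R + n%:~R * t)) * (expR (- (2 * pi * s * n%:~R * y)))%:C.
      rewrite -cexp_real mulrC /e2pi -cexpD; congr cexp; apply: complexP; rewrite !ReImE /=; ring.
    rewrite /wt /chi /c /G [_%:C * e2pi (b * _)]mulrC !e2pi_expRM normc_sqr /beta /b /=.
    by congr (e2pi _ * (expR _)%:C); move: (pi : R) => p; field.
  have e2 j : T (n, j) = c * J j.
    rewrite /T /c /J mulrC [_%:C * e2pi (_ * _)]mulrC [RHS]e2pi_expRM [LHS]mulrC /beta /b /k /=.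
    by congr (e2pi _ * (expR _)%:C); move: (pi : R) => p; field.
  have P : cint cnt G = (Num.sqrt (2 * y))%:C * cint cnt J.
    by rewrite -[X in Num.sqrt X]invrK; exact: (poisson_gauss (n%:~R * t) b A0).
  by rewrite (eq_cint cnt e1) (eq_cint cnt e2) (cintZ c IG) (cintZ c IJ) P mulrCA.
(* Absolute convergence, which permits summing over n first; the substitution then pairs the sums at
   j and 1 - j. *)
have fin : (\int[cnt]_n \int[cnt]_j (normc (T (n, j)))%:E < +oo)%E.
  pose C := M * (expR (pi * y) * Num.sqrt (pi / (pi * y / 2))).
  have /integrableP[_] := integrableZl measurableT C In; apply: le_lt_trans; apply: ge0_le_integral => //.
    by move=> n _; apply: integral_ge0 => j _; rewrite lee_fin normc_ge0.
  move=> n _; rewrite gee0_abs; last by rewrite lee_fin !mulr_ge0 ?expR_ge0 ?sqrtr_ge0.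
  apply: (@le_trans _ _ (\int[cnt]_j ((M * expR (- (pi * y / 4 * n%:~R ^+ 2)))%:E * (expR (- (pi * y * (j%:~R - (n%:~R + 1) / 2) ^+ 2)))%:E))%E).
    apply: ge0_le_integral => // j _; first by rewrite lee_fin; exact: normc_ge0.
    by rewrite -kE -EFinM lee_fin; exact: nT.
  rewrite ge0_integralZl ?lee_fin ?mulr_ge0 ?expR_ge0 //.
  rewrite /C [X in (_ <= X%:E)%E]mulrAC [X in (_ <= X)%E]EFinM.
  by rewrite lee_wpmul2l ?lee_fin ?mulr_ge0 ?expR_ge0 // zsum_gauss_le.
have [_ I1 _ sw I2] := @cint_fubini _ _ _ _ R cnt cnt T (cmeas_int2 T) IT IT' fin.
rewrite (eq_cint cnt E) (cintZ _ I1) sw.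
pose U j := cint cnt (fun n => T (n, j)).
(* The sign comes from the phase: - k / 2 = n / 2 + 1 / 2 - j, and a half period contributes -1. *)
have UN j : U (1 - j) = - U j.
  rewrite /U -(cint_cnt_bij (e := fun n => n + 1 - 2 * j) _ (IT' (1 - j))).2; last first.
    exists (fun n => n - 1 + 2 * j) => n; ring.
  rewrite -(cintN (IT' j)); apply: eq_cint => n; rewrite /T.
  have k1 : k (n + 1 - 2 * j) (1 - j) = - n%:~R.
    by rewrite /k !intrD !mulrNz intrM; ring.
  have n1 : (n + 1 - 2 * j)%:~R = - k n j by rewrite /k !intrD !mulrNz intrM; ring.
  rewrite [(_, _).1]/= [(_, _).2]/= [(n, j).1]/= [(n, j).2]/= k1 n1 (_ : - k n j / 2 + _ = n%:~R / 2 + t * n%:~R * k n j / 2 + (1 / 2) + (- j)%:~R); last first.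
    by rewrite mulrNz /k; field.
  rewrite e2pi_shift e2piD (_ : e2pi (1 / 2) = -1); last first.
    have h : 2 * pi * (1 / 2) = pi :> R by move: (pi : R) => p; field.
    by rewrite /e2pi h; exact: cexp_pi.
  rewrite mulrN1 mulNr; congr (- (_ * (expR _)%:C)); move: (pi : R) => p; ring.
have V : cint cnt U = - cint cnt U.
  rewrite -{1}(cint_cnt_bij (e := fun j => 1 - j) _ I2).2; last by exists (fun j => 1 - j) => j; ring.
  by rewrite -(cintN I2); apply: eq_cint => j; exact: UN.
have -> : cint cnt U = 0.
  have n2 : (2 : R[i]) != 0 by rewrite pnatr_eq0.
  by apply: (mulfI n2); rewrite mulr0 mulr_natl mulr2n {1}V addNr.
by rewrite mulr0.
Qed.

End LatticeSums.

(** * Annihilation of polynomials and Lagrange interpolation on the lattice *)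

Section LatticeInterpolation.
Context (R : realType) (t y : R) (y0 : 0 < y).
Local Notation cnt2 := (@zcount R \x @zcount R)%E.
Local Notation lat := (lat t y).
Local Notation wt := (wt t y).
Local Notation beta := (beta y).

Lemma normc_wt_le (A B M : R) (f : int * int -> R[i]) p : B < beta ->
  normc (f p) <= M * expR (A * normc (lat p) + B * normc (lat p) ^+ 2) ->
  normc (wt p * f p) <= M * expR (A ^+ 2 / (2 * (beta - B))) * expR (- ((beta - B) / 2 * normc (lat p) ^+ 2)).
Proof.
move=> Bb fM; have b0 : 0 < beta - B by rewrite subr_gt0.
have M0 : 0 <= M by have := le_trans (normc_ge0 _) fM; rewrite pmulr_lge0 ?expR_gt0.
rewrite normcM normc_wt mulrC; apply: le_trans (ler_wpM2r (expR_ge0 _) fM) _.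
rewrite -[leLHS]mulrA -[leRHS]mulrA; apply: (ler_wpM2l M0); rewrite -[leLHS]expRD.
have H := expR_lin_le A (normc (lat p)) b0; apply: le_trans _ H.
by rewrite ler_expR le_eqVlt; apply/orP; left; apply/eqP; ring.
Qed.

Lemma cintg_wt2 (A B M : R) (f : int * int -> R[i]) : B < beta ->
  (forall p, normc (f p) <= M * expR (A * normc (lat p) + B * normc (lat p) ^+ 2)) ->
  cintg cnt2 (fun p => wt p * f p).
Proof.
move=> Bb fM; have b0 : 0 < (beta - B) / 2 by rewrite divr_gt0 // subr_gt0.
by apply: (cintg_lgauss y0 b0) => p; exact: normc_wt_le.
Qed.

Lemma cintg_wt_cexp (a : R[i]) : cintg cnt2 (fun p => wt p * cexp (a * lat p)).
Proof.
apply: (@cintg_wt R t y y0 (normc a) 1) => p; rewrite mul1r.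
by apply: le_trans (normc_cexp_le _) _; rewrite ler_expR normcM.
Qed.

Lemma exprn_le_expR (x : R) k : 0 <= x -> x ^+ k <= expR (k%:R * x).
Proof.
move=> x0; rewrite expRM_natl lerXn2r ?nnegrE ?expR_ge0 //.
by apply: le_trans (expR_ge1Dx x); rewrite lerDr.
Qed.

Lemma cintg_wt_pow k : cintg cnt2 (fun p => wt p * lat p ^+ k).
Proof.
apply: (@cintg_wt R t y y0 k%:R 1) => p; rewrite mul1r normcX.
by apply: exprn_le_expR; exact: normc_ge0.
Qed.

Lemma cvg_invS : (n.+1%:R^-1 : R) @[n --> \oo] --> (0 : R).
Proof. exact: cvg_harmonic. Qed.

(** The k-th power of the difference quotient (exp(e l) - 1) / e with e = 2 pi i / (n + 1) is, by
    the binomial theorem, a combination of exponentials covered by [sum_wt_exp], and it tends to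
    l^k. *)
Lemma sum_wt_pow k : cint cnt2 (fun p => wt p * lat p ^+ k) = 0.
Proof.
have pi0 := pi_gt0 R.
pose e (n : nat) : R[i] := 0 +i* (2 * pi * n.+1%:R^-1).
have en n : normc (e n) = 2 * pi * n.+1%:R^-1.
  by rewrite /e /= expr0n add0r sqrtr_sqr ger0_norm // mulr_ge0 ?invr_ge0 // mulr_ge0 // ltW.
have e_gt0 n : 0 < normc (e n) by rewrite en mulr_gt0 ?invr_gt0 ?ltr0n // mulr_gt0.
have e_neq0 n : e n != 0 by rewrite -normc_gt0.
have e_le n : normc (e n) <= 2 * pi.
  by rewrite en ler_piMr ?mulr_ge0 ?(ltW pi0) // invf_le1 ?ltr0n // ler1n.
pose d n p := (cexp (e n * lat p) - 1) / e n.
have dle n p : normc (d n p) <= normc (lat p) * expR (2 * pi * normc (lat p)).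
  rewrite normcM normcV ler_pdivrMr //; apply: le_trans (cexp_sub1_le _) _.
  rewrite normcM [leRHS]mulrAC; apply: ler_pM; rewrite ?mulr_ge0 ?normc_ge0 ?expR_ge0 //.
    by rewrite mulrC.
  by rewrite ler_expR; apply: ler_wpM2r; rewrite ?normc_ge0.
have dcv p : ccvg (fun n => d n p) (lat p).
  pose C := normc (lat p) ^+ 2 * expR (2 * pi * normc (lat p)) * (2 * pi).
  have H n : normc (d n p - lat p) <= C * n.+1%:R^-1.
    have -> : d n p - lat p = (cexp (e n * lat p) - 1 - e n * lat p) / e n.
      by rewrite /d [RHS]mulrBl [X in _ = _ - X]mulrAC divff // mul1r.
    rewrite normcM normcV ler_pdivrMr //; apply: le_trans (cexp_sub1z_le _) _.
    rewrite normcM exprMn /C (_ : _ * _ * normc (e n) = (normc (e n) ^+ 2 * normc (lat p) ^+ 2) * expR (2 * pi * normc (lat p))).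
      apply: ler_wpM2l; first by rewrite mulr_ge0 ?sqr_ge0.
      by rewrite ler_expR; apply: ler_wpM2r; rewrite ?normc_ge0.
    rewrite en; ring.
  apply: (cvg0_squeeze (b := fun n => C * n.+1%:R^-1)).
    by move=> n; rewrite normc_ge0 H.
  by rewrite -(mulr0 C); apply: cvgM; [exact: cvg_cst|exact: cvg_invS].
have S0 n : cint cnt2 (fun p => wt p * d n p ^+ k) = 0.
  pose F (i : 'I_k.+1) p := ((-1) ^+ i *+ 'C(k, i)) / (e n) ^+ k *
    (wt p * cexp ((0 +i* (2 * pi * ((k - i)%:R * n.+1%:R^-1))) * lat p)).
  have IF i : cintg cnt2 (F i) by apply: cintgZ; exact: cintg_wt_cexp.
  transitivity (cint cnt2 (fun p => \sum_(i <- index_enum 'I_k.+1) F i p)).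
    apply: eq_cint => p; rewrite /d exprMn exprVn exprBn mulr_suml mulr_sumr.
    apply: eq_bigr => i _; rewrite /F expr1n mulr1 -cexpMn.
    have -> : e n * lat p *+ (k - i) = (0 +i* (2 * pi * ((k - i)%:R * n.+1%:R^-1))) * lat p.
      rewrite -mulrnAl; congr (_ * _); apply: complexP; rewrite /e.
        by rewrite raddfMn /= mul0rn.
      by rewrite raddfMn /= -mulr_natl; ring.
    by rewrite -!mulrnAl; ring.
  rewrite cint_sum // big1 // => i _; rewrite /F cintZ ?sum_wt_exp ?mulr0 //.
  exact: cintg_wt_cexp.
pose h p := expR ((2 * pi * k%:R + k%:R) ^+ 2 / (2 * beta)) * expR (- (beta / 2 * normc (lat p) ^+ 2)).
have b20 : 0 < beta / 2 by rewrite divr_gt0 // beta_gt0.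
have Ih := integrableZl measurableT (expR ((2 * pi * k%:R + k%:R) ^+ 2 / (2 * beta))) (integrable_lgauss0 t y0 b20).
have lim : ccvg (fun n => cint cnt2 (fun p => wt p * d n p ^+ k)) (cint cnt2 (fun p => wt p * lat p ^+ k)).
  apply: (cint_dominated (mu := cnt2) (fn := fun n p => wt p * d n p ^+ k) (h := h) _ Ih).
  - by move=> n; exact: cmeas_int2.
  - move=> n p; apply: le_trans (@normc_wt_le (2 * pi * k%:R + k%:R) 0 1 (fun p => d n p ^+ k) p (beta_gt0 y0) _) _; last first.
      by rewrite subr0 mul1r.
    rewrite mul0r addr0 mul1r normcX.
    apply: le_trans (_ : (normc (lat p) * expR (2 * pi * normc (lat p))) ^+ k <= _).
      by apply: lerXn2r; rewrite ?nnegrE ?mulr_ge0 ?normc_ge0 ?expR_ge0.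
    rewrite exprMn -expRM_natl [(_ + k%:R) * _]mulrDl expRD mulrC.
    have -> : 2 * pi * k%:R * normc (lat p) = k%:R * (2 * pi * normc (lat p)) by ring.
    by apply: ler_wpM2l; [exact: expR_ge0|exact: (exprn_le_expR k (normc_ge0 _))].
  - by move=> p; apply: ccvgZ; exact: ccvgX.
have lim0 : ccvg (fun n => cint cnt2 (fun p => wt p * d n p ^+ k)) 0.
  by under eq_fun do rewrite S0; exact: ccvg_cst.
exact: (ccvg_unique lim lim0).
Qed.

Lemma sum_wt_poly (P : {poly R[i]}) :
  cintg cnt2 (fun p => wt p * P.[lat p]) /\ cint cnt2 (fun p => wt p * P.[lat p]) = 0.
Proof.
pose F (i : 'I_(size P)) p := P`_i * (wt p * lat p ^+ i).
have IF i : cintg cnt2 (F i) by apply: cintgZ; exact: cintg_wt_pow.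
have E : (fun p => wt p * P.[lat p]) = (fun p => \sum_(i <- index_enum 'I_(size P)) F i p).
  by apply/funext => p; rewrite horner_coef mulr_sumr; apply: eq_bigr => i _; rewrite /F; ring.
rewrite E; split; first exact: cintg_sum.
rewrite cint_sum // big1 // => i _; rewrite /F cintZ ?sum_wt_pow ?mulr0 //.
exact: cintg_wt_pow.
Qed.

Lemma dist_int_gt0 (x : R) : (forall m : int, m%:~R != x) -> exists2 d : R, 0 < d & forall m : int, d <= `|m%:~R - x|.
Proof.
move=> xZ; have /andP[f1 f2] := floor_itv x; set f := Num.floor x in f1 f2.
exists (Num.min (x - f%:~R) ((f + 1)%:~R - x)).
  by rewrite lt_min !subr_gt0 f2 andbT lt_neqAle xZ.
move=> m; have [mf|mf] := leP m f.
  rewrite distrC; apply: le_trans (ler_norm _); rewrite ge_min lerD2l lerN2.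
  by rewrite ler_int mf.
apply: le_trans (ler_norm _); rewrite ge_min lerD2r ler_int orbC.
by rewrite -lezD1 in mf; rewrite mf.
Qed.

(** Either w lies strictly between two rows of the lattice, or it lies on a row strictly between two
    of its points; then the other rows are at distance at least y. *)
Lemma lat_dist (w : R[i]) : (forall p, lat p != w) -> exists2 d : R, 0 < d & forall p, d <= normc (lat p - w).
Proof.
move=> wL; have yn : y != 0 by rewrite gt_eqF.
have [[n0 /eqP En0]|H] := pselect (exists n : int, n%:~R == Im w / y); last first.
  have [m|d d0 hd] := @dist_int_gt0 (Im w / y).
    by apply/negP => /eqP E; apply: H; exists m; apply/eqP.
  exists (d * y); first exact: mulr_gt0.
  move=> p; apply: le_trans (normr_Im _); rewrite !ReImE /=.
  rewrite (_ : _ - _ = (p.2%:~R - Im w / y) * y); last by field.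
  by rewrite normrM (gtr0_norm y0) ler_pM2r.
have [m|d d0 hd] := @dist_int_gt0 (Re w - n0%:~R * t).
  apply: contra_neq (wL (m, n0)) => E; apply: complexP => /=; first by rewrite E subrK.
  by rewrite En0 mulfVK.
exists (Num.min d y); first by rewrite lt_min d0.
move=> [m n]; have [->|nn] := eqVneq n n0.
  apply: le_trans (normr_Re _); rewrite ge_min; apply/orP; left.
  by rewrite !ReImE /= -addrA -opprB; have := hd m; rewrite opprB.
apply: le_trans (normr_Im _); rewrite ge_min; apply/orP; right.
rewrite !ReImE /= (_ : _ - _ = (n - n0)%:~R * y); last first.
  by rewrite intrD mulrNz En0; field.
rewrite normrM (gtr0_norm y0) ler_peMl ?(ltW y0) //.
rewrite -intr_norm -[1]/(1%:~R) ler_int -gtz0_ge1.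
by rewrite normr_gt0 subr_eq0.
Qed.

Context (w : R[i]) (wL : forall p, lat p != w).

(** Classically the partial fraction expansion of - theta'(0) / theta(w). What is established below
    is a lower bound for its product with theta(w). *)
Definition lagr0 : R[i] := cint cnt2 (fun p => wt p / (lat p - w)).

Lemma lat_sub_neq0 p : lat p - w != 0. Proof. by rewrite subr_eq0. Qed.

Lemma cintg_wt_div (A B M : R) (f : int * int -> R[i]) : B < beta ->
  (forall p, normc (f p) <= M * expR (A * normc (lat p) + B * normc (lat p) ^+ 2)) ->
  cintg cnt2 (fun p => wt p * f p / (lat p - w)).
Proof.
move=> Bb fM; have [d d0 hd] := lat_dist wL.
under eq_fun do rewrite -mulrA.
apply: (@cintg_wt2 A B (M / d)) => // p.
rewrite normcM normcV mulrAC; apply: ler_pM => //; rewrite ?normc_ge0 ?invr_ge0 ?normc_ge0 //.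
by rewrite lef_pV2 ?posrE ?normc_gt0 ?lat_sub_neq0 ?hd.
Qed.

Lemma cintg_lagr0 : cintg cnt2 (fun p => wt p / (lat p - w)).
Proof.
have := @cintg_wt_div 0 0 1 (fun=> 1) (beta_gt0 y0); under eq_fun do rewrite mulr1.
by apply => p; rewrite !mul0r addr0 expR0 mulr1 normc1.
Qed.

(** The quotient of P - P(w) by X - w is a polynomial, and the weights annihilate it. *)
Lemma lagrange_poly (P : {poly R[i]}) :
  cint cnt2 (fun p => wt p * P.[lat p] / (lat p - w)) = P.[w] * lagr0.
Proof.
have /factor_theorem [Q PQ] : root (P - P.[w]%:P) w by rewrite /root hornerD hornerN hornerC subrr.
have E z : P.[z] = Q.[z] * (z - w) + P.[w].
  have := congr1 (fun q => q.[z]) PQ; rewrite hornerD hornerN hornerC hornerM hornerXsubC => <-.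
  by rewrite subrK.
transitivity (cint cnt2 (fun p => wt p * Q.[lat p] + P.[w] * (wt p / (lat p - w)))).
  apply: eq_cint => p; rewrite E; have := lat_sub_neq0 p; set z := lat p - w => z0.
  by rewrite mulrDr mulrDl [wt p * (_ * z)]mulrA mulfK // [wt p * P.[w]]mulrC -[P.[w] * wt p / z]mulrA.
have [i1 e1] := sum_wt_poly Q.
by rewrite (cintD i1 (cintgZ _ cintg_lagr0)) e1 add0r (cintZ _ cintg_lagr0).
Qed.

(** Approximate the exponential by the polynomials [cexp_approx] of its exponent; |b| < beta leaves
    a Gaussian majorant uniform in n. *)
Lemma lagrange_exp (a b : R[i]) : normc b < beta ->
  cintg cnt2 (fun p => wt p * cexp (a * lat p + b * lat p ^+ 2) / (lat p - w)) /\
  cint cnt2 (fun p => wt p * cexp (a * lat p + b * lat p ^+ 2) / (lat p - w)) =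
  cexp (a * w + b * w ^+ 2) * lagr0.
Proof.
move=> bb; have [d d0 hd] := lat_dist wL.
have nq p : normc (a * lat p + b * lat p ^+ 2) <= normc a * normc (lat p) + normc b * normc (lat p) ^+ 2.
  by apply: le_trans (normcD _ _) _; rewrite (normcM a) (normcM b) normcX.
have I1 : cintg cnt2 (fun p => wt p * cexp (a * lat p + b * lat p ^+ 2) / (lat p - w)).
  apply: (@cintg_wt_div (normc a) (normc b) 1) => // p; rewrite mul1r.
  by apply: le_trans (normc_cexp_le _) _; rewrite ler_expR.
split => //.
pose P n : {poly R[i]} := (1 + (n.+1%:R%:C)^-1 *: (a *: 'X + b *: 'X ^+ 2)) ^+ n.+1.
have PE n z : (P n).[z] = cexp_approx (a * z + b * z ^+ 2) n.
  by rewrite /P /cexp_approx !hornerE mulrC.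
have b0 : 0 < beta - normc b by rewrite subr_gt0.
have b20 : 0 < (beta - normc b) / 2 by rewrite divr_gt0.
pose C := d^-1 * expR (normc a ^+ 2 / (2 * (beta - normc b))).
have lim : ccvg (fun n => cint cnt2 (fun p => wt p * (P n).[lat p] / (lat p - w)))
    (cint cnt2 (fun p => wt p * cexp (a * lat p + b * lat p ^+ 2) / (lat p - w))).
  apply: (cint_dominated (mu := cnt2) (fn := fun n p => wt p * (P n).[lat p] / (lat p - w)) _
     (integrableZl measurableT C (integrable_lgauss0 t y0 b20))).
  - by move=> n; exact: cmeas_int2.
  - move=> n p; rewrite -mulrA.
    apply: (normc_wt_le (f := fun p => (P n).[lat p] / (lat p - w)) bb).
    rewrite normcM normcV mulrC; apply: ler_pM; rewrite ?normc_ge0 ?invr_ge0 ?normc_ge0 //.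
      by rewrite lef_pV2 ?posrE ?normc_gt0 ?lat_sub_neq0 ?hd.
    by rewrite PE; apply: le_trans (cexp_approx_le _ _) _; rewrite ler_expR.
  - move=> p; under eq_fun do rewrite PE.
    by apply: ccvgM; [apply: ccvgZ; exact: cvg_cexp_approx|exact: ccvg_cst].
apply: (ccvg_unique lim); under eq_fun do rewrite lagrange_poly PE.
by apply: ccvgM; [exact: cvg_cexp_approx|exact: ccvg_cst].
Qed.

End LatticeInterpolation.

Lemma normc_cint_le (R : realType) d (T : measurableType d) (mu : {measure set T -> \bar R})
    (f : T -> R[i]) (c : R) : cintg mu f ->
  (\int[mu]_x (normc (f x))%:E <= c%:E)%E -> normc (cint mu f) <= c.
Proof.
move=> If fc; apply: le_trans (normc_cint If) _.
rewrite -lee_fin fineK //; exact: (integrable_fin_num measurableT (cintg_norm If)).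
Qed.

(** * The odd theta function with zeros on the lattice *)

Section Theta.
Context (R : realType) (t y : R) (y0 : 0 < y).
Local Notation cnt := (@zcount R).
Local Notation lat := (lat t y).
Local Notation beta := (beta y).

Definition half (n : int) : R := n%:~R + 2^-1.

(* [n]-th term of [e^(beta z^2) * sum_n (-1)^n e^(i pi tau (n+1/2)^2 + 2 i pi (n+1/2) z)], [tau = t + i y] *)
Definition theta_term (n : int) (z : R[i]) : R[i] :=
  cexp (beta%:C * (z * z) + (0 +i* pi) *
    ((n%:~R : R)%:C + (t +i* y) * (half n ^+ 2)%:C + (2 * half n)%:C * z)).

(** The factor e^(beta z^2) in the terms makes the growth of Jacobi's odd theta function isotropic,
    as for a modified Weierstrass sigma function. *)
Definition theta (z : R[i]) : R[i] := cint cnt (theta_term ^~ z).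

Let yn : y != 0. Proof. by rewrite gt_eqF. Qed.
Let pi0 : 0 < (pi : R). Proof. exact: pi_gt0. Qed.
Let py0 : 0 < pi * y. Proof. exact: mulr_gt0. Qed.
Let b0 : 0 < beta. Proof. exact: beta_gt0. Qed.

Let c1 : 0 <= 2 * beta ^+ 2.
Proof. by apply: mulr_ge0 => //; exact: sqr_ge0. Qed.
Let c2 : 0 <= 32 * pi / y.
Proof. by apply: divr_ge0; [apply: mulr_ge0 => //; exact: ltW|exact: ltW]. Qed.
Let c3 : 0 <= 4 * pi / y.
Proof. by apply: divr_ge0; [apply: mulr_ge0 => //; exact: ltW|exact: ltW]. Qed.
Let b1 : 0 <= beta. Proof. exact: ltW. Qed.

Lemma normc_theta_term n z : normc (theta_term n z) =
  expR (beta * normc z ^+ 2) * expR (- (pi * y * (n%:~R - (- (2^-1 + Im z / y))) ^+ 2)).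
Proof.
rewrite /theta_term normc_cexp -expRD normc_sqr !ReImE /= /half /beta.
by congr expR; move: (pi : R) => p; field.
Qed.

Lemma cintg_theta z : cintg cnt (theta_term ^~ z).
Proof.
have I := integrableZl measurableT (expR (beta * normc z ^+ 2)) (integrable_zgauss (- (2^-1 + Im z / y)) py0).
apply: (cintg_le _ I); first exact: cmeas_int.
by move=> n; rewrite normc_theta_term.
Qed.

Definition theta_bound : R := expR (pi * y) * Num.sqrt (pi / (pi * y / 2)).
Lemma theta_bound_ge0 : 0 <= theta_bound.
Proof. by rewrite mulr_ge0 ?expR_ge0 ?sqrtr_ge0. Qed.

Lemma sum_normc_theta_le z :
  (\int[cnt]_n (normc (theta_term n z))%:E <= (expR (beta * normc z ^+ 2) * theta_bound)%:E)%E.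
Proof.
under eq_integral do rewrite normc_theta_term EFinM.
rewrite ge0_integralZl ?lee_fin ?expR_ge0 // EFinM lee_wpmul2l ?lee_fin ?expR_ge0 //.
exact: zsum_gauss_le.
Qed.

Lemma normc_theta_le z : normc (theta z) <= theta_bound * expR (beta * normc z ^+ 2).
Proof.
by apply: (normc_cint_le (cintg_theta z)); rewrite mulrC; exact: sum_normc_theta_le.
Qed.

Lemma theta_term_shift n z p : theta_term n (z + lat p) =
  chi R p * cexp ((2 * beta)%:C * conjc (lat p) * z + (beta * normc (lat p) ^+ 2)%:C) * theta_term (n + p.2) z.
Proof.
(* The two exponents differ by 2 pi i (n m - k), which is inserted here into the phase of [chi]. *)
case: p => m k; rewrite /chi -(e2pi_shift _ (n * m - k)) /e2pi /theta_term -!cexpD normc_sqr /=.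
congr cexp; case: z => a b; apply: complexP; rewrite !ReImE /= /half /beta ?intrD ?mulrNz ?intrM.
  by move: (pi : R) => q; field.
by move: (pi : R) => q; field.
Qed.

Lemma theta_shift z p : theta (z + lat p) =
  chi R p * cexp ((2 * beta)%:C * conjc (lat p) * z + (beta * normc (lat p) ^+ 2)%:C) * theta z.
Proof.
rewrite /theta (eq_cint cnt (fun n => theta_term_shift n z p)).
have bij : bijective (fun n : int => n + p.2) by exists (fun n => n - p.2) => n; rewrite ?addrK ?subrK.
by have [I E] := cint_cnt_bij bij (cintg_theta z); rewrite (cintZ _ I) E.
Qed.

(** The reflection n |-> -1 - n negates [half n] and changes the sign (-1)^n. *)
Lemma theta_term_odd n z : theta_term (- 1 - n) (- z) = - theta_term n z.
Proof.
rewrite -[RHS]mulN1r -cexp_pi -[cexp (0 +i* pi)]mulr1 -(@e2pi_int R (- 1 - n)) /e2pi /theta_term -!cexpD.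
congr cexp; case: z => a b; apply: complexP; rewrite !ReImE /= /half /beta ?intrD ?mulrNz.
  by move: (pi : R) => q; field.
by move: (pi : R) => q; field.
Qed.

Lemma theta_odd z : theta (- z) = - theta z.
Proof.
have bij : bijective (fun n : int => - 1 - n) by exists (fun n => - 1 - n) => n; rewrite opprB addrCA subrr addr0.
rewrite /theta -(cint_cnt_bij bij (cintg_theta (- z))).2 -(cintN (cintg_theta z)).
by apply: eq_cint => n; exact: theta_term_odd.
Qed.

Lemma theta0 : theta 0 = 0.
Proof.
have := theta_odd 0; rewrite oppr0 => E.
have n2 : (2 : R[i]) != 0 by rewrite pnatr_eq0.
by apply: (mulfI n2); rewrite mulr0 mulr_natl mulr2n {1}E addNr.
Qed.

(** The derivative theta'(0), taken term by term. *)
Definition theta_slope : R[i] := cint cnt (fun n => (0 +i* (2 * pi * half n)) * theta_term n 0).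

Lemma normc_theta_term0 n : normc (theta_term n 0) = expR (- (pi * y * half n ^+ 2)).
Proof.
rewrite normc_theta_term normc0 expr0n /= mulr0 expR0 mul1r mul0r addr0 opprK.
by congr expR.
Qed.

Definition taylor_cst : R := 2 * beta ^+ 2 + 32 * pi / y + beta.

(** The inequality of means splits the linear part 2 pi i h z of the exponent x into a multiple of
    |z|^2 and a quarter of the Gaussian exponent pi y h^2. This is spent twice, on |x|^2 and on
    e^|x|, so half of the decay in n remains. *)
Lemma theta_term_taylor n z :
  normc (theta_term n z - theta_term n 0 - (0 +i* (2 * pi * half n)) * theta_term n 0 * z) <=
  normc z ^+ 2 * taylor_cst * expR ((1 + beta + 4 * pi / y) * normc z ^+ 2) *
  expR (- (pi * y / 2 * half n ^+ 2)).
Proof.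
set r := normc z; set h := half n.
pose q := (0 +i* (2 * pi * h)) : R[i].
pose x := beta%:C * (z * z) + q * z.
have nz : 0 <= r := normc_ge0 z.
have E : theta_term n z - theta_term n 0 - q * theta_term n 0 * z =
    theta_term n 0 * ((cexp x - 1 - x) + beta%:C * (z * z)).
  have -> : theta_term n z = theta_term n 0 * cexp x.
    rewrite /theta_term -cexpD; congr cexp; rewrite /x /q -/h; case: (z) => a b; apply: complexP; rewrite !ReImE /=; ring.
  by rewrite /x; ring.
rewrite -/q E normcM normc_theta_term0 -/h.
have bE : normc (beta%:C * (z * z)) = beta * r ^+ 2.
  by rewrite normcM normcR (gtr0_norm b0) normcM -expr2.
have xle : normc x <= beta * r ^+ 2 + 2 * pi * `|h| * r.
  apply: le_trans (normcD _ _) _; rewrite bE lerD2l normcM /q.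
  have -> : normc (0 +i* (2 * pi * h)) = 2 * pi * `|h|.
    by rewrite /= expr0n add0r sqrtr_sqr normrM ger0_norm // mulr_ge0 ?(ltW pi0) ?(ltW y0) ?(ltW b0) ?(ltW py0) //.
  by [].
have xle1 : normc x <= (beta + 4 * pi / y) * r ^+ 2 + pi * y / 4 * h ^+ 2.
  apply: le_trans xle _; rewrite -subr_ge0 -[h ^+ 2]real_normK ?num_real //.
  rewrite [X in 0 <= X](_ : _ = pi / (4 * y) * (4 * r - y * `|h|) ^+ 2); last first.
    by move: (pi : R) => p; move: `|h| => k; field.
  by rewrite mulr_ge0 ?sqr_ge0 // divr_ge0 ?mulr_ge0 ?(ltW pi0) ?(ltW y0) ?(ltW b0) ?(ltW py0) //.
have xle2 : normc x ^+ 2 <= r ^+ 2 * ((2 * beta ^+ 2 + 32 * pi / y) * (expR (r ^+ 2) * expR (pi * y / 4 * h ^+ 2))).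
  apply: le_trans (_ : (beta * r ^+ 2 + 2 * pi * `|h| * r) ^+ 2 <= _).
    by apply: lerXn2r => //; rewrite nnegrE ?normc_ge0 //; apply: le_trans xle; exact: normc_ge0.
  apply: le_trans (_ : r ^+ 2 * (2 * beta ^+ 2 * r ^+ 2 + 32 * pi / y * (pi * y / 4 * h ^+ 2)) <= _).
    rewrite -subr_ge0 -[h ^+ 2]real_normK ?num_real //.
    rewrite [X in 0 <= X](_ : _ = r ^+ 2 * (beta * r - 2 * pi * `|h|) ^+ 2); last first.
      by move: (pi : R) (beta) => p b; move: `|h| => k; field.
    by rewrite mulr_ge0 ?sqr_ge0.
  apply: ler_wpM2l; first exact: sqr_ge0.
  have u0 : 0 <= r ^+ 2 by exact: sqr_ge0.
  have v0 : 0 <= pi * y / 4 * h ^+ 2 by rewrite mulr_ge0 ?sqr_ge0 // divr_ge0 ?(ltW pi0) ?(ltW y0) ?(ltW b0) ?(ltW py0) //.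
  have eu := expR_ge1Dx (r ^+ 2); have ev := expR_ge1Dx (pi * y / 4 * h ^+ 2).
  rewrite [leRHS]mulrDl; apply: lerD; apply: ler_wpM2l => //.
    by rewrite -[leLHS]mulr1; apply: ler_pM => //; lra.
  by rewrite -[leLHS]mul1r; apply: ler_pM => //; lra.
have e1 : expR (normc x) <= expR ((beta + 4 * pi / y) * r ^+ 2) * expR (pi * y / 4 * h ^+ 2).
  by rewrite -expRD ler_expR.
pose K := 2 * beta ^+ 2 + 32 * pi / y.
have K0 : 0 <= K := addr_ge0 c1 c2.
pose G := expR ((1 + beta + 4 * pi / y) * r ^+ 2) * expR (pi * y / 2 * h ^+ 2).
have G1 : 1 <= G.
  rewrite /G -expRD -[leLHS]expR0 ler_expR; apply: addr_ge0; apply: mulr_ge0; rewrite ?sqr_ge0 //.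
    exact: addr_ge0 (addr_ge0 ler01 b1) c3.
  by rewrite divr_ge0 // ltW.
have main : normc (cexp x - 1 - x + beta%:C * (z * z)) <= r ^+ 2 * taylor_cst * G.
  apply: le_trans (normcD _ _) _; rewrite bE /taylor_cst -/K [X in X * G]mulrDr [leRHS]mulrDl; apply: lerD; last first.
    by rewrite [beta * _]mulrC -[leLHS]mulr1; apply: (ler_wpM2l (mulr_ge0 (sqr_ge0 r) b1)).
  apply: le_trans (cexp_sub1z_le _) _.
  apply: le_trans (_ : r ^+ 2 * (K * (expR (r ^+ 2) * expR (pi * y / 4 * h ^+ 2))) *
     (expR ((beta + 4 * pi / y) * r ^+ 2) * expR (pi * y / 4 * h ^+ 2)) <= _).
    by apply: ler_pM => //; rewrite ?sqr_ge0 ?expR_ge0.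
  rewrite /G le_eqVlt; apply/orP; left; apply/eqP.
  have -> : (1 + beta + 4 * pi / y) * r ^+ 2 = r ^+ 2 + (beta + 4 * pi / y) * r ^+ 2 by ring.
  have -> : pi * y / 2 * h ^+ 2 = pi * y / 4 * h ^+ 2 + pi * y / 4 * h ^+ 2 by field.
  by rewrite !expRD; ring.
rewrite mulrC; apply: le_trans (ler_wpM2r (expR_ge0 _) main) _.
have -> : expR (- (pi * y / 2 * h ^+ 2)) = expR (pi * y / 2 * h ^+ 2) * expR (- (pi * y * h ^+ 2)).
  by rewrite -expRD; congr expR; field.
by rewrite /G le_eqVlt; apply/orP; left; apply/eqP; rewrite -!mulrA.
Qed.

(** One constant serves both as factor and as exponent; the sum of the termwise remainders converges
    by the decay in n left over there. *)
Lemma theta_taylor : exists2 C : R, 0 < C & forall z,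
  normc (theta z - theta_slope * z) <= C * normc z ^+ 2 * expR (C * normc z ^+ 2).
Proof.
have a0 : 0 < pi * y / 2 by rewrite divr_gt0.
have Ig := integrable_zgauss (- 2^-1) a0.
have hE n : half n = n%:~R - - 2^-1 by rewrite opprK.
have I1 : cintg cnt (fun n => (0 +i* (2 * pi * half n)) * theta_term n 0).
  apply: (cintg_le _ (integrableZl measurableT (2 * pi * (1 + (pi * y)^-1)) Ig)); first exact: cmeas_int.
  move=> n; rewrite normcM normc_theta_term0.
  have -> : normc (0 +i* (2 * pi * half n)) = 2 * pi * `|half n|.
    by rewrite /= expr0n add0r sqrtr_sqr normrM ger0_norm // mulr_ge0 ?(ltW pi0) ?(ltW y0) ?(ltW b0) ?(ltW py0) //.
  rewrite -hE -[leLHS]mulrA -[leRHS]mulrA; apply: ler_wpM2l; first by rewrite mulr_ge0 // ltW.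
  exact: (absr_gauss_le (half n) py0).
pose S := expR (pi * y / 2) * Num.sqrt (pi / (pi * y / 2 / 2)).
have S0 : 0 <= S by rewrite mulr_ge0 ?expR_ge0 ?sqrtr_ge0.
pose C1 := taylor_cst * S; pose C2 := 1 + beta + 4 * pi / y.
have t0 : 0 <= taylor_cst := addr_ge0 (addr_ge0 c1 c2) b1.
have C10 : 0 <= C1 by rewrite mulr_ge0.
have C20 : 0 < C2 by rewrite /C2 -addrA; exact: ltr_pwDl ltr01 (addr_ge0 b1 c3).
exists (C1 + C2) => [|z]; first exact: (ltr_wpDl C10 C20).
have Iz := cintgB (cintgB (cintg_theta z) (cintg_theta 0)) (cintgZr z I1).
have E : theta z - theta_slope * z = cint cnt (fun n => theta_term n z - theta_term n 0 - (0 +i* (2 * pi * half n)) * theta_term n 0 * z).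
  rewrite (cintB (cintgB (cintg_theta z) (cintg_theta 0)) (cintgZr z I1)).
  rewrite (cintB (cintg_theta z) (cintg_theta 0)) (cintZr z I1) -/(theta 0) theta0 subr0 //.
rewrite E; apply: (normc_cint_le Iz).
pose c := normc z ^+ 2 * taylor_cst * expR (C2 * normc z ^+ 2).
have c0 : 0 <= c := mulr_ge0 (mulr_ge0 (sqr_ge0 _) t0) (expR_ge0 _).
apply: (@le_trans _ _ (\int[cnt]_n (c%:E * (expR (- (pi * y / 2 * (n%:~R - - 2^-1) ^+ 2)))%:E))%E).
  apply: ge0_le_integral => // n _; first by rewrite lee_fin normc_ge0.
  by rewrite -EFinM lee_fin -hE; exact: theta_term_taylor.
rewrite ge0_integralZl ?lee_fin //.
apply: (@le_trans _ _ (c%:E * S%:E)%E); first by rewrite lee_wpmul2l ?lee_fin // zsum_gauss_le.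
rewrite -EFinM lee_fin /c.
have -> : normc z ^+ 2 * taylor_cst * expR (C2 * normc z ^+ 2) * S = C1 * normc z ^+ 2 * expR (C2 * normc z ^+ 2) by rewrite /C1; ring.
apply: (ler_pM (mulr_ge0 C10 (sqr_ge0 _)) (expR_ge0 _)).
  by apply: ler_wpM2r; rewrite ?sqr_ge0 // lerDl ltW.
by rewrite ler_expR; apply: ler_wpM2r; rewrite ?sqr_ge0 // lerDr.
Qed.

(** For |z| <= 1 the factor |z| comes from the zero at 0, for larger z it costs nothing. It will
    cancel the denominator l_p - w in [key_expansion]. *)
Lemma theta_le_lin : exists2 M : R, 0 < M & forall z,
  normc (theta z) <= M * normc z * expR (beta * normc z ^+ 2).
Proof.
have [C C0 HC] := theta_taylor; have B0 := theta_bound_ge0.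
exists (theta_bound + 1 + normc theta_slope + C * expR C) => [|z].
  exact: ltr_wpDr (mulr_ge0 (ltW C0) (expR_ge0 _)) (ltr_wpDr (normc_ge0 _) (ltr_wpDl B0 ltr01)).
have e1 : 1 <= expR (beta * normc z ^+ 2).
  by rewrite -[leLHS]expR0 ler_expR (mulr_ge0 b1 (sqr_ge0 _)).
have n0 := normc_ge0 z; have s0 := normc_ge0 theta_slope.
have CE0 : 0 <= C * expR C := mulr_ge0 (ltW C0) (expR_ge0 _).
have [z1|z1] := leP (normc z) 1; last first.
  apply: le_trans (normc_theta_le z) _; apply: ler_wpM2r; first exact: expR_ge0.
  have := ltW z1; nra.
apply: le_trans (_ : normc theta_slope * normc z + C * expR C * normc z <= _).
  apply: le_trans (_ : normc (theta_slope * z) + normc (theta z - theta_slope * z) <= _).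
    by apply: le_trans (normcD _ _); rewrite addrC subrK.
  rewrite normcM lerD2l; apply: le_trans (HC z) _.
  have z2 : normc z ^+ 2 <= normc z by rewrite expr2 ler_piMr.
  have ez : expR (C * normc z ^+ 2) <= expR C by rewrite ler_expR ler_piMr ?(ltW C0) //; exact: le_trans z2 z1.
  rewrite [leRHS]mulrAC; apply: (ler_pM (mulr_ge0 (ltW C0) (sqr_ge0 _)) (expR_ge0 _) _ ez).
  by apply: ler_wpM2l => //; exact: ltW.
apply: le_trans (_ : (theta_bound + 1 + normc theta_slope + C * expR C) * normc z <= _).
  by rewrite -mulrDl; apply: ler_wpM2r => //; lra.
by rewrite ler_peMr //; exact: mulr_ge0 (addr_ge0 (addr_ge0 (addr_ge0 B0 ler01) s0) CE0) n0.
Qed.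

(** The point w will be approached along the ray from 0, where |u_n| <= |w|, so that one majorant
    serves all n. *)
Lemma theta_cvg (u : nat -> R[i]) w : ccvg u w -> (forall n, normc (u n) <= normc w) ->
  ccvg (fun n => theta (u n)) (theta w).
Proof.
move=> uw ul; have a0 : 0 < pi * y / 2 by rewrite divr_gt0.
have Ig := integrable_zgauss (- 2^-1) a0.
apply: (cint_dominated (mu := cnt) (fn := fun k n => theta_term n (u k)) _
  (integrableZl measurableT (expR ((beta + pi / y) * normc w ^+ 2)) Ig)).
- by move=> n; exact: cmeas_int.
- move=> k n; rewrite normc_theta_term -!expRD ler_expR.
  have hv : Im (u k) ^+ 2 <= normc w ^+ 2.
    rewrite -[Im _ ^+ 2]real_normK ?num_real //; apply: lerXn2r; rewrite ?nnegrE ?normc_ge0 //.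
    exact: le_trans (normr_Im _) (ul k).
  have hn : normc (u k) ^+ 2 <= normc w ^+ 2 by apply: lerXn2r; rewrite ?nnegrE ?normc_ge0.
  rewrite -subr_ge0.
  rewrite [X in 0 <= X](_ : _ = beta * (normc w ^+ 2 - normc (u k) ^+ 2) + pi / y * (normc w ^+ 2 - Im (u k) ^+ 2) +
    pi * y / 2 * (n%:~R + 2^-1 + 2 * (Im (u k) / y)) ^+ 2).
    have d1 : 0 <= normc w ^+ 2 - normc (u k) ^+ 2 by rewrite subr_ge0.
    have d2 : 0 <= normc w ^+ 2 - Im (u k) ^+ 2 by rewrite subr_ge0.
    by apply: addr_ge0 (mulr_ge0 (ltW a0) (sqr_ge0 _)); apply: addr_ge0; [exact: mulr_ge0|apply: mulr_ge0 => //; apply: divr_ge0; exact: ltW].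
  by move: (pi : R) (beta) => p b; field.
- move=> n; apply: ccvg_cexp; apply: ccvgD; first by apply: ccvgZ; exact: ccvgM.
  by apply: ccvgZ; apply: ccvgD; [exact: ccvg_cst|exact: ccvgZ].
Qed.

End Theta.

(** A name for the product measure to which a sigma-finite structure can be attached, so that Fubini
    applies with the whole lattice as one factor. *)
Definition zcount2 (R : realType) : set (int * int)%type -> \bar R := (@zcount R \x @zcount R)%E.
HB.instance Definition _ (R : realType) := Measure.copy (@zcount2 R) (@zcount R \x @zcount R)%E.

Lemma sigma_finite_zcount2 (R : realType) : sigma_finite [set: int * int] (@zcount2 R).
Proof.
exists (fun n => [set p : int * int | pickle p = n]).
  by apply/seteqP; split => // p _; exists (pickle p).
move=> n; have [[[a b] pn]|H] := pselect (exists p : int * int, pickle p = n).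
  have -> : [set p : int * int | pickle p = n] = [set a] `*` [set b].
    apply/seteqP; split => [p /= pE|[_ _] [/= -> ->] //].
    by have -> : p = (a, b) by apply: (pcan_inj pickleK); rewrite pE.
  split; first exact: measurableX.
  rewrite /zcount2 product_measure1E //.
  have -> : (@zcount R [set a] * @zcount R [set b] = 1%E)%E by rewrite !zcount_set1 mule1.
  exact: ltry.
have -> : [set p : int * int | pickle p = n] = set0.
  by apply/seteqP; split => // p /= pE; apply: H; exists p.
by split => //; rewrite measure0 ltry.
Qed.
HB.instance Definition _ (R : realType) :=
  @Measure_isSigmaFinite.Build _ _ _ (@zcount2 R) (@sigma_finite_zcount2 R).

(** * Interpolation of dilated theta functions *)

Section ThetaLagrange.
Context (R : realType) (t y : R) (y0 : 0 < y).
Local Notation cnt := (@zcount R).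
Local Notation cnt2 := (@zcount R \x @zcount R)%E.
Local Notation lat := (lat t y).
Local Notation wt := (wt t y).
Local Notation beta := (beta y).
Local Notation theta := (theta t y).
Local Notation theta_term := (theta_term t y).

Lemma normc_cint_lgauss_le (a M : R) (f : int * int -> R[i]) : 0 < a ->
  (forall p, normc (f p) <= M * expR (- (a * normc (lat p) ^+ 2))) ->
  normc (cint cnt2 f) <= M * (expR (a * (1 + y ^+ 2)) * (2 * pi / (a * y))).
Proof.
move=> a0 fM; apply: normc_cint_le; first exact: (cintg_lgauss y0 a0 fM).
have M0 : 0 <= M by have := le_trans (normc_ge0 _) (fM (0, 0)); rewrite pmulr_lge0 ?expR_gt0.
apply: (@le_trans _ _ (\int[cnt2]_p (M%:E * (expR (- (a * normc (lat p) ^+ 2)))%:E))%E).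
  apply: ge0_le_integral => //.
  - by move=> p _; rewrite lee_fin; exact: normc_ge0.
  - by apply: measurable_fun_int2.
  - by apply: measurable_fun_int2.
  - by move=> p _; rewrite -EFinM lee_fin; exact: fM.
rewrite ge0_integralZl ?lee_fin //; last by apply: measurable_fun_int2.
rewrite EFinM lee_wpmul2l ?lee_fin //.
have := lgauss_le t y0 0 a0.
rewrite (_ : (fun p => (expR (- (a * normc (lat p - 0) ^+ 2)))%:E) = (fun p => (expR (- (a * normc (lat p) ^+ 2)))%:E)) //.
by apply/funext => p; rewrite subr0.
Qed.

(** The function theta(r z) is a series of exponentials with quadratic coefficient beta r^2 < beta,
    so [lagrange_exp] applies term by term; r < 1 also makes the double series converge
    absolutely. *)
Lemma theta_lagrange (r : R) (w : R[i]) (wL : forall p, lat p != w) : 0 <= r < 1 ->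
  cint cnt2 (fun p => wt p * theta (r%:C * lat p) / (lat p - w)) = theta (r%:C * w) * lagr0 t y w.
Proof.
move=> /andP[r0 r1]; have b0 : 0 < beta := beta_gt0 y0.
have [d d0 hd] := lat_dist y0 wL.
have r2 : r ^+ 2 < 1 by rewrite exprn_ilt1.
pose a n : R[i] := (0 +i* pi) * (2 * half R n)%:C * r%:C.
pose b : R[i] := (beta * r ^+ 2)%:C.
have bb : normc b < beta.
  have B2 : 0 <= beta * r ^+ 2 := mulr_ge0 (ltW b0) (sqr_ge0 r).
  by rewrite /b normcR (ger0_norm B2) -[ltRHS]mulr1 ltr_pM2l.
have tE n z : theta_term n (r%:C * z) = theta_term n 0 * cexp (a n * z + b * z ^+ 2).
  rewrite /theta_term -cexpD; congr cexp; rewrite /a /b; ring.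
pose f (q : (int * int) * int) := wt q.1 * theta_term q.2 (r%:C * lat q.1) / (lat q.1 - w).
have fE p n : f (p, n) = theta_term n 0 * (wt p * cexp (a n * lat p + b * lat p ^+ 2) / (lat p - w)).
  rewrite /f tE; ring.
have I1 p : cintg cnt (fun n => f (p, n)).
  have := cintgZ (wt p / (lat p - w)) (cintg_theta t y0 (r%:C * lat p)).
  by congr cintg; apply/funext => n; rewrite /f; ring.
have I2 n : cintg cnt2 (fun p => f (p, n)).
  have := cintgZ (theta_term n 0) (lagrange_exp y0 wL (a n) bb).1.
  by congr cintg; apply/funext => p; rewrite fE.
have mf : cmeas f.
  by split; apply: measurable_fun_countable_prod => //; first [exact: countable_int2|exact: measurable_int2].
have b1 : 0 < beta * (1 - r ^+ 2) by rewrite mulr_gt0 // subr_gt0.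
have fin : (\int[cnt2]_p \int[cnt]_n (normc (f (p, n)))%:E < +oo)%E.
  have /integrableP[_] := integrableZl measurableT (d^-1 * theta_bound y) (integrable_lgauss0 t y0 b1).
  apply: le_lt_trans; apply: ge0_le_integral => //.
  - by move=> p _; apply: integral_ge0 => n _; rewrite lee_fin; exact: normc_ge0.
  - by apply: measurable_fun_int2.
  - by apply: measurable_fun_int2.
  move=> p _; rewrite gee0_abs; last first.
    by rewrite lee_fin; apply: mulr_ge0 (mulr_ge0 _ (theta_bound_ge0 y)) (expR_ge0 _); rewrite invr_ge0 ltW.
  have nf n : (normc (f (p, n)))%:E = ((normc (wt p) / normc (lat p - w))%:E * (normc (theta_term n (r%:C * lat p)))%:E)%E.
    by rewrite -EFinM /f (normcM (wt p * _)) normcV (normcM (wt p)); congr EFin; rewrite mulrAC.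
  under eq_integral do rewrite nf.
  have c0 : 0 <= normc (wt p) / normc (lat p - w) by apply: divr_ge0; exact: normc_ge0.
  rewrite ge0_integralZl ?lee_fin //; last by move=> n _; rewrite lee_fin; exact: normc_ge0.
  have c0E : (0 <= (normc (wt p) / normc (lat p - w))%:E)%E by rewrite lee_fin.
  apply: le_trans (lee_wpmul2l c0E (sum_normc_theta_le t y0 _)) _.
  rewrite -EFinM lee_fin normc_wt.
  have -> : d^-1 * theta_bound y * expR (- (beta * (1 - r ^+ 2) * normc (lat p) ^+ 2)) =
     expR (- (beta * normc (lat p) ^+ 2)) * d^-1 * (expR (beta * normc (r%:C * lat p) ^+ 2) * theta_bound y).
    have -> : - (beta * (1 - r ^+ 2) * normc (lat p) ^+ 2) =
        - (beta * normc (lat p) ^+ 2) + beta * normc (r%:C * lat p) ^+ 2.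
      by rewrite normcM normcR ger0_norm //; ring.
    by rewrite expRD; ring.
  apply: ler_wpM2r; first by rewrite (mulr_ge0 (expR_ge0 _) (theta_bound_ge0 y)).
  apply: ler_wpM2l; first exact: expR_ge0.
  by rewrite lef_pV2 ?posrE ?hd //; exact: lt_le_trans d0 (hd p).
have [_ _ _ sw _] := @cint_fubini _ _ _ _ R (@zcount2 R) cnt f mf I1 I2 fin.
transitivity (cint cnt2 (fun p => cint cnt (fun n => f (p, n)))).
  apply: eq_cint => p; have E : forall n, f (p, n) = (wt p / (lat p - w)) * theta_term n (r%:C * lat p).
    by move=> n; rewrite /f; ring.
  by rewrite (eq_cint cnt E) (cintZ _ (cintg_theta t y0 (r%:C * lat p))) mulrAC.
rewrite [LHS]sw /theta -(cintZr _ (cintg_theta t y0 (r%:C * w))); apply: eq_cint => n.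
rewrite (eq_cint cnt2 (fun p => fE p n)) (cintZ _ (lagrange_exp y0 wL (a n) bb).1).
by rewrite (lagrange_exp y0 wL (a n) bb).2 tE mulrA.
Qed.

Lemma chi2 p : chi R p * chi R p = 1.
Proof.
rewrite /chi -e2piD -(@e2pi_int R (p.1 + p.2 + p.1 * p.2)); congr e2pi.
by rewrite !intrD intrM; field.
Qed.

(** Write (1 - eta) l = l - eta l: the quasi-period factor of [theta] cancels the weight up to
    exp(-2 beta eta |l|^2), and oddness gives the sign. *)
Lemma wt_theta (eta : R) p : wt p * theta ((1 - eta)%:C * lat p) =
  - ((expR (- (2 * beta * eta * normc (lat p) ^+ 2)))%:C * theta (eta%:C * lat p)).
Proof.
have -> : (1 - eta)%:C * lat p = - (eta%:C * lat p) + lat p.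
  by rewrite rmorphB rmorph1 mulrBl mul1r addrC.
rewrite (theta_shift t y0) (theta_odd t y0).
have -> : (2 * beta)%:C * conjc (lat p) * - (eta%:C * lat p) + (beta * normc (lat p) ^+ 2)%:C =
    (- (2 * beta * eta * normc (lat p) ^+ 2) + beta * normc (lat p) ^+ 2)%:C.
  have E := mulcJ (lat p); have -> : (2 * beta)%:C * conjc (lat p) * - (eta%:C * lat p) = - ((2 * beta)%:C * eta%:C * (lat p * conjc (lat p))) by ring.
  by rewrite [lat p * _]E -!rmorphM -rmorphN -rmorphD.
rewrite cexp_real expRD rmorphM /wt.
have aux (x A B C T : R[i]) : B * C = 1 -> x * x = 1 -> x * B * (x * (A * C) * - T) = - (A * T).
  move=> h1 h2; have -> : x * B * (x * (A * C) * - T) = - ((x * x) * (B * C) * (A * T)) by ring.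
  by rewrite h1 h2 !mul1r.
apply: aux; last exact: chi2.
by rewrite -rmorphM -expRD addNr expR0.
Qed.

Let b0 : 0 < beta. Proof. exact: beta_gt0. Qed.

Lemma theta_lagrange_eta (eta : R) (w : R[i]) (wL : forall p, lat p != w) : 0 < eta -> eta <= 1 ->
  cint cnt2 (fun p => (expR (- (2 * beta * eta * normc (lat p) ^+ 2)))%:C * theta (eta%:C * lat p) / (lat p - w)) =
  - (theta ((1 - eta)%:C * w) * lagr0 t y w).
Proof.
move=> e0 e1; rewrite -(theta_lagrange wL); last by rewrite subr_ge0 e1 gtrBl.
rewrite -cintN.
  by apply: eq_cint => p; rewrite wt_theta mulNr opprK.
have [d d0 hd] := lat_dist y0 wL.
apply: (@cintg_wt_div R t y y0 w wL 0 (beta * (1 - eta) ^+ 2) (theta_bound y)).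
  have : (1 - eta) ^+ 2 < 1 by rewrite exprn_ilt1 // ?subr_ge0 // gtrBl.
  by move=> h; rewrite -[ltRHS]mulr1 ltr_pM2l.
move=> p; rewrite mul0r add0r; apply: le_trans (normc_theta_le t y0 _) _.
rewrite normcM normcR exprMn real_normK ?num_real //.
by rewrite mulrA.
Qed.

End ThetaLagrange.

(** * A lower bound for theta times the Lagrange series, uniform in the point *)

Section ThetaLower.
Context (R : realType) (t y : R) (y0 : 0 < y).
Local Notation cnt2 := (@zcount R \x @zcount R)%E.
Local Notation lat := (lat t y).
Local Notation beta := (beta y).
Local Notation theta := (theta t y).
Local Notation slope := (theta_slope t y).
Local Notation g a := (expR (a * (1 + y ^+ 2)) * (2 * pi / (a * y))).

Lemma normc_cint_lgauss2_le (a b M N : R) (f : int * int -> R[i]) : 0 < a -> 0 < b -> 0 <= M -> 0 <= N ->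
  (forall p, normc (f p) <= M * expR (- (a * normc (lat p) ^+ 2)) + N * expR (- (b * normc (lat p) ^+ 2))) ->
  normc (cint cnt2 f) <= M * g a + N * g b.
Proof.
move=> a0 b0 M0 N0 fM.
pose f1 p := (M * expR (- (a * normc (lat p) ^+ 2)))%:C : R[i].
pose f2 p := (N * expR (- (b * normc (lat p) ^+ 2)))%:C : R[i].
have n1 p : normc (f1 p) = M * expR (- (a * normc (lat p) ^+ 2)).
  by rewrite normcR (ger0_norm (mulr_ge0 M0 (expR_ge0 _))).
have n2 p : normc (f2 p) = N * expR (- (b * normc (lat p) ^+ 2)).
  by rewrite normcR (ger0_norm (mulr_ge0 N0 (expR_ge0 _))).
have I1 : cintg cnt2 f1 by apply: (cintg_lgauss y0 a0 (M := M)) => p; rewrite n1.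
have I2 : cintg cnt2 f2 by apply: (cintg_lgauss y0 b0 (M := N)) => p; rewrite n2.
have If : cintg cnt2 f.
  have I12 := integrableD measurableT I1.1 I2.1.
  apply: (cintg_le _ I12) => [|p]; first exact: cmeas_int2.
  exact: fM.
have B1 : normc (cint cnt2 f1) <= M * g a by apply: normc_cint_lgauss_le => // p; rewrite n1.
have B2 : normc (cint cnt2 f2) <= N * g b by apply: normc_cint_lgauss_le => // p; rewrite n2.
apply: le_trans (normc_cint If) _.
apply: le_trans (_ : \int[cnt2]_p (Re (f1 p) + Re (f2 p)) <= _).
  apply: le_Rintegral => //.
  - exact: (cintg_norm If).
  - exact: (integrableD measurableT I1.1 I2.1).
rewrite (RintegralD (mu := cnt2) measurableT I1.1 I2.1).
apply: lerD.
  by apply: le_trans _ B1; exact: (le_trans (ler_norm _) (normr_Re (cint cnt2 f1))).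
by apply: le_trans _ B2; exact: (le_trans (ler_norm _) (normr_Re (cint cnt2 f2))).
Qed.

Let b0 : 0 < beta. Proof. exact: beta_gt0. Qed.
Let s : R := 1 + t ^+ 2 + y ^+ 2.
Let s0 : 0 < s.
Proof. by rewrite ltr_wpDr ?sqr_ge0 // ltr_wpDr ?sqr_ge0. Qed.

(** The bound of [lgauss_ge] at a = 2 beta eta, multiplied by eta and by |theta'(0)|: the factor 1/a
    cancels eta, and the exponential is smallest at eta = 1. *)
Definition theta_lower : R := normc slope * (expR (- (16 * beta * s)) * (pi / (8 * beta * s))).

Lemma slope_sum_ge (eta : R) : 0 < eta -> eta <= 1 ->
  theta_lower <= normc (cint cnt2 (fun p => (expR (- (2 * beta * eta * normc (lat p) ^+ 2)))%:C * (slope * eta%:C))).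
Proof.
move=> e0 e1; have a0 : 0 < 2 * beta * eta := mulr_gt0 (mulr_gt0 (ltr0Sn _ 1) b0) e0.
pose X p := (expR (- (2 * beta * eta * normc (lat p) ^+ 2))) : R.
have IX : cintg cnt2 (fun p => (X p)%:C).
  apply: (cintg_lgauss y0 a0 (M := 1)) => p; by rewrite mul1r normcR (ger0_norm (expR_ge0 _)).
rewrite (cintZr _ IX) normcM mulrC (normcM slope) normcR (gtr0_norm e0) -mulrA /theta_lower.
apply: ler_wpM2l; first exact: normc_ge0.
apply: le_trans (_ : eta * \int[cnt2]_p X p <= _); last first.
  apply: ler_wpM2l; first exact: ltW.
  have RE : \int[cnt2]_p X p = Re (cint cnt2 (fun p => (X p)%:C)) by [].
  by rewrite RE; apply: le_trans (ler_norm _) _; exact: normr_Re.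
have low : expR (- (8 * (2 * beta * eta) * s)) * (pi / (4 * (2 * beta * eta) * s)) <= \int[cnt2]_p X p.
  have L := lgauss_ge t y a0; rewrite -lee_fin.
  have -> : (\int[cnt2]_p X p)%:E = (\int[cnt2]_p (X p)%:E)%E.
    by rewrite fineK //; exact: (integrable_fin_num measurableT IX.1).
  exact: L.
apply: le_trans (ler_wpM2l (ltW e0) low).
have -> : eta * (expR (- (8 * (2 * beta * eta) * s)) * (pi / (4 * (2 * beta * eta) * s))) =
    expR (- (8 * (2 * beta * eta) * s)) * (pi / (8 * beta * s)).
  rewrite mulrCA; congr (_ * _); move: (pi : R) (beta) b0 (s) s0 => p b b_gt r r_gt; field.
  by rewrite (gt_eqF b_gt) (gt_eqF e0) (gt_eqF r_gt).
apply: ler_wpM2r; first by rewrite divr_ge0 ?pi_ge0 // mulr_ge0 ?(ltW s0) // mulr_ge0 // ltW.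
rewrite ler_expR lerN2.
have -> : 8 * (2 * beta * eta) * s = 16 * beta * s * eta by ring.
by rewrite ler_piMr // mulr_ge0 ?(ltW s0) // mulr_ge0 // ltW.
Qed.

(** Either 1 + r >= 1/d, or d r < 1 and the second term is at least 1. This replaces the slow decay
    of 1 / (1 + r) by a small constant and a Gaussian. *)
Lemma inv1D_le (d r : R) : 0 < d -> 0 <= r -> (1 + r)^-1 <= d + expR 1 * expR (- (d ^+ 2 * r ^+ 2)).
Proof.
move=> d0 r0; have r1 : 0 < 1 + r by rewrite ltr_pwDl.
have [h|h] := leP 1 (d * (1 + r)).
  rewrite ler_wpDr ?mulr_ge0 ?expR_ge0 //.
  by rewrite -[leLHS]mul1r ler_pdivrMr.
rewrite ler_wpDl ?(ltW d0) // -expRD.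
have dr : d * r < 1 by nra.
apply: le_trans (_ : 1 <= _); first by rewrite invf_le1 // lerDl.
rewrite -[leLHS]expR0 ler_expR subr_ge0 -exprMn expr_le1 ?(ltW dr) //.
by rewrite mulr_ge0 // ltW.
Qed.

(** From l / (l - w) = 1 + w / (l - w): theta(eta l) / (l - w) is theta'(0) eta, plus the Taylor
    remainder over l - w, plus theta'(0) eta w / (l - w). Summed against the Gaussian, the last two
    vanish with d. *)
Lemma theta_lower_approx (w : R[i]) (wL : forall p, lat p != w) :
  exists D Cst : R, [/\ 0 < D, D <= 1 & forall d, 0 < d -> d <= D ->
    theta_lower <= normc (theta ((1 - d ^+ 4)%:C * w) * lagr0 t y w) + Cst * d].
Proof.
have [C C0 HC] := theta_taylor t y0.
have [q q0 hq] := lat_dist y0 wL.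
have nw := normc_ge0 w; have nsl := normc_ge0 slope.
(* With |l - w| >= q these bound |l| / |l - w| and (1 + |l|) / |l - w|. *)
pose c1 := 1 + normc w / q; pose c2 := 1 + (1 + normc w) / q.
have mu_le p : normc (lat p) <= normc (lat p - w) + normc w.
  by apply: le_trans (normcD _ _); rewrite subrK.
have n_gt0 p : 0 < normc (lat p - w) by exact: lt_le_trans q0 (hq p).
have h1 p : 1 <= normc (lat p - w) / q by rewrite ler_pdivlMr // mul1r.
have hc1 p : normc (lat p) / normc (lat p - w) <= c1.
  rewrite ler_pdivrMr // /c1; apply: le_trans (mu_le p) _; rewrite mulrDl mul1r lerD2l.
  by rewrite -mulrA [q^-1 * _]mulrC ler_peMr.
have hc2 p : (normc (lat p - w))^-1 <= c2 * (1 + normc (lat p))^-1.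
  rewrite ler_pdivlMr; last by rewrite ltr_pwDl // normc_ge0.
  rewrite mulrC ler_pdivrMr // /c2; have := mu_le p; have := h1 p.
  rewrite mulrDl mul1r -mulrA [q^-1 * _]mulrC; set k := _ / q; set n := normc (lat p - w).
  move=> ? ?; nra.
have c10 : 0 <= c1 by rewrite addr_ge0 // divr_ge0 // ltW.
have c20 : 0 <= c2 by rewrite addr_ge0 // divr_ge0 ?(ltW q0) // addr_ge0.
(* A majorizes every Gaussian exponent used below, so the bound of [lgauss_le] becomes a constant
   times 1/a. *)
pose A := 2 * beta + 1; pose G := expR (A * (1 + y ^+ 2)) * (2 * pi / y).
have G0 : 0 <= G by rewrite mulr_ge0 ?expR_ge0 // divr_ge0 ?(ltW y0) // mulr_ge0 // pi_ge0.
have gle a : 0 < a -> a <= A -> g a <= G / a.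
  move=> a0 aA; have -> : 2 * pi / (a * y) = 2 * pi / y / a by rewrite invfM mulrA mulrAC.
  rewrite [leLHS]mulrA; apply: ler_wpM2r; first by rewrite invr_ge0 ltW.
  apply: ler_wpM2r; first by rewrite divr_ge0 ?(ltW y0) // mulr_ge0 // pi_ge0.
  by rewrite ler_expR; apply: ler_wpM2r => //; rewrite addr_ge0 // sqr_ge0.
pose K2 := C * c1 * (1 + beta^-1); pose K3 := normc slope * normc w * c2.
have K20 : 0 <= K2.
  by apply: mulr_ge0 (mulr_ge0 (ltW C0) c10) _; rewrite addr_ge0 // invr_ge0 ltW.
have K30 : 0 <= K3 := mulr_ge0 (mulr_ge0 nsl nw) c20.
(* d <= beta / C makes the exponential of the Taylor remainder at most exp(beta eta |l|^2), half of
   the available decay. *)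
exists (Num.min 1 (beta / C)), (K2 * G * (2 / beta) + K3 * G * ((2 * beta)^-1 + expR 1)); split.
- by rewrite lt_min ltr01 divr_gt0.
- by rewrite ge_min lexx.
move=> d d0 dD.
have d1 : d <= 1 by apply: le_trans dD _; rewrite ge_min lexx.
have dC : C * d <= beta by rewrite mulrC -ler_pdivlMr //; apply: le_trans dD _; rewrite ge_min lexx orbT.
(* With this power the remainder [G2] sums to O(d^2) and the correction [G3] to O(d), the latter by
   [inv1D_le]. *)
pose eta := d ^+ 4.
have e0 : 0 < eta by exact: exprn_gt0.
have ed : eta <= d by rewrite /eta exprS ler_piMr ?(ltW d0) // exprn_ile1 // ltW.
have e1 : eta <= 1 := le_trans ed d1.
have d2d : d ^+ 2 <= d by rewrite expr2 ler_piMr // ltW.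
pose X p := (expR (- (2 * beta * eta * normc (lat p) ^+ 2))) : R.
have X0 p : 0 <= X p := expR_ge0 _.
pose G1 p := (X p)%:C * theta (eta%:C * lat p) / (lat p - w).
pose G2 p := (X p)%:C * (theta (eta%:C * lat p) - slope * (eta%:C * lat p)) / (lat p - w).
pose G3 p := (X p)%:C * (slope * (eta%:C * w)) / (lat p - w).
have E p : (X p)%:C * (slope * eta%:C) = G1 p - G2 p - G3 p.
  have nz : lat p - w != 0 by rewrite -normc_gt0.
  rewrite /G1 /G2 /G3 -!mulrBl; apply: (mulIf nz); rewrite mulfVK //; ring.
have a1 : 0 < 2 * beta * eta := mulr_gt0 (mulr_gt0 (ltr0Sn _ 1) b0) e0.
have a2 : 0 < beta / 2 * eta := mulr_gt0 (divr_gt0 b0 (ltr0Sn _ 1)) e0.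
have a3 : 0 < d ^+ 2 by exact: exprn_gt0.
have B2 p : normc (G2 p) <= K2 * d ^+ 6 * expR (- (beta / 2 * eta * normc (lat p) ^+ 2)).
  rewrite /G2 normcM normcV (normcM (X p)%:C) normcR (ger0_norm (X0 p)).
  set r := normc (lat p); set n := normc (lat p - w).
  have r0 : 0 <= r := normc_ge0 _.
  have := HC (eta%:C * lat p); rewrite (normcM eta%:C) normcR (gtr0_norm e0) -/r => Ht.
  have eC : expR (C * (eta * r) ^+ 2) <= expR (beta * eta * r ^+ 2).
    rewrite ler_expR exprMn (_ : C * (eta ^+ 2 * r ^+ 2) = C * eta * (eta * r ^+ 2)); last by ring.
    rewrite -[leRHS]mulrA; apply: ler_wpM2r; first exact: mulr_ge0 (ltW e0) (sqr_ge0 _).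
    by apply: le_trans dC; rewrite ler_pM2l.
  have XE : X p = expR (- (beta * eta * r ^+ 2)) * expR (- (beta * eta * r ^+ 2)).
    by rewrite /X -expRD -/r; congr expR; ring.
  have EE : expR (- (beta * eta * r ^+ 2)) * expR (beta * eta * r ^+ 2) = 1.
    by rewrite -expRD addNr expR0.
  (* One factor sqrt(eta) |l| = d^2 |l| is absorbed by the Gaussian; the other |l| in (eta |l|)^2
     goes with 1 / |l - w|. *)
  have gs := absr_gauss_le (d ^+ 2 * r) b0.
  have d2r : 0 <= d ^+ 2 * r := mulr_ge0 (sqr_ge0 _) r0.
  rewrite (ger0_norm d2r) exprMn in gs.
  have d4 : (d ^+ 2) ^+ 2 = eta by rewrite -exprM.
  rewrite d4 [beta * _]mulrA [beta / 2 * _]mulrA in gs.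
  apply: le_trans (_ : X p * (C * (eta * r) ^+ 2 * expR (beta * eta * r ^+ 2)) / n <= _).
    apply: ler_wpM2r; first by rewrite invr_ge0 normc_ge0.
    apply: ler_wpM2l => //; apply: le_trans Ht _; apply: ler_wpM2l => //.
    exact: mulr_ge0 (ltW C0) (sqr_ge0 _).
  have -> : X p * (C * (eta * r) ^+ 2 * expR (beta * eta * r ^+ 2)) / n =
      C * (r / n) * (d ^+ 6 * (d ^+ 2 * r * expR (- (beta * eta * r ^+ 2)))) *
      (expR (- (beta * eta * r ^+ 2)) * expR (beta * eta * r ^+ 2)).
    by rewrite XE /eta; ring.
  rewrite EE mulr1.
  have -> : K2 * d ^+ 6 * expR (- (beta / 2 * eta * r ^+ 2)) =
     C * c1 * (d ^+ 6 * ((1 + beta^-1) * expR (- (beta / 2 * eta * r ^+ 2)))).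
    by rewrite /K2; ring.
  have d6 : 0 <= d ^+ 6 by rewrite exprn_ge0 // ltW.
  apply: ler_pM.
  - by apply: mulr_ge0; [exact: ltW|rewrite divr_ge0 ?normc_ge0].
  - exact: mulr_ge0 d6 (mulr_ge0 d2r (expR_ge0 _)).
  - by apply: ler_wpM2l; [exact: ltW|exact: hc1].
  - by apply: (ler_wpM2l d6); exact: gs.
have B3 p : normc (G3 p) <= K3 * eta * d * expR (- (2 * beta * eta * normc (lat p) ^+ 2)) +
    K3 * eta * expR 1 * expR (- (d ^+ 2 * normc (lat p) ^+ 2)).
  rewrite /G3 normcM normcV (normcM (X p)%:C) normcR (ger0_norm (X0 p)).
  rewrite (normcM slope) (normcM eta%:C) normcR (gtr0_norm e0).
  have r0 : 0 <= normc (lat p) := normc_ge0 _.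
  have i1 := inv1D_le d0 r0; have i2 := hc2 p.
  have X1 : X p <= 1 by rewrite /X -[leRHS]expR0 ler_expR oppr_le0 (mulr_ge0 (ltW a1) (sqr_ge0 _)).
  rewrite -/(X p); set E2 := expR (- (d ^+ 2 * _)) in i1 *.
  apply: le_trans (_ : X p * (normc slope * (eta * normc w)) * (c2 * (d + expR 1 * E2)) <= _).
    apply: ler_wpM2l.
      exact: mulr_ge0 (X0 p) (mulr_ge0 nsl (mulr_ge0 (ltW e0) nw)).
    by apply: le_trans i2 _; apply: ler_wpM2l.
  have -> : X p * (normc slope * (eta * normc w)) * (c2 * (d + expR 1 * E2)) =
     K3 * eta * d * X p + K3 * eta * expR 1 * E2 * X p by rewrite /K3; ring.
  rewrite lerD2l ler_piMr //.
  exact: (mulr_ge0 (mulr_ge0 (mulr_ge0 K30 (ltW e0)) (expR_ge0 _)) (expR_ge0 _)).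
have IX : cintg cnt2 (fun p => (X p)%:C * (slope * eta%:C)).
  apply: (@cintg_lgauss R t y y0 _ (normc (slope * eta%:C)) _ a1) => p.
  by rewrite [leLHS]normcM [leLHS]mulrC normcR (ger0_norm (X0 p)).
have I2 : cintg cnt2 G2 := cintg_lgauss y0 a2 B2.
have M1 : 0 <= K3 * eta * d := mulr_ge0 (mulr_ge0 K30 (ltW e0)) (ltW d0).
have M2 : 0 <= K3 * eta * expR 1 := mulr_ge0 (mulr_ge0 K30 (ltW e0)) (expR_ge0 _).
have I3 : cintg cnt2 G3.
  pose N p := K3 * eta * d * expR (- (2 * beta * eta * normc (lat p) ^+ 2)) + K3 * eta * expR 1 * expR (- (d ^+ 2 * normc (lat p) ^+ 2)).
  have IN : cnt2.-integrable setT (fun p => (N p)%:E).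
    exact: (integrableD measurableT (integrableZl measurableT _ (integrable_lgauss0 t y0 a1)) (integrableZl measurableT _ (integrable_lgauss0 t y0 a3))).
  by apply: (cintg_le _ IN B3); exact: cmeas_int2.
have I1 : cintg cnt2 G1.
  have := cintgD (cintgD IX I2) I3; congr cintg; apply/funext => p.
  by rewrite E; ring.
have eq : cint cnt2 (fun p => (X p)%:C * (slope * eta%:C)) = cint cnt2 G1 - cint cnt2 G2 - cint cnt2 G3.
  by rewrite (eq_cint cnt2 E) (cintB (cintgB I1 I2) I3) (cintB I1 I2).
apply: le_trans (slope_sum_ge e0 e1) _; rewrite eq.
have n1 : normc (cint cnt2 G1) = normc (theta ((1 - d ^+ 4)%:C * w) * lagr0 t y w).
  by rewrite (theta_lagrange_eta y0 wL e0 e1) normcN.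
have n2 : normc (cint cnt2 G2) <= K2 * G * (2 / beta) * d.
  apply: le_trans (normc_cint_lgauss_le y0 a2 B2) _.
  have aA : beta / 2 * eta <= A.
    apply: le_trans (_ : beta * 1 <= _); last by rewrite /A; have := b0; lra.
    apply: ler_pM => //; [by rewrite divr_ge0 // ltW|by rewrite ltW|have := b0; lra].
  apply: le_trans (ler_wpM2l (mulr_ge0 K20 (exprn_ge0 6 (ltW d0))) (gle _ a2 aA)) _.
  have -> : K2 * d ^+ 6 * (G / (beta / 2 * eta)) = K2 * G * (2 / beta) * d ^+ 2.
    rewrite /eta; move: (beta) b0 => b b_gt; field; by rewrite (gt_eqF d0) (gt_eqF b_gt).
  apply: ler_wpM2l => //; apply: mulr_ge0 (mulr_ge0 K20 G0) _; by rewrite divr_ge0 // ltW.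
have n3 : normc (cint cnt2 G3) <= K3 * G * ((2 * beta)^-1 + expR 1) * d.
  apply: le_trans (normc_cint_lgauss2_le a1 a3 M1 M2 B3) _.
  have aA : 2 * beta * eta <= A.
    apply: le_trans (_ : 2 * beta * 1 <= _); last by rewrite /A mulr1 lerDl.
    by apply: ler_wpM2l => //; rewrite mulr_ge0 // ltW.
  have aA' : d ^+ 2 <= A.
    by apply: le_trans d2d (le_trans d1 _); rewrite /A lerDr mulr_ge0 // ltW.
  apply: le_trans (lerD (ler_wpM2l M1 (gle _ a1 aA)) (ler_wpM2l M2 (gle _ a3 aA'))) _.
  have -> : K3 * eta * d * (G / (2 * beta * eta)) + K3 * eta * expR 1 * (G / d ^+ 2) =
     K3 * G * ((2 * beta)^-1 * d + expR 1 * d ^+ 2).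
    rewrite /eta; move: (beta) (expR 1) b0 => b e b_gt; field; by rewrite (gt_eqF d0) (gt_eqF b_gt).
  rewrite -[leRHS]mulrA; apply: ler_wpM2l; first exact: mulr_ge0.
  by rewrite [leRHS]mulrDl lerD2l; apply: ler_wpM2l => //; exact: expR_ge0.
apply: le_trans (_ : normc (cint cnt2 G1) + normc (cint cnt2 G2) + normc (cint cnt2 G3) <= _).
  apply: le_trans (normcD _ _) _; rewrite normcN lerD2r.
  by apply: le_trans (normcD _ _) _; rewrite normcN.
rewrite n1 -addrA lerD2l [leRHS]mulrDl; exact: lerD.
Qed.

(** The constant [Cst] depends on w through its modulus and its distance to the lattice; as d tends
    to 0 it disappears, and the bound left is the same for all w. *)
Lemma theta_lagr0_ge (w : R[i]) (wL : forall p, lat p != w) :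
  theta_lower <= normc (theta w * lagr0 t y w).
Proof.
have [D [Cst [D0 D1 H]]] := theta_lower_approx wL.
pose d (n : nat) := D * n.+1%:R^-1.
have d0 n : 0 < d n by rewrite mulr_gt0 // invr_gt0 ltr0n.
have dD n : d n <= D by rewrite ler_piMr ?(ltW D0) // invf_le1 ?ltr0n // ler1n.
have dc : d n @[n --> \oo] --> (0 : R).
  by rewrite -(mulr0 D); apply: cvgM; [exact: cvg_cst|exact: cvg_invS].
have dc4 : 1 - d n ^+ 4 @[n --> \oo] --> (1 : R).
  rewrite -[X in _ --> X](subr0 1); apply: cvgB; first exact: cvg_cst.
  rewrite (_ : (fun n => d n ^+ 4) = (fun n => (d n * d n) * (d n * d n))); last by apply/funext => n; ring.
  by have := cvgM (cvgM dc dc) (cvgM dc dc); rewrite !mulr0; exact.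
have uc : ccvg (fun n => (1 - d n ^+ 4)%:C * w) w.
  rewrite -[X in ccvg _ X]mul1r; apply: ccvgM; last exact: ccvg_cst.
  exact: (ccvgR dc4).
have ul n : normc ((1 - d n ^+ 4)%:C * w) <= normc w.
  have e0 : 0 <= d n ^+ 4 by rewrite exprn_ge0 // ltW.
  have e1 : d n ^+ 4 <= 1 by rewrite exprn_ile1 ?(ltW (d0 n)) // (le_trans (dD n)).
  by rewrite normcM normcR ger0_norm ?subr_ge0 // ler_piMl ?normc_ge0 // gerBl.
have tc := ccvgM (theta_cvg t y0 uc ul) (ccvg_cst (lagr0 t y w)).
have L : normc (theta ((1 - d n ^+ 4)%:C * w) * lagr0 t y w - theta w * lagr0 t y w) + Cst * d n @[n --> \oo] --> (0 + Cst * 0 : R).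
  by apply: cvgD; [exact: tc|apply: cvgM => //; exact: cvg_cst].
rewrite mulr0 addr0 in L.
rewrite -subr_le0; apply: (ler_cvg_to (cvg_cst _) L); apply: nearW => n /=.
rewrite lerBlDr; apply: le_trans (H _ (d0 n) (dD n)) _.
rewrite [leRHS]addrAC lerD2r.
have := normcD (theta ((1 - d n ^+ 4)%:C * w) * lagr0 t y w - theta w * lagr0 t y w) (theta w * lagr0 t y w).
by rewrite subrK.
Qed.

End ThetaLower.

(** * Non-vanishing of theta'(0) *)

Section ThetaSlope.
Context (R : realType) (t y : R) (y2 : 2^-1 <= y).
Local Notation cnt := (@zcount R).
Local Notation theta_term := (theta_term t y).
Local Notation half := (@half R).

Let y0 : 0 < y. Proof. by apply: lt_le_trans y2; rewrite invr_gt0. Qed.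

(** The ratio of a geometric majorant: 2 n + 1 <= 3^n, and y n (n + 1) >= n because y >= 1/2. *)
Let rho : R := 3 * expR (- pi).

(** It suffices that e^pi > 6, which follows from pi >= 2 and e^2 >= (9/8)^16. *)
Let rho_lt : rho < 2^-1.
Proof.
have h : 6 < expR (pi : R).
  apply: lt_le_trans (_ : expR 2 <= _); last by rewrite ler_expR pi_ge2.
  have -> : expR 2 = expR (8^-1) ^+ 16 :> R by rewrite -expRM_natl; congr expR; field.
  have h1 : 1 + 8^-1 <= expR (8^-1) :> R := expR_ge1Dx _.
  apply: lt_le_trans (_ : (1 + 8^-1) ^+ 16 <= _); last by apply: lerXn2r => //; rewrite nnegrE ?expR_ge0 // addr_ge0 // invr_ge0.
  have -> : (1 + 8^-1) ^+ 16 = ((((1 + 8^-1) ^+ 2) ^+ 2) ^+ 2) ^+ 2 :> R by rewrite -!exprM.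
  have a1 : 81 / 64 <= (1 + 8^-1) ^+ 2 :> R by lra.
  have a2 : 8 / 5 <= ((1 + 8^-1) ^+ 2) ^+ 2 :> R by nra.
  have a3 : 64 / 25 <= (((1 + 8^-1) ^+ 2) ^+ 2) ^+ 2 :> R by nra.
  nra.
rewrite /rho expRN ltr_pdivrMr ?expR_gt0 //; lra.
Qed.

(** The terms of [theta_slope] divided by 2 pi i e^(i pi tau / 4), using half(n)^2 = n (n + 1) +
    1/4. *)
Let a (n : int) : R[i] := (half n)%:C * cexp ((0 +i* pi) * ((n%:~R : R)%:C + (t +i* y) * (n%:~R * (n%:~R + 1) : R)%:C)).

Let v (n : int) : R := `|half n| * expR (- (pi * y * (n%:~R * (n%:~R + 1)))).

Let normc_a n : normc (a n) = v n.
Proof.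
rewrite /a normcM normcR normc_cexp /v; congr (_ * expR _); rewrite !ReImE /=; ring.
Qed.

Let v_le (n : nat) : v (Posz n) <= 2^-1 * rho ^+ n.
Proof.
rewrite /v /half ger0_norm; last by rewrite addr_ge0 ?invr_ge0 // ler0z.
rewrite /rho exprMn -expRM_natl [leRHS]mulrA -pmulrn; apply: ler_pM; rewrite ?expR_ge0 ?addr_ge0 ?invr_ge0 ?ler0n //.
  have h : (2 * n + 1 <= 3 ^ n)%N.
    elim: n => // n IH; rewrite expnS; move: IH; set k := (3 ^ n)%N => IH; lia.
  have : (2 * n + 1)%:R <= (3 ^ n)%:R :> R by rewrite ler_nat.
  rewrite natrD natrM natrX; lra.
rewrite ler_expR mulrN lerN2.
have pi0 := pi_gt0 R.
have n0 : 0 <= n%:R :> R by rewrite ler0n.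
have nn : n%:R <= n%:R ^+ 2 :> R by rewrite -natrX ler_nat; case: n {n0} => // n; rewrite leq_pmulr.
have e : n%:R <= y * (n%:R * (n%:R + 1)).
  have y1 : 0 <= y - 2^-1 by rewrite subr_ge0.
  have := mulr_ge0 y1 (mulr_ge0 n0 (addr_ge0 n0 ler01)); nra.
by rewrite -mulrA [leLHS]mulrC ler_wpM2l // ltW.
Qed.

Let v_neg (n : nat) : v (Negz n) = v (Posz n).
Proof.
rewrite /v /half NegzE mulrNz -!pmulrn -natr1; congr (_ * expR _); last by ring.
by rewrite -normrN; congr `|_|; field.
Qed.

Let rho0 : 0 <= rho. Proof. by rewrite mulr_ge0 // expR_ge0. Qed.

Let a0E : a 0 = (2^-1)%:C.
Proof.
rewrite /a -[RHS]mulr1 -cexp0; congr (_%:C * cexp _); first by rewrite /half mulr0z add0r.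
by rewrite mulr0z mul0r; apply: complexP; rewrite !ReImE /=; ring.
Qed.

Let am1E : a (- 1) = (2^-1)%:C.
Proof.
transitivity ((- 2^-1)%:C * cexp (- (0 +i* pi)) : R[i]); last first.
  by rewrite cexpN cexp_pi invrN invr1 mulrN1 -rmorphN opprK.
rewrite /a mulrNz mulr1z addNr mulr0; congr (_%:C * cexp _).
  by rewrite /half mulrNz mulr1z; field.
by apply: complexP; rewrite !ReImE /=; ring.
Qed.

Let sum_v : (\int[cnt]_n (v n)%:E <= (1 - rho)^-1%:E)%E.
Proof.
have v0 n : (0 <= (v n)%:E)%E by rewrite lee_fin mulr_ge0 // expR_ge0.
have r1 : 0 < 1 - rho by rewrite subr_gt0; apply: lt_trans rho_lt _; rewrite invf_lt1 // ltr1n.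
have part : (\esum_(n in [set: nat]) (v (Posz n))%:E <= (2^-1 * (1 - rho)^-1)%:E)%E.
  rewrite -nneseries_esumT //; apply: lime_le; first exact: is_cvg_nneseries.
  apply: nearW => n; rewrite sumEFin lee_fin.
  apply: le_trans (_ : \sum_(0 <= k < n) 2^-1 * rho ^+ k <= _).
    by apply: ler_sum => k _; exact: v_le.
  rewrite -mulr_sumr ler_pM2l ?invr_gt0 // -[leRHS]mul1r ler_pdivlMr //.
  rewrite mulr_suml.
  have -> : \sum_(0 <= k < n) rho ^+ k * (1 - rho) = 1 - rho ^+ n.
    elim: n => [|n IH]; first by rewrite big_geq // expr0 subrr.
    by rewrite big_nat_recr //= IH exprSr; ring.
  by rewrite gerBl exprn_ge0.
rewrite integral_cnt_esum // (esumID [set n | 0 <= n]) // !setTI.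
have -> : [set n : int | 0 <= n] = Posz @` [set: nat].
  by apply/seteqP; split => [[n|n] //= _|_ [n _ <-] //]; exists n.
have -> : ~` (Posz @` [set: nat]) = Negz @` [set: nat].
  apply/seteqP; split => [[n|n] /= h|_ [n _ <-] [m _] //]; last by exists n.
  by exfalso; apply: h; exists n.
rewrite !esum_image; [|by move=> m n _ _ [] | by move=> m n _ _ []].
under [X in (_ + X <= _)%E]eq_esum do rewrite v_neg.
apply: le_trans (leeD part part) _; rewrite -EFinD lee_fin; lra.
Qed.

(** The terms at 0 and -1 are both 1/2. Since |a_n| + Re a_n is nonnegative and equals 1 at these
    two, 2 <= sum |a_n| + Re (sum a_n); but sum |a_n| <= 1 / (1 - rho) < 2, so the sum is not 0. *)
Lemma theta_slope_neq0 : theta_slope t y != 0.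
Proof.
have r1 : 0 < 1 - rho by rewrite subr_gt0; apply: lt_trans rho_lt _; rewrite invf_lt1 // ltr1n.
have Ia : cintg cnt a.
  apply: cintg_lty; first exact: cmeas_int.
  by under eq_integral do rewrite normc_a; exact: le_lt_trans sum_v (ltry _).
pose c : R[i] := (0 +i* (2 * pi)) * cexp ((0 +i* pi) * ((t +i* y) * (4^-1)%:C)).
have E n : (0 +i* (2 * pi * half n)) * theta_term n 0 = c * a n.
  rewrite /c /a /theta_term mulrACA -cexpD; congr (_ * cexp _).
    by apply: complexP; rewrite !ReImE /=; ring.
  by apply: complexP; rewrite !ReImE /= /half; move: (pi : R) => p; field.
rewrite /theta_slope (eq_cint cnt E) (cintZ c Ia) mulf_neq0 //.
  rewrite /c mulf_neq0 ?cexp_neq0 // -normc_gt0 /= expr0n add0r sqrtr_sqr normr_gt0.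
  by rewrite mulf_neq0 ?pnatr_eq0 // gt_eqF // pi_gt0.
have Iv : cnt.-integrable setT (fun n => (v n)%:E).
  by have := cintg_norm Ia; apply: eq_integrable => // n _; rewrite normc_a.
have Sv : \int[cnt]_n v n < 2.
  rewrite -lte_fin fineK; last exact: (integrable_fin_num measurableT Iv).
  apply: le_lt_trans sum_v _; rewrite lte_fin -[ltLHS]mul1r ltr_pdivrMr //.
  have := rho_lt; lra.
pose u (n : int) : R := (\1_[set 0] n : R) + (\1_[set - 1] n : R).
have i1 (k : int) : (\int[cnt]_n (\1_[set k] n : R)%:E = 1)%E.
  by rewrite integral_indic // setIT; exact: zcount_set1.
have I1 (k : int) : cnt.-integrable setT (fun n => (\1_[set k] n : R)%:E).
  apply/integrableP; split => //.
  by under eq_integral do rewrite /= ger0_norm ?indicE ?ler0n // -indicE; rewrite i1 ltry.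
have Iu := integrableD measurableT (I1 0) (I1 (- 1)).
have Su : \int[cnt]_n u n = 2.
  by rewrite (RintegralD (mu := cnt) measurableT (I1 0) (I1 (-1))) /Rintegral !i1.
have key n : u n <= v n + Re (a n).
  have le0 : 0 <= v n + Re (a n).
    by rewrite -lerBlDr sub0r -normc_a; apply: le_trans (normr_Re _); rewrite -normrN ler_norm.
  rewrite /u !indicE -normc_a.
  have [->|n0] := eqVneq n 0.
    by rewrite mem_set // memNset // a0E normcR ger0_norm ?invr_ge0 //=; lra.
  have [->|n1] := eqVneq n (- 1).
    by rewrite memNset // mem_set // am1E normcR ger0_norm ?invr_ge0 //=; lra.
  by rewrite normc_a !memNset ?add0r //; apply/eqP.
apply/eqP => a0.
have Ra : \int[cnt]_n Re (a n) = 0 by have := congr1 (@complex.Re R) a0.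
have : \int[cnt]_n u n <= \int[cnt]_n (v n + Re (a n)).
  apply: le_Rintegral => //; exact: (integrableD measurableT Iv Ia.1).
rewrite Su (RintegralD (mu := cnt) measurableT Iv Ia.1) Ra addr0 leNgt.
by rewrite Sv.
Qed.

End ThetaSlope.

Lemma normc_mul_contract (R : realType) (z : R[i]) (x : R) : 0 <= x -> x <= 1 ->
  normc (z * x%:C) ^+ 2 <= normc z ^+ 2.
Proof.
move=> x0 x1; apply: lerXn2r; rewrite ?nnegrE ?normc_ge0 //.
by rewrite normcM normcR (ger0_norm x0) ler_piMr ?normc_ge0.
Qed.

(** * Fourier inversion and Parseval for Gaussian mollifications *)

Section FourierTransform.
Context (R : realType).
Local Notation leb := (@lebesgue_measure R).
Local Notation e2pi := (@e2pi R).

Lemma cint_swap (u v : R -> R[i]) (k : R * R -> R[i]) : cintg leb u -> cintg leb v ->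
  cmeas k -> (forall z, normc (k z) <= 1) ->
  [/\ forall x, cintg leb (fun s => u x * v s * k (x, s)),
      cintg leb (fun x => cint leb (fun s => u x * v s * k (x, s))),
      cint leb (fun x => cint leb (fun s => u x * v s * k (x, s))) =
      cint leb (fun s => cint leb (fun x => u x * v s * k (x, s))) &
      cintg leb (fun s => cint leb (fun x => u x * v s * k (x, s)))].
Proof.
move=> Iu Iv mk k1; have mu := cintg_meas Iu; have mv := cintg_meas Iv.
have mu1 : cmeas (fun z : R * R => u z.1).
  by case: mu => m1 m2; split; [apply: (measurableT_comp m1)|apply: (measurableT_comp m2)].
have mv1 : cmeas (fun z : R * R => v z.2).
  by case: mv => m1 m2; split; [apply: (measurableT_comp m1)|apply: (measurableT_comp m2)].
have mf := cmeasM (cmeasM mu1 mv1) mk.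
have kx x : cmeas (fun s => k (x, s)).
  by case: mk => m1 m2; split; [apply: (measurableT_comp m1)|apply: (measurableT_comp m2)].
have ks s : cmeas (fun x => k (x, s)).
  by case: mk => m1 m2; split; [apply: (measurableT_comp m1)|apply: (measurableT_comp m2)].
have I1 x : cintg leb (fun s => u x * v s * k (x, s)).
  apply: (cintg_le _ (cintg_norm (cintgZ (u x) Iv))).
    exact: (cmeasM (cmeasM (cmeas_cst _ (u x)) mv) (kx x)).
  by move=> s; rewrite normcM ler_piMr // normc_ge0.
have I2 s : cintg leb (fun x => u x * v s * k (x, s)).
  apply: (cintg_le _ (cintg_norm (cintgZr (v s) Iu))).
    exact: (cmeasM (cmeasM mu (cmeas_cst _ (v s))) (ks s)).
  by move=> x; rewrite normcM ler_piMr // normc_ge0.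
have fin : (\int[leb]_x \int[leb]_s (normc (u x * v s * k (x, s)))%:E < +oo)%E.
  pose V := \int[leb]_s normc (v s).
  have VE : (\int[leb]_s (normc (v s))%:E)%E = V%:E.
    by rewrite /V fineK //; exact: (integrable_fin_num measurableT (cintg_norm Iv)).
  have mh : cmeas (fun z : R * R => u z.1 * v z.2 * k z) by exact: mf.
  have /integrableP[_] := integrableZl measurableT V (cintg_norm Iu); apply: le_lt_trans.
  apply: ge0_le_integral => //.
  - by move=> x _; apply: integral_ge0 => s _; rewrite lee_fin normc_ge0.
  - apply: (@measurable_fun_fubini_tonelli_F _ _ _ _ R leb (fun z => (normc (u z.1 * v z.2 * k z))%:E)) => //.
      exact: cmeas_normE.
    by move=> z; rewrite lee_fin normc_ge0.
  - apply: measurableT_comp => //; apply/measurable_EFinP; apply: measurable_funM => //; exact: cmeas_norm.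
  move=> x _; apply: (@le_trans _ _ (\int[leb]_s ((normc (u x))%:E * (normc (v s))%:E))%E).
    apply: ge0_le_integral => //.
    - by move=> s _; rewrite lee_fin normc_ge0.
    - exact: (cmeas_normE (cintg_meas (I1 x))).
    - by apply: emeasurable_funM => //; exact: (cmeas_normE mv).
    - by move=> s _; rewrite -EFinM lee_fin normcM normcM ler_piMr // mulr_ge0 // normc_ge0.
  rewrite ge0_integralZl ?lee_fin ?normc_ge0 //; last first.
  - by move=> s _; rewrite lee_fin normc_ge0.
  - exact: cmeas_normE.
  by rewrite VE -EFinM mulrC; apply: (le_trans _ (lee_abs _)).
have [_ a _ b c] := @cint_fubini _ _ _ _ R leb leb _ mf I1 I2 fin.
by split; [exact: I1|exact: a|exact: b|exact: c].
Qed.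

Definition ft (h : R -> R[i]) (xi : R) : R[i] := cint leb (fun t => h t * e2pi (- (xi * t))).

Lemma cmeas_kernel (c : R) : cmeas (fun z : R * R => e2pi (c * (z.1 * z.2))).
Proof. by apply: cmeas_cexp; split => /=; rmeas. Qed.

Context (h : R -> R[i]) (Ih : cintg leb h) (a : R) (a0 : 0 < a).

(* [psi] is the Gaussian density whose Fourier transform is [gam]. *)
Let psi (x : R) : R := Num.sqrt a * expR (- (pi * a * x ^+ 2)).
Let gam (xi : R) : R := expR (- (pi / a * xi ^+ 2)).
Definition mollify (v : R) : R[i] := cint leb (fun s => h s * (psi (v - s))%:C).

Let pi0 : 0 < (pi : R). Proof. exact: pi_gt0. Qed.
Let pa0 : 0 < pi * a. Proof. exact: mulr_gt0. Qed.
Let pa1 : 0 < pi / a. Proof. exact: divr_gt0. Qed.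

Let Igam : cintg leb (fun xi => (gam xi)%:C).
Proof.
apply: (cintg_le _ (integrable_gauss0 pa1)); first by apply: cmeas_real; exact: measurable_gauss0.
by move=> x; rewrite normcR (ger0_norm (expR_ge0 _)).
Qed.

Let psi_ft x : cint leb (fun xi => (gam xi)%:C * e2pi (x * xi)) = (psi x)%:C.
Proof.
have := cint_gauss_cexp (2 * pi * x) pa1.
have -> : (fun t => (expR (- (pi / a * t ^+ 2)))%:C * cexp (0 +i* (2 * pi * x * t))) = (fun xi => (gam xi)%:C * e2pi (x * xi)).
  by apply/funext => t; rewrite /e2pi mulrA.
move=> ->; rewrite /psi; congr ((_ * expR _)%:C).
  by rewrite invfM invrK mulrA divff ?mul1r // gt_eqF.
have pin : (pi : R) != 0 by rewrite gt_eqF.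
have an : a != 0 by rewrite gt_eqF.
by move: (pi : R) pin => p pn; field; rewrite an pn.
Qed.

Let gam_ft xi : cint leb (fun x => (psi x)%:C * e2pi (- (xi * x))) = (gam xi)%:C.
Proof.
have I := cintg_gauss_cexp (2 * pi * - xi) pa0.
have E := cint_gauss_cexp (2 * pi * - xi) pa0.
have F x : (psi x)%:C * e2pi (- (xi * x)) =
    (Num.sqrt a)%:C * ((expR (- (pi * a * x ^+ 2)))%:C * cexp (0 +i* (2 * pi * - xi * x))).
  have -> : e2pi (- (xi * x)) = cexp (0 +i* (2 * pi * - xi * x)).
    by rewrite /e2pi; congr (cexp (0 +i* _)); ring.
  by rewrite /psi rmorphM -[LHS]mulrA.
rewrite (eq_cint leb F) (cintZ _ I) E -rmorphM [X in X%:C = _]mulrA -sqrtrM ?(ltW a0) //.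
have pin : (pi : R) != 0 by rewrite gt_eqF.
have an : a != 0 by rewrite gt_eqF.
have -> : a * (pi / (pi * a)) = 1 by move: (pi : R) pin => p pn; field; rewrite an pn.
rewrite sqrtr1 mul1r /gam; congr ((expR (- _))%:C).
by move: (pi : R) pin => p pn; field; rewrite an pn.
Qed.

Let mpsi : measurable_fun setT psi.
Proof. by apply: measurable_funM => //; exact: measurable_gauss0. Qed.

Let Ipsi : cintg leb (fun x => (psi x)%:C).
Proof.
apply: (cintg_le _ (integrableZl measurableT (Num.sqrt a) (integrable_gauss0 pa0))).
  by apply: cmeas_real; exact: mpsi.
by move=> x; rewrite normcR ger0_norm // mulr_ge0 ?sqrtr_ge0 ?expR_ge0.
Qed.

Lemma cintg_ft_kernel xi : cintg leb (fun t => h t * e2pi (- (xi * t))).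
Proof.
apply: (cintg_le _ (cintg_norm Ih)).
  apply: cmeasM; first exact: (cintg_meas Ih).
  have := cmeas_e2pi (- xi); congr cmeas; by apply/funext => t; rewrite mulNr.
by move=> t; rewrite normcM normc_e2pi mulr1.
Qed.

Let Ik : cintg leb (fun xi => ft h xi * (gam xi)%:C).
Proof.
have [] := @cint_swap h (fun xi => (gam xi)%:C) (fun z => e2pi (- 1 * (z.1 * z.2))) Ih Igam (cmeas_kernel _).
  by move=> z; rewrite normc_e2pi.
move=> _ _ _; congr cintg; apply/funext => xi.
rewrite /ft -(cintZr _ (cintg_ft_kernel xi)); apply: eq_cint => t.
by rewrite /= mulrAC; congr (_ * e2pi _ * _); rewrite mulN1r mulrC.
Qed.

(** Write the Gaussian [psi] as the transform of [gam] and exchange the integrals; the factor [gam]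
    makes the frequency integral converge absolutely. *)
Lemma mollify_inversion v : mollify v = cint leb (fun xi => ft h xi * (gam xi)%:C * e2pi (v * xi)).
Proof.
have Igv : cintg leb (fun xi => (gam xi)%:C * e2pi (v * xi)).
  apply: (cintg_le _ (cintg_norm Igam)).
    by apply: cmeasM; [exact: (cintg_meas Igam)|exact: cmeas_e2pi].
  by move=> xi; rewrite normcM normc_e2pi mulr1.
have [] := @cint_swap h (fun xi => (gam xi)%:C * e2pi (v * xi)) (fun z => e2pi (- 1 * (z.1 * z.2))) Ih Igv (cmeas_kernel _).
  by move=> z; rewrite normc_e2pi.
move=> I1 _ sw _; transitivity (cint leb (fun x => cint leb (fun s => h x * ((gam s)%:C * e2pi (v * s)) * e2pi (- 1 * (x * s))))).
  apply: eq_cint => s; rewrite -psi_ft -cintZ.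
    apply: eq_cint => xi; rewrite mulrBl e2piD -mulN1r; ring.
  apply: (cintg_le _ (cintg_norm Igam)).
    by apply: cmeasM; [exact: (cintg_meas Igam)|exact: cmeas_e2pi].
  by move=> xi; rewrite normcM normc_e2pi mulr1.
rewrite [LHS]sw; apply: eq_cint => xi.
rewrite /ft -!mulrA -(cintZr _ (cintg_ft_kernel xi)); apply: eq_cint => t.
rewrite /= mulN1r [t * xi]mulrC; ring.
Qed.

(** The convolution theorem for h and [psi], with the integrability that later exchanges of
    integrals require. *)
Lemma cintg_mollify_kernel xi :
  [/\ forall v, cintg leb (fun t => h t * (psi (v - t))%:C * e2pi (- (xi * v))),
      cintg leb (fun v => mollify v * e2pi (- (xi * v))) &
      ft mollify xi = ft h xi * (gam xi)%:C].
Proof.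
have psi0 x : 0 <= psi x by rewrite mulr_ge0 ?sqrtr_ge0 ?expR_ge0.
have npsi x : normc ((psi x)%:C) = psi x by rewrite normcR ger0_norm.
have psile x : psi x <= Num.sqrt a.
  rewrite ler_piMr ?sqrtr_ge0 // -[leRHS]expR0 ler_expR oppr_le0.
  exact: mulr_ge0 (ltW pa0) (sqr_ge0 _).
have mh := cintg_meas Ih.
have mps v : cmeas (fun t : R => (psi (v - t))%:C).
  by apply: cmeas_real; apply: measurable_funM; [exact: measurable_cst|rmeas].
pose f (z : R * R) := h z.1 * (psi (z.2 - z.1))%:C * e2pi (- (xi * z.2)).
have mh1 : cmeas (fun z : R * R => h z.1).
  by case: mh => m1 m2; split; [apply: (measurableT_comp m1)|apply: (measurableT_comp m2)].
have mf : cmeas f.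
  apply: cmeasM; first apply: cmeasM => //; first apply: cmeas_real.
    by apply: measurable_funM => //; rmeas.
  by apply: cmeas_cexp; split => /=; rmeas.
have Is (t : R) : cintg leb (fun v => (psi (v - t))%:C * e2pi (- (xi * v))).
  apply: (cintg_le _ (cintg_norm (cint_shift (- t) Ipsi).1)).
    apply: cmeasM; first exact: (cintg_meas (cint_shift (- t) Ipsi).1).
    by apply: cmeas_cexp; split => /=; rmeas.
  by move=> v; rewrite normcM normc_e2pi mulr1.
have I1 t : cintg leb (fun v => f (t, v)).
  have := cintgZ (h t) (Is t); congr cintg; apply/funext => v; by rewrite /f /= mulrA.
have I2 v : cintg leb (fun t => f (t, v)).
  apply: (cintg_le _ (integrableZl measurableT (Num.sqrt a) (cintg_norm Ih))).
    apply: cmeasM; last exact: (cmeas_cst _ (e2pi (- (xi * v)))).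
    exact: (cmeasM mh (mps v)).
  move=> t; rewrite normcM normc_e2pi mulr1 normcM npsi [leLHS]mulrC.
  exact: (ler_wpM2r (normc_ge0 (h t)) (psile (v - t))).
have int_psi t : (\int[leb]_v (psi (v - t))%:E = 1)%E.
  rewrite /psi; under eq_integral do rewrite EFinM.
  rewrite ge0_integralZl ?lee_fin ?sqrtr_ge0 //; last first.
    by apply/measurable_EFinP; exact: measurable_gauss.
  rewrite integral_gauss // -EFinM -sqrtrM ?(ltW a0) //.
  have pin : (pi : R) != 0 by rewrite gt_eqF.
  have an : a != 0 by rewrite gt_eqF.
  have -> : a * (pi / (pi * a)) = 1 by move: (pi : R) pin => p pn; field; rewrite an pn.
  by rewrite sqrtr1.
have fin : (\int[leb]_t \int[leb]_v (normc (f (t, v)))%:E < +oo)%E.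
  have /integrableP[_] := cintg_norm Ih; apply: le_lt_trans; apply: ge0_le_integral => //.
  - by move=> t _; apply: integral_ge0 => v _; rewrite lee_fin normc_ge0.
  - apply: (@measurable_fun_fubini_tonelli_F _ _ _ _ R leb (fun z => (normc (f z))%:E)) => //.
      exact: cmeas_normE.
    by move=> z; rewrite lee_fin normc_ge0.
  - by apply: measurableT_comp => //; exact: cmeas_normE.
  move=> t _; have nf v : (normc (f (t, v)))%:E = ((normc (h t))%:E * (psi (v - t))%:E)%E.
    by rewrite /f normcM normc_e2pi mulr1 normcM npsi EFinM.
  under eq_integral do rewrite nf.
  rewrite ge0_integralZl ?lee_fin ?normc_ge0 //.
  - by rewrite int_psi mule1; exact: lee_abs.
  - by apply/measurable_EFinP; apply: measurable_funM => //; exact: measurable_gauss.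
  - by move=> v _; rewrite lee_fin.
have [_ _ _ sw I5] := @cint_fubini _ _ _ _ R leb leb f mf I1 I2 fin.
have Ik0 v : cintg leb (fun t => h t * (psi (v - t))%:C).
  apply: (cintg_le _ (integrableZl measurableT (Num.sqrt a) (cintg_norm Ih))).
    exact: (cmeasM mh (mps v)).
  move=> t; rewrite normcM npsi [leLHS]mulrC.
  exact: (ler_wpM2r (normc_ge0 (h t)) (psile (v - t))).
have E v : cint leb (fun t => f (t, v)) = mollify v * e2pi (- (xi * v)).
  by rewrite -(cintZr (e2pi (- (xi * v))) (Ik0 v)); apply: eq_cint => t.
have E' : (fun v => cint leb (fun t => f (t, v))) = (fun v => mollify v * e2pi (- (xi * v))).
  by apply/funext => v; exact: E.
split; [exact: I2|by rewrite -E'|].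
rewrite /ft -(eq_cint leb E) -[LHS]sw -(cintZr _ (cintg_ft_kernel xi)).
apply: eq_cint => t.
have S : cintg leb (fun v => (psi v)%:C * e2pi (- (xi * (v + t)))).
  apply: (cintg_le _ (cintg_norm Ipsi)).
    by apply: cmeasM; [exact: (cintg_meas Ipsi)|apply: cmeas_cexp; split => /=; rmeas].
  by move=> v; rewrite normcM normc_e2pi mulr1.
transitivity (h t * cint leb (fun v => (psi (v - t))%:C * e2pi (- (xi * v)))).
  by rewrite -(cintZ _ (Is t)); apply: eq_cint => v; rewrite /f /= mulrA.
rewrite -mulrA; congr (_ * _).
have Sg : cintg leb (fun x => (psi x)%:C * e2pi (- (xi * x))).
  apply: (cintg_le _ (cintg_norm Ipsi)).
    by apply: cmeasM; [exact: (cintg_meas Ipsi)|apply: cmeas_cexp; split => /=; rmeas].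
  by move=> v; rewrite normcM normc_e2pi mulr1.
rewrite -gam_ft -(cintZ _ Sg) -(cint_shift (- t) (f := fun v => e2pi (- (xi * t)) * ((psi v)%:C * e2pi (- (xi * v)))) (cintgZ _ Sg)).2.
apply: eq_cint => v; rewrite mulrCA -e2piD; congr (_ * e2pi _); ring.
Qed.

(** Its product with the positive function [gam] is integrable, hence measurable. *)
Lemma cmeas_ft : cmeas (ft h).
Proof.
have m1 := cintg_meas Ik.
have m2 : cmeas (fun xi : R => (expR (pi / a * xi ^+ 2))%:C).
  by apply: cmeas_real; rmeas.
have := cmeasM m1 m2; congr cmeas; apply/funext => xi.
by rewrite /gam -mulrA -rmorphM -expRD addNr expR0 mulr1.
Qed.

Lemma cmeas_mollify : cmeas mollify.
Proof.
have [_ I _] := cintg_mollify_kernel 0; have := cintg_meas I; congr cmeas; apply/funext => v.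
by rewrite mul0r oppr0 (_ : e2pi 0 = 1) ?mulr1 //; exact: e2pi0.
Qed.

(** Expanding one factor of |mollify h|^2 by [mollify_inversion] and exchanging integrals gives
    Parseval for the mollification; then [gam] is at most 1. *)
Lemma mollify_le : (\int[leb]_v (normc (mollify v) ^+ 2)%:E <= \int[leb]_xi (normc (ft h xi) ^+ 2)%:E)%E.
Proof.
have IA : cintg leb mollify.
  have [_ I _] := cintg_mollify_kernel 0; move: I; congr cintg; apply/funext => v.
  by rewrite mul0r oppr0 (_ : e2pi 0 = 1) ?mulr1 //; exact: e2pi0.
have [] := @cint_swap (fun v => conjc (mollify v)) (fun xi => ft h xi * (gam xi)%:C) (fun z => e2pi (1 * (z.1 * z.2))) (cintgJ IA) Ik (cmeas_kernel _).
  by move=> z; rewrite normc_e2pi.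
move=> J1 J2 sw J4.
have Iv v : cintg leb (fun s => ft h s * (gam s)%:C * e2pi (v * s)).
  apply: (cintg_le _ (cintg_norm Ik)).
    by apply: cmeasM; [exact: (cintg_meas Ik)|exact: cmeas_e2pi].
  by move=> s; rewrite normcM normc_e2pi mulr1.
have E1 v : cint leb (fun s => conjc (mollify v) * (ft h s * (gam s)%:C) * e2pi (1 * (v * s))) = (normc (mollify v) ^+ 2)%:C.
  transitivity (conjc (mollify v) * cint leb (fun xi => ft h xi * (gam xi)%:C * e2pi (v * xi))).
    by rewrite -(cintZ _ (Iv v)); apply: eq_cint => s; rewrite mul1r [RHS]mulrA.
  by rewrite -mollify_inversion mulrC mulcJ.
have E2 s : cint leb (fun v => conjc (mollify v) * (ft h s * (gam s)%:C) * e2pi (1 * (v * s))) = (normc (ft h s * (gam s)%:C) ^+ 2)%:C.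
  have [_ I3 e3] := cintg_mollify_kernel s.
  have cE : conjc (ft h s * (gam s)%:C) = cint leb (fun v => conjc (mollify v * e2pi (- (s * v)))).
    by rewrite -e3 /ft; exact: esym (cintJ I3).
  transitivity (ft h s * (gam s)%:C * conjc (ft h s * (gam s)%:C)); last exact: mulcJ.
  rewrite [X in _ = ft h s * (gam s)%:C * X]cE -(cintZ _ (cintgJ I3)); apply: eq_cint => v.
  have -> : e2pi (1 * (v * s)) = conjc (e2pi (- (s * v))) by rewrite -e2piN opprK mul1r mulrC.
  have aux (A Z B : R[i]) : conjc A * Z * conjc B = Z * conjc (A * B) by rewrite conjcM mulrCA mulrA.
  exact: aux.
have N1 : leb.-integrable setT (fun v => (normc (mollify v) ^+ 2)%:E).
  by have := J2; rewrite (funext E1) => -[j _]; exact: j.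
have N2 : leb.-integrable setT (fun s => (normc (ft h s * (gam s)%:C) ^+ 2)%:E).
  by have := J4; rewrite (funext E2) => -[j _]; exact: j.
have S : \int[leb]_v (normc (mollify v) ^+ 2) = \int[leb]_s (normc (ft h s * (gam s)%:C) ^+ 2).
  have := congr1 (@complex.Re R) sw; rewrite (eq_cint leb E1) (eq_cint leb E2); exact.
have -> : (\int[leb]_v (normc (mollify v) ^+ 2)%:E = \int[leb]_s (normc (ft h s * (gam s)%:C) ^+ 2)%:E)%E.
  transitivity ((\int[leb]_v (normc (mollify v) ^+ 2))%:E).
    exact: (esym (fineK (integrable_fin_num measurableT N1))).
  rewrite S; exact: (fineK (integrable_fin_num measurableT N2)).
have mF := cmeas_norm cmeas_ft.
have gam1 s : gam s <= 1.
  by rewrite -[leRHS]expR0 ler_expR oppr_le0; exact: mulr_ge0 (ltW pa1) (sqr_ge0 _).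
apply: (@ge0_le_integral _ _ _ leb setT measurableT).
- by move=> s _; rewrite lee_fin; exact: sqr_ge0.
- exact: (measurable_int _ N2).
- by apply/measurable_EFinP; exact: (measurable_funX 2 mF).
- move=> s _; rewrite lee_fin; exact: normc_mul_contract (expR_ge0 _) (gam1 s).
Qed.

End FourierTransform.

(** * Gaussian means at Lebesgue points *)

Section LebesguePoint.
Context (R : realType).
Local Notation leb := (@lebesgue_measure R).
Local Notation cnt := (@zcount R).
Context (f : R -> R) (If : leb.-integrable setT (fun s => (f s)%:E)) (x : R) (xL : lebesgue_pt f x).

Let mf : measurable_fun setT f. Proof. by case/integrableP: If => /measurable_EFinP. Qed.
Let D (r : R) : \bar R := davg f x r.
Let I (r : R) : \bar R := (\int[leb]_(s in ball x r) `|f s - f x|%:E)%E.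

Let I0 r : (0 <= I r)%E. Proof. by apply: integral_ge0 => s _; rewrite lee_fin. Qed.

Let DE r : 0 < r -> (D r = (2 * r)^-1%:E * I r)%E.
Proof.
move=> r0; rewrite /D /davg /iavg (lebesgue_measure_ball _ (ltW r0)).
rewrite inver mulrn_eq0 /= gt_eqF // mulr_natl; congr (_ * _)%E.
Qed.

Let mball r : measurable (ball x r). Proof. exact: measurable_ball. Qed.

(** Small radii are controlled by the Lebesgue point, large ones by the integral of |f|. *)
Let D_bounded : exists B : R, 0 <= B /\ forall r, 0 < r -> (D r <= B%:E)%E.
Proof.
have [r0 r00 hr0] : exists2 r0 : R, 0 < r0 & forall r, 0 < r -> r < r0 -> (D r <= 1)%E.
  have /fine_cvgP[F L] := xL.
  have [e1 /= e10 H1] := F; have /cvgrPdist_le /(_ _ ltr01) [e2 /= e20 H2] := L.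
  exists (Num.min e1 e2); first by rewrite lt_min e10.
  move=> r r0; rewrite lt_min => /andP[r1 r2].
  have Fr : D r \is a fin_num by apply: H1 => //=; rewrite sub0r normrN gtr0_norm.
  have := H2 r; rewrite /= sub0r normrN gtr0_norm // => /(_ r2 r0).
  rewrite sub0r normrN => h; rewrite -(fineK Fr) lee_fin; exact: le_trans (ler_norm _) h.
pose N := \int[leb]_s `|f s|.
have N0 : 0 <= N by apply: Rintegral_ge0.
have NE : (\int[leb]_s `|f s|%:E)%E = N%:E.
  by rewrite /N fineK //; exact: (integrable_fin_num measurableT (integrable_norm If)).
exists (1 + N / (2 * r0) + `|f x|); split.
  by rewrite !addr_ge0 // divr_ge0 // mulr_ge0 // ltW.
move=> r rp; have [rr|rr] := ltP r r0.
  by apply: le_trans (hr0 _ rp rr) _; rewrite lee_fin -addrA lerDl addr_ge0 // divr_ge0 // mulr_ge0 // ltW.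
have i1 : (I r <= N%:E + (`|f x| * (2 * r))%:E)%E.
  apply: (@le_trans _ _ (\int[leb]_(s in ball x r) (`|f s|%:E + `|f x|%:E))%E).
    apply: ge0_le_integral => //.
    - exact: mball.
    - apply/measurable_EFinP; apply: measurable_funTS; apply: measurable_fun_norm.
      by apply: measurable_funB.
    - apply: measurable_funTS; apply: emeasurable_funD => //; apply/measurable_EFinP; exact: measurable_fun_norm.
    - by move=> s _; rewrite -EFinD lee_fin; exact: ler_normB.
  rewrite ge0_integralD //; last 2 first.
  - exact: mball.
  - by apply: measurable_funTS; apply/measurable_EFinP; exact: measurable_fun_norm.
  apply: leeD.
    rewrite -NE; apply: ge0_subset_integral => //; first exact: mball.
    by apply/measurable_EFinP; exact: measurable_fun_norm.
  rewrite integral_cst; last exact: mball.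
  rewrite [X in (_ * X)%E](_ : _ = (r *+ 2)%:E); last exact: (lebesgue_measure_ball x (ltW rp)).
  by rewrite -EFinM mulr_natl.
rewrite DE //; apply: le_trans (lee_wpmul2l _ i1) _.
  by rewrite lee_fin invr_ge0 mulr_ge0 // ltW.
rewrite -EFinD -EFinM lee_fin mulrDr.
have rn : r != 0 by rewrite gt_eqF.
have -> : (2 * r)^-1 * (`|f x| * (2 * r)) = `|f x| by field.
rewrite lerD2r ler_wpDl // mulrC; apply: ler_wpM2l => //.
by rewrite lef_pV2 ?posrE ?mulr_gt0 // ler_pM2l.
Qed.

Let Dfin r : 0 < r -> D r \is a fin_num.
Proof.
move=> r0; have [B [B0 HB]] := D_bounded.
rewrite ge0_fin_numE; first exact: le_lt_trans (HB _ r0) (ltry _).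
exact: davg_ge0.
Qed.

Let M (N : nat) : R := N.+1%:R.
(** On the shell n <= M |s - x| < n + 1 the Gaussian of width 1/M is at most M e^(-pi n^2), and the
    enclosing ball has measure 2 (n + 1) / M; [b n] is the product. Negative indices carry
    nothing. *)
Let b (n : int) : R := if 0 <= n then 2 * (n + 1)%:~R * expR (- (pi * n%:~R ^+ 2)) else 0.
Let d (N : nat) (n : int) : R := fine (D ((n + 1)%:~R / M N)).

Let b_ge0 n : 0 <= b n.
Proof.
rewrite /b; case: ifP => // n0; rewrite !mulr_ge0 ?expR_ge0 // ler0z.
by rewrite addr_ge0.
Qed.

Let Ib : cnt.-integrable setT (fun n => (b n)%:E).
Proof.
have pi2 : 0 < (pi : R) / 2 by rewrite divr_gt0 ?pi_gt0.
have Ig := integrableZl measurableT (2 * (2 + (pi : R)^-1)) (integrable_zgauss 0 pi2).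
have c0 : 0 <= 2 * (2 + (pi : R)^-1) by rewrite mulr_ge0 // addr_ge0 // invr_ge0 pi_ge0.
apply: le_integrable Ig => // n _.
rewrite gee0_abs; last by rewrite lee_fin.
rewrite gee0_abs; last by rewrite mule_ge0 ?lee_fin ?expR_ge0.
rewrite -EFinM lee_fin /b; case: ifP => [n0|_]; last by rewrite mulr_ge0 ?expR_ge0.
rewrite subr0 -mulrA -[leRHS]mulrA; apply: ler_wpM2l => //.
have nn : 0 <= n%:~R :> R by rewrite ler0z.
have := absr_gauss_le n%:~R (pi_gt0 R); rewrite (ger0_norm nn) => h.
have h2 : expR (- (pi * n%:~R ^+ 2)) <= expR (- (pi / 2 * n%:~R ^+ 2)) :> R.
  rewrite ler_expR lerN2; apply: ler_wpM2r; first exact: sqr_ge0.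
  by rewrite ler_pdivrMr // ler_peMr ?pi_ge0 // ler1n.
rewrite intrD mulrDl mul1r; apply: le_trans (lerD h h2) _.
by rewrite le_eqVlt; apply/orP; left; apply/eqP; ring.
Qed.

(** For each n the mean deviation [d N n] tends to 0 as its radius shrinks, and it is bounded; [b]
    is summable, so dominated convergence applies. *)
Let Sd : (fun N => \int[cnt]_n (b n * d N n)) @ \oo --> (0 : R).
Proof.
have [B [B0 HB]] := D_bounded.
have M0 N : 0 < M N by rewrite ltr0n.
have dp N n : 0 <= n -> 0 < (n + 1)%:~R / M N.
  by move=> n0; rewrite divr_gt0 // ltr0z ltzD1.
have -> : (0 : R) = \int[cnt]_n (0 : R) by rewrite /Rintegral integral0.
apply: (Rintegral_dominated (mu := cnt) (fn := fun N n => b n * d N n) (h := fun n => B * b n)) => //.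
- exact: (integrableZl measurableT B Ib).
- move=> N n; have [n0|n0] := boolP (0 <= n); last by rewrite /b (negbTE n0) mul0r normr0 mulr0.
  have d0 : 0 <= d N n by apply: fine_ge0; exact: davg_ge0.
  rewrite ger0_norm ?mulr_ge0 // mulrC; apply: ler_wpM2r => //.
  by rewrite -lee_fin /d fineK ?Dfin ?dp //; exact: HB (dp _ _ n0).
- move=> n; have [n0|n0] := boolP (0 <= n); last first.
    by rewrite /b (negbTE n0); under eq_fun do rewrite mul0r; exact: cvg_cst.
  rewrite -(mulr0 (b n)); apply: cvgM; first exact: cvg_cst.
  have /fine_cvgP[_ L] := xL.
  have u0 : (n + 1)%:~R / M N @[N --> \oo] --> (0 : R).
    rewrite -(mulr0 ((n + 1)%:~R : R)); apply: cvgM; first exact: cvg_cst.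
    exact: cvg_invS.
  apply/cvgrPdist_le => e e0; have /cvgrPdist_le /(_ _ e0) [r /= r0 Hr] := L.
  have /cvgrPdist_lt /(_ _ r0) [K _ HK] := u0.
  exists K => // N KN; apply: Hr; [exact: (HK N KN)|exact: dp].
Qed.

Let psi (N : nat) (s : R) : R := M N * expR (- (pi * M N ^+ 2 * (s - x) ^+ 2)).

Let psi_sum N : (\int[leb]_s (`|f s - f x| * psi N s)%:E <= (\int[cnt]_n (b n * d N n))%:E)%E.
Proof.
have M0 : 0 < M N by rewrite ltr0n.
have Mn : M N != 0 by rewrite gt_eqF.
have [B [B0 HB]] := D_bounded.
have dp n : 0 <= n -> 0 < (n + 1)%:~R / M N.
  by move=> n0; rewrite divr_gt0 // ltr0z ltzD1.
have Ibd : cnt.-integrable setT (fun n => (b n * d N n)%:E).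
  apply: le_integrable (integrableZl measurableT B Ib) => // n _.
  have [n0|n0] := boolP (0 <= n); last by rewrite /b (negbTE n0) mul0r mule0.
  have d0 : 0 <= d N n by apply: fine_ge0; exact: davg_ge0.
  rewrite gee0_abs; last by rewrite lee_fin mulr_ge0.
  rewrite gee0_abs; last by rewrite mule_ge0 ?lee_fin.
  rewrite -EFinM lee_fin mulrC; apply: ler_wpM2r => //.
  by rewrite -lee_fin /d fineK ?Dfin ?dp //; exact: HB (dp _ n0).
have -> : (\int[cnt]_n (b n * d N n))%:E = (\int[cnt]_n (b n * d N n)%:E)%E.
  by rewrite fineK //; exact: (integrable_fin_num measurableT Ibd).
pose be (n : int) : R := if 0 <= n then M N * expR (- (pi * n%:~R ^+ 2)) else 0.
have be0 n : 0 <= be n by rewrite /be; case: ifP => // _; rewrite mulr_ge0 ?expR_ge0 // ltW.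
pose F (z : int * R) : \bar R := ((be z.1)%:E * ((\1_(ball x ((z.1 + 1)%:~R / M N)) z.2 : R)%:E * `|f z.2 - f x|%:E))%E.
have F0 z : (0 <= F z)%E by rewrite !mule_ge0 ?lee_fin // indicE ler0n.
have mn : measurable_fun setT (fun s => `|f s - f x|%:E).
  by apply/measurable_EFinP; apply: measurable_fun_norm; exact: measurable_funB.
have mi (r : R) : measurable_fun setT (fun s => (\1_(ball x r) s : R)%:E).
  by apply/measurable_EFinP; exact: measurable_indic.
have mF1 n : measurable_fun setT (fun s => F (n, s)).
  apply: (emeasurable_funM (f := fun=> (be n)%:E) (g := fun s => ((\1_(ball x ((n + 1)%:~R / M N)) s : R)%:E * `|f s - f x|%:E)%E)); first exact: measurable_cst.
  by apply: (emeasurable_funM (f := fun s => (\1_(ball x ((n + 1)%:~R / M N)) s : R)%:E)); [exact: mi|exact: mn].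
have mF : measurable_fun setT F.
  by apply: measurable_fun_countable_prod; [exact: countable_int|by []|].
apply: (@le_trans _ _ (\int[leb]_s \int[cnt]_n F (n, s))%E).
  apply: ge0_le_integral => //.
  - by move=> s _; rewrite lee_fin mulr_ge0 // mulr_ge0 ?expR_ge0 // ltW.
  - apply/measurable_EFinP; apply: measurable_funM; first exact/measurable_EFinP.
    by apply: measurable_funM => //; exact: measurable_gauss.
  - exact: (@measurable_fun_fubini_tonelli_G _ _ _ _ R cnt F).
  (* The integer part of M |s - x| is the index of the shell containing s; this single term already
     dominates. *)
  move=> s _; pose n := Num.floor (M N * `|s - x|).
  have Ms : 0 <= M N * `|s - x| by rewrite mulr_ge0 // ltW.
  have n0 : 0 <= n by rewrite floor_ge0.
  have /andP[n1 n2] := floor_itv (M N * `|s - x|).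
  apply: le_trans (le_integral_cnt (f := fun n => F (n, s)) n _); last by move=> k; exact: F0.
  rewrite /F /be n0 /= indicE mem_set; last first.
    by rewrite /ball /= distrC ltr_pdivlMr // mulrC.
  rewrite mul1e -EFinM lee_fin mulrC; apply: ler_wpM2r => //.
  rewrite /psi; apply: ler_wpM2l; first exact: ltW.
  rewrite ler_expR lerN2 -mulrA; apply: ler_wpM2l; first exact: pi_ge0.
  rewrite -[(s - x) ^+ 2]real_normK ?num_real // -exprMn; apply: lerXn2r => //.
  by rewrite nnegrE ler0z.
rewrite -(@fubini_tonelli _ _ _ _ R cnt leb _ mF) //.
apply: ge0_le_integral => //.
- by move=> n _; apply: integral_ge0 => s _; exact: F0.
move=> n _.
have FE s : F (n, s) = ((be n)%:E * ((\1_(ball x ((n + 1)%:~R / M N)) s : R)%:E * `|f s - f x|%:E))%E by [].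
under eq_integral do rewrite FE.
rewrite ge0_integralZl ?lee_fin //; last first.
  by apply: (emeasurable_funM (f := fun s => (\1_(ball x ((n + 1)%:~R / M N)) s : R)%:E)); [exact: mi|exact: mn].
have [n0|n0] := boolP (0 <= n); last by rewrite /be /b (negbTE n0) !mul0r mul0e.
have IE : (\int[leb]_s ((\1_(ball x ((n + 1)%:~R / M N)) s : R)%:E * `|f s - f x|%:E) = I ((n + 1)%:~R / M N))%E.
  rewrite /I [RHS]integral_mkcond; apply: eq_integral => s _.
  by rewrite patchE indicE; case: ifP => _; rewrite ?mul1e ?mul0e.
rewrite IE EFinM /d fineK; last by apply: Dfin; exact: dp.
rewrite DE ?dp // muleA -EFinM.
apply: lee_wpmul2r => //; rewrite lee_fin /be /b n0 le_eqVlt; apply/orP; left; apply/eqP.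
have nn : (n + 1)%:~R != 0 :> R by rewrite intr_eq0 gt_eqF // ltzD1.
have N1 : 1 + N%:R != 0 :> R by rewrite addrC natr1 pnatr_eq0.
by move: (expR _) ((n + 1)%:~R) nn => e k kn; field; rewrite N1 kn.
Qed.

Lemma lebesgue_pt_gauss_cvg :
  \int[leb]_s (f s * (N.+1%:R * expR (- (pi * N.+1%:R ^+ 2 * (s - x) ^+ 2)))) @[N --> \oo] --> f x.
Proof.
have M0 N : 0 < M N by rewrite ltr0n.
have pM N : 0 < pi * M N ^+ 2 by rewrite mulr_gt0 ?pi_gt0 ?exprn_gt0.
have psi0 N s : 0 <= psi N s by rewrite mulr_ge0 ?expR_ge0 // ltW.
have Ip N : leb.-integrable setT (fun s => (psi N s)%:E).
  exact: (integrableZl measurableT (M N) (integrable_gauss x (pM N))).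
have p1 N : \int[leb]_s psi N s = 1.
  rewrite /psi (RintegralZl (mu := leb) (M N) measurableT (integrable_gauss x (pM N))).
  rewrite /Rintegral (integral_gauss x (pM N)) /=.
  have -> : pi / (pi * M N ^+ 2) = ((M N)^-1) ^+ 2.
    by rewrite invfM mulrA divff ?mul1r ?exprVn // gt_eqF // pi_gt0.
  by rewrite sqrtr_sqr ger0_norm ?invr_ge0 ?(ltW (M0 N)) // divff // gt_eqF.
have Ifp N : leb.-integrable setT (fun s => (f s * psi N s)%:E).
  have mp : measurable_fun setT (fun s => f s * psi N s).
    by apply: measurable_funM => //; apply: measurable_funM => //; exact: measurable_gauss.
  apply: le_integrable (integrableZl measurableT (M N) If) => //; first exact/measurable_EFinP.
  move=> s _; rewrite /= lee_fin !normrM (ger0_norm (ltW (M0 N))) mulrC.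
  apply: ler_wpM2r => //; rewrite (ger0_norm (expR_ge0 _)) ler_piMr ?(ltW (M0 N)) //.
  by rewrite -[leRHS]expR0 ler_expR oppr_le0 (mulr_ge0 (ltW (pM N)) (sqr_ge0 _)).
have key N : `|\int[leb]_s (f s * psi N s) - f x| <= \int[cnt]_n (b n * d N n).
  have Ic := integrableZl measurableT (f x) (Ip N).
  have -> : \int[leb]_s (f s * psi N s) - f x = \int[leb]_s (f s * psi N s - f x * psi N s).
    by rewrite (RintegralB (mu := leb) measurableT (Ifp N) Ic) (RintegralZl (mu := leb) (f x) measurableT (Ip N)) p1 mulr1.
  have Is := integrableB measurableT (Ifp N) Ic.
  apply: le_trans (le_normr_Rintegral measurableT Is) _.
  rewrite -lee_fin fineK; last exact: (integrable_fin_num measurableT (integrable_norm Is)).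
  apply: le_trans _ (psi_sum N); rewrite le_eqVlt; apply/orP; left; apply/eqP.
  by apply: eq_integral => s _; rewrite -mulrBl normrM (ger0_norm (psi0 N s)).
apply/subr_cvg0; apply/norm_cvg0P; apply: (cvg0_squeeze (b := fun N => \int[cnt]_n (b n * d N n))) => //.
by move=> N; rewrite normr_ge0; exact: key.
Qed.

End LebesguePoint.

(** * Expansion of Gaussian exponentials over the lattice *)

Section KeyExpansion.
Context (R : realType) (t y : R) (y2 : 2^-1 <= y).
Local Notation cnt2 := (@zcount R \x @zcount R)%E.
Local Notation lat := (lat t y).
Local Notation wt := (wt t y).
Local Notation beta := (beta y).
Local Notation theta := (theta t y).

Let y0 : 0 < y. Proof. by apply: lt_le_trans y2; rewrite invr_gt0. Qed.
Let b0 : 0 < beta. Proof. exact: beta_gt0. Qed.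

Lemma theta_lower_gt0 : 0 < theta_lower t y.
Proof.
apply: mulr_gt0; first by rewrite normc_gt0; exact: theta_slope_neq0.
apply: mulr_gt0; first exact: expR_gt0.
have s0 : 0 < 1 + t ^+ 2 + y ^+ 2 by rewrite ltr_wpDr ?sqr_ge0 // ltr_wpDr ?sqr_ge0.
by apply: divr_gt0; [exact: pi_gt0|apply: mulr_gt0 => //; apply: mulr_gt0].
Qed.

Lemma normc_theta_shift w p : normc (theta w) =
  expR (beta * normc w ^+ 2 - beta * normc (w - lat p) ^+ 2) * normc (theta (w - lat p)).
Proof.
rewrite -{1}[w](subrK (lat p)) (theta_shift t y0) normcM normcM normc_e2pi mul1r normc_cexp.
congr (expR _ * _); rewrite !normc_sqr !ReImE /=; case: w => u v /=; ring.
Qed.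

(* The atoms are exponentials of quadratic polynomials, so one set of coefficients expands them all. *)
Lemma key_expansion : exists2 C : R, 0 < C & forall w, exists k : int * int -> R[i],
  (forall p, normc (k p) <= C * expR (beta * (normc w ^+ 2 - normc (lat p) ^+ 2))) /\
  forall a b : R[i], normc b < beta ->
    cintg cnt2 (fun p => k p * cexp (a * lat p + b * lat p ^+ 2)) /\
    cint cnt2 (fun p => k p * cexp (a * lat p + b * lat p ^+ 2)) = cexp (a * w + b * w ^+ 2).
Proof.
have [M M0 HM] := theta_le_lin t y0; have K0 := theta_lower_gt0.
have MK : 0 <= M / theta_lower t y by apply: divr_ge0; exact: ltW.
(* The summand 1 serves the points w of the lattice, the other summand all remaining points. *)
exists (1 + M / theta_lower t y) => [|w]; first by rewrite ltr_wpDr.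
have [[q qw]|H] := pselect (exists q, lat q = w).
  (* At a lattice point the Lagrange series has a pole; the expansion there consists of one term. *)
  exists (fun p => (\1_[set q] p : R)%:C); split => [p|a b bb].
    rewrite normcR ger0_norm ?indicE ?ler0n //.
    have [pq|pq] := pselect (p = q); last first.
      by rewrite memNset //= (mulr_ge0 (addr_ge0 ler01 MK) (expR_ge0 _)).
    by rewrite mem_set // pq qw subrr mulr0 expR0 mulr1 lerDl.
  have E p : (\1_[set q] p : R)%:C * cexp (a * lat p + b * lat p ^+ 2) =
      cexp (a * w + b * w ^+ 2) * (\1_[set q] p : R)%:C.
    rewrite indicE; have [pq|pq] := pselect (p = q); last by rewrite memNset //= mul0r mulr0.
    by rewrite mem_set // pq qw mulrC.
  have i1 : (\int[cnt2]_p (\1_[set q] p : R)%:E = 1)%E.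
    rewrite integral_indic //=; last exact: measurable_int2.
    rewrite setIT; case: (q) => m n.
    have -> : [set (m, n)] = [set m] `*` [set n].
      by apply/seteqP; split => [_ -> //|[u v] [/= -> ->]].
    rewrite product_measure1E //.
    by have -> : (@zcount R [set m] * @zcount R [set n] = 1%E)%E by rewrite !zcount_set1 mule1.
  have I1 : cintg cnt2 (fun p => (\1_[set q] p : R)%:C).
    apply: cintg_lty; first exact: cmeas_int2.
    by under eq_integral do rewrite normcR ger0_norm ?indicE ?ler0n // -indicE; rewrite i1 ltry.
  have -> : (fun p => (\1_[set q] p : R)%:C * cexp (a * lat p + b * lat p ^+ 2)) =
     (fun p => cexp (a * w + b * w ^+ 2) * (\1_[set q] p : R)%:C) by apply/funext => p; exact: E.
  split; first exact: cintgZ.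
  rewrite (cintZ _ I1) (_ : cint _ _ = 1) ?mulr1 //.
  by apply: complexP; rewrite /cint /= /Rintegral ?i1 // integral0.
have wL p : lat p != w by apply/eqP => pw; apply: H; exists p.
have TL := theta_lagr0_ge y0 wL.
have l0 : lagr0 t y w != 0.
  rewrite -normc_gt0; have := lt_le_trans K0 TL; rewrite normcM => h.
  by rewrite lt_neqAle normc_ge0 andbT eq_sym; apply: contraTneq h => ->; rewrite mulr0 ltxx.
exists (fun p => wt p / (lat p - w) / lagr0 t y w); split => [p|a b bb].
  have nz : 0 < normc (lat p - w) by rewrite normc_gt0 subr_eq0.
  have nl : 0 < normc (lagr0 t y w) by rewrite normc_gt0.
  rewrite normcM (normcM (wt p)) !normcV normc_wt.
  apply: le_trans (_ : M / theta_lower t y * expR (beta * (normc w ^+ 2 - normc (lat p) ^+ 2)) <= _); last first.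
    by apply: ler_wpM2r; rewrite ?expR_ge0 // lerDr.
  (* The uniform lower bound trades 1 / |lagr0| for |theta(w)|. Recentred at l_p, the latter
     contains the factor |l_p - w| that cancels the denominator. *)
  have h1 : (normc (lagr0 t y w))^-1 <= normc (theta w) / theta_lower t y.
    by rewrite ler_pdivlMr // mulrC ler_pdivrMr // -normcM.
  have h2 : normc (theta w) <= M * normc (lat p - w) * expR (beta * normc w ^+ 2).
    rewrite (normc_theta_shift w p) mulrC.
    apply: le_trans (ler_wpM2r (expR_ge0 _) (HM _)) _.
    by rewrite -[leLHS]mulrA -expRD [X in expR X]addrC subrK normcB.
  apply: le_trans (ler_wpM2l _ h1) _; first by rewrite mulr_ge0 ?expR_ge0 // invr_ge0 normc_ge0.
  apply: le_trans (_ : expR (- (beta * normc (lat p) ^+ 2)) / normc (lat p - w) *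
      (M * normc (lat p - w) * expR (beta * normc w ^+ 2) / theta_lower t y) <= _).
    apply: ler_wpM2l; first by rewrite mulr_ge0 ?expR_ge0 // invr_ge0 normc_ge0.
    by apply: ler_wpM2r h2; rewrite invr_ge0 ltW.
  have -> : beta * (normc w ^+ 2 - normc (lat p) ^+ 2) = - (beta * normc (lat p) ^+ 2) + beta * normc w ^+ 2 by ring.
  rewrite expRD le_eqVlt; apply/orP; left; apply/eqP.
  move: (expR _) (expR _) nz K0 => e1 e2; move: (normc (lat p - w)) (theta_lower t y) => n K n0 KK.
  by field; rewrite (gt_eqF n0) (gt_eqF KK).
have [I E] := lagrange_exp y0 wL a bb.
have F p : wt p / (lat p - w) / lagr0 t y w * cexp (a * lat p + b * lat p ^+ 2) =
    (lagr0 t y w)^-1 * (wt p * cexp (a * lat p + b * lat p ^+ 2) / (lat p - w)) by ring.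
have -> : (fun p => wt p / (lat p - w) / lagr0 t y w * cexp (a * lat p + b * lat p ^+ 2)) =
    (fun p => (lagr0 t y w)^-1 * (wt p * cexp (a * lat p + b * lat p ^+ 2) / (lat p - w))).
  by apply/funext => p; exact: F.
split; first exact: cintgZ.
by rewrite (cintZ _ I) E mulrC mulfK.
Qed.

End KeyExpansion.

(** * Plancherel's inequality *)

Section Plancherel.
Context (R : realType).
Local Notation leb := (@lebesgue_measure R).
Context (h : R -> R[i]) (Ih : cintg leb h).

(** The mollifications converge at the common Lebesgue points of both components, hence almost
    everywhere, and Fatou's lemma passes the bound of [mollify_le] to the limit. The right-hand side
    may be infinite. *)
Lemma plancherel_le :
  (\int[leb]_s (normc (h s) ^+ 2)%:E <= \int[leb]_xi (normc (ft h xi) ^+ 2)%:E)%E.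
Proof.
(* Squares, so that the factor Num.sqrt a of the Gaussian density is the integer N + 1 of
   [lebesgue_pt_gauss_cvg]. *)
pose a (N : nat) : R := N.+1%:R ^+ 2.
have a0 N : 0 < a N by rewrite exprn_gt0.
pose f N v : \bar R := (normc (mollify h (a N) v) ^+ 2)%:E.
have mf N : measurable_fun setT (f N).
  by apply/measurable_EFinP; exact: (measurable_funX 2 (cmeas_norm (cmeas_mollify Ih (a0 N)))).
have f0 N v : setT v -> (0 <= f N v)%E by move=> _; rewrite lee_fin; exact: sqr_ge0.
have [I1 I2] := Ih.
have L1 := lebesgue_differentiation (open_integrable_locally openT I1).
have L2 := lebesgue_differentiation (open_integrable_locally openT I2).
have sqa N : Num.sqrt (a N) = N.+1%:R by rewrite sqrtr_sqr ger0_norm.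
have cv v : lebesgue_pt (fun s => Re (h s)) v -> lebesgue_pt (fun s => Im (h s)) v ->
    f ^~ v @ \oo --> (normc (h v) ^+ 2)%:E.
  move=> l1 l2.
  have c1 : Re (mollify h (a N) v) @[N --> \oo] --> Re (h v).
    rewrite (_ : (fun N => Re (mollify h (a N) v)) = (fun N => \int[leb]_s (Re (h s) * (N.+1%:R * expR (- (pi * N.+1%:R ^+ 2 * (s - v) ^+ 2)))))).
      exact: (lebesgue_pt_gauss_cvg I1 l1).
    apply/funext => N.
    apply: eq_Rintegral => s _; rewrite ReM /= mulr0 subr0 sqa /a.
    by congr (_ * (_ * expR (- (_ * _)))); rewrite -sqrrN opprB.
  have c2 : Im (mollify h (a N) v) @[N --> \oo] --> Im (h v).
    rewrite (_ : (fun N => Im (mollify h (a N) v)) = (fun N => \int[leb]_s (Im (h s) * (N.+1%:R * expR (- (pi * N.+1%:R ^+ 2 * (s - v) ^+ 2)))))).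
      exact: (lebesgue_pt_gauss_cvg I2 l2).
    apply/funext => N.
    apply: eq_Rintegral => s _; rewrite ImM /= mulr0 add0r sqa /a.
    by congr (_ * (_ * expR (- (_ * _)))); rewrite -sqrrN opprB.
  rewrite /f normc_sqr; under eq_fun do rewrite normc_sqr.
  apply: cvg_EFin; first exact: nearW.
  by rewrite !expr2; under eq_fun do rewrite !expr2; apply: cvgD; exact: cvgM.
have fat := fatou leb measurableT mf f0.
have mh : measurable_fun setT (fun s => (normc (h s) ^+ 2)%:E).
  by apply/measurable_EFinP; exact: (measurable_funX 2 (cmeas_norm (cintg_meas Ih))).
have ae : ae_eq leb setT (fun s => (normc (h s) ^+ 2)%:E) (fun v => limn_einf (f ^~ v)).
  apply: negligibleS (negligibleU L1 L2) => v /= H.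
  have [l1|] := pselect (lebesgue_pt (fun s => Re (h s)) v); last by left.
  have [l2|] := pselect (lebesgue_pt (fun s => Im (h s)) v); last by right.
  by exfalso; apply: H => _; rewrite (cvg_limn_einf_sup (cv v l1 l2)).1.
have ml : measurable_fun setT (fun v => limn_einf (f ^~ v)).
  rewrite (_ : (fun v => limn_einf (f ^~ v)) = (fun v => - limn_esup (fun N => - f N v))%E).
    apply: (measurableT_comp (@oppe_measurable R setT)); apply: measurable_fun_limn_esup => N.
    exact: (measurableT_comp (@oppe_measurable R setT) (mf N)).
  by apply/funext => v; exact: etrans (esym (oppeK _)) (congr1 -%E (esym (limn_esupN _))).
have -> : (\int[leb]_s (normc (h s) ^+ 2)%:E = \int[leb]_v limn_einf (f ^~ v))%E.
  exact: (@ae_eq_integral _ _ _ leb setT _ _ measurableT mh ml ae).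
apply: le_trans fat _; rewrite limn_einf_lim; apply: lime_le; first exact: is_cvg_einfs.
apply: nearW => N; rewrite /einfs /=.
apply: le_trans (_ : \int[leb]_v f N v <= _)%E; last exact: (mollify_le Ih (a0 N)).
by apply: ereal_inf_lbound; exists N => /=.
Qed.

End Plancherel.

(** Integrate e a <= (s/2) e + e a^2 / (2 s) with s = X / S. In this form the integral on the right
    may be infinite. *)
Lemma weighted_cauchy (R : realType) d (T : measurableType d) (mu : {measure set T -> \bar R})
    (e a : T -> R) (S X : R) : measurable_fun setT e -> measurable_fun setT a ->
  (forall p, 0 <= e p) -> (forall p, 0 <= a p) -> 0 < S -> 0 <= X ->
  (\int[mu]_p (e p)%:E <= S%:E)%E -> (X%:E <= \int[mu]_p (e p * a p)%:E)%E ->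
  ((X ^+ 2)%:E <= S%:E * \int[mu]_p (e p * a p ^+ 2)%:E)%E.
Proof.
move=> me ma e0 a0 S0 X0 eS Xea.
have mQ : measurable_fun setT (fun p => (e p * a p ^+ 2)%:E).
  by apply/measurable_EFinP; apply: measurable_funM => //; exact: measurable_funX.
have Q0 : (0 <= \int[mu]_p (e p * a p ^+ 2)%:E)%E.
  by apply: integral_ge0 => p _; rewrite lee_fin mulr_ge0 // sqr_ge0.
move: X0; rewrite le_eqVlt => /predU1P[<-|X0].
  by rewrite expr0n /= mule_ge0 // lee_fin ltW.
pose s := X / S; have s0 : 0 < s by rewrite divr_gt0.
have H : (X%:E <= (s / 2)%:E * S%:E + (s^-1 / 2)%:E * \int[mu]_p (e p * a p ^+ 2)%:E)%E.
  apply: le_trans Xea _.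
  apply: (@le_trans _ _ (\int[mu]_p ((s / 2)%:E * (e p)%:E + (s^-1 / 2)%:E * (e p * a p ^+ 2)%:E))%E).
    apply: ge0_le_integral => //.
    - by move=> p _; rewrite lee_fin mulr_ge0.
    - by apply/measurable_EFinP; exact: measurable_funM.
    - by apply: emeasurable_funD; apply: emeasurable_funM => //; exact/measurable_EFinP.
    - move=> p _; rewrite -!EFinM -EFinD lee_fin -subr_ge0.
      have sn : s != 0 by rewrite gt_eqF.
      have -> : s / 2 * e p + s^-1 / 2 * (e p * a p ^+ 2) - e p * a p = e p * (s^-1 / 2) * (s - a p) ^+ 2 by field.
      by rewrite mulr_ge0 ?sqr_ge0 // mulr_ge0 // divr_ge0 // invr_ge0 ltW.
  have z1 : (0 <= (s / 2)%:E)%E by rewrite lee_fin divr_ge0 // ltW.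
  have z2 : (0 <= (s^-1 / 2)%:E)%E by rewrite lee_fin divr_ge0 // invr_ge0 ltW.
  rewrite ge0_integralD //.
  - rewrite ge0_integralZl //; last 2 first.
    + exact/measurable_EFinP.
    + by move=> p _; rewrite lee_fin.
    rewrite ge0_integralZl //; last by move=> p _; rewrite lee_fin mulr_ge0 // sqr_ge0.
    by rewrite leeD2r // lee_wpmul2l.
  - by move=> p _; rewrite mule_ge0 // lee_fin.
  - by apply: emeasurable_funM => //; exact/measurable_EFinP.
  - by move=> p _; rewrite mule_ge0 // lee_fin mulr_ge0 // sqr_ge0.
  - exact: emeasurable_funM.
move: Q0 H; case: (\int[mu]_p _)%E => [Q| |] //=; last by move=> _ _; rewrite gt0_muley ?leey ?lte_fin.
rewrite !lee_fin => Q0.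
have -> : s / 2 * S = X / 2 by rewrite /s; field; rewrite gt_eqF.
have -> : s^-1 / 2 * Q = S * Q / X / 2 by rewrite /s; field; rewrite !gt_eqF.
move=> H; have : X <= S * Q / X by lra.
by rewrite ler_pdivlMr // expr2.
Qed.

(** * The short-time Fourier transform and its expansion over the lattice *)

Section FrameBound.
Context (R : realType) (t y : R) (y2 : 2^-1 <= y) (u : R[i]) (uy : normc u ^+ 2 * y = 1).
Local Notation leb := (@lebesgue_measure R).
Local Notation cnt2 := (@zcount R \x @zcount R)%E.
Local Notation lat := (lat t y).
Local Notation beta := (beta y).

Let y0 : 0 < y. Proof. by apply: lt_le_trans y2; rewrite invr_gt0. Qed.
Let u0 : 0 < normc u ^+ 2.
Proof. by rewrite -(pmulr_lgt0 _ y0) uy. Qed.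
Let un : u != 0. Proof. by move: u0; rewrite exprn_even_gt0 //= normc_eq0. Qed.
Let pi0 : 0 < (pi : R). Proof. exact: pi_gt0. Qed.

Definition gauss0 : R := 2 `^ 4^-1.

(* [pi_z H_0], the point [(x, xi)] of the plane being [z = x + i xi]. *)
Definition atom (z : R[i]) (s : R) : R[i] :=
  (gauss0 * expR (- (pi * s ^+ 2) - pi * Re z ^+ 2))%:C * cexp ((2 * pi * s)%:C * z).

Definition stft (f : R -> R[i]) (z : R[i]) : R[i] := cint leb (fun s => f s * conjc (atom z s)).

Let g00 : 0 <= gauss0. Proof. exact: powR_ge0. Qed.

Lemma normc_atom z s : normc (atom z s) = gauss0 * expR (- (pi * (s - Re z) ^+ 2)).
Proof.
rewrite /atom normcM normcR ger0_norm ?mulr_ge0 ?expR_ge0 // normc_cexp -[LHS]mulrA -expRD.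
by congr (_ * expR _); case: z => a b; rewrite !ReImE /=; ring.
Qed.

Lemma cmeas_atom z : cmeas (atom z).
Proof.
apply: cmeasM; first by apply: cmeas_real; rmeas.
by apply: cmeas_cexp; apply: cmeasM; [apply: cmeas_real; rmeas|exact: cmeas_cst].
Qed.

Let sqn (f : R -> R[i]) := (\int[leb]_s (normc (f s) ^+ 2)%:E)%E.

(** All atoms have the same norm, so |f| |g| <= |f|^2 + |g|^2 gives a bound uniform in z, as the
    exchange of sum and integral in [stft_expansion] requires. *)
Lemma atom_bound (f : R -> R[i]) : cmeas f -> (sqn f < +oo)%E ->
  exists2 N : R, 0 <= N & forall z, (\int[leb]_s (normc (f s * conjc (atom z s)))%:E <= N%:E)%E.
Proof.
move=> mf ff; pose B : R := Num.sqrt (pi / (2 * pi)).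
have sq0 : (0 <= sqn f)%E by apply: integral_ge0 => s _; rewrite lee_fin sqr_ge0.
have sqE : sqn f = (fine (sqn f))%:E by rewrite fineK // ge0_fin_numE.
exists (fine (sqn f) + gauss0 ^+ 2 * B) => [|z].
  by rewrite addr_ge0 ?fine_ge0 // mulr_ge0 ?sqr_ge0 ?sqrtr_ge0.
have mn := cmeas_norm mf.
have p2 : 0 < 2 * pi :> R by rewrite mulr_gt0.
apply: (@le_trans _ _ (\int[leb]_s ((normc (f s) ^+ 2)%:E + (gauss0 ^+ 2)%:E * (expR (- (2 * pi * (s - Re z) ^+ 2)))%:E))%E).
  apply: ge0_le_integral => //.
  - by move=> s _; rewrite lee_fin normc_ge0.
  - by apply: cmeas_normE; apply: cmeasM => //; apply: cmeasJ; exact: cmeas_atom.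
  - apply: emeasurable_funD; first by apply/measurable_EFinP; exact: measurable_funX.
    by apply: emeasurable_funM => //; apply/measurable_EFinP; exact: measurable_gauss.
  - move=> s _; rewrite -EFinM -EFinD lee_fin normcM normcJ normc_atom.
    have -> : gauss0 ^+ 2 * expR (- (2 * pi * (s - Re z) ^+ 2)) = (gauss0 * expR (- (pi * (s - Re z) ^+ 2))) ^+ 2.
      by rewrite exprMn -expRM_natl; congr (_ * expR _); ring.
    move: (normc (f s)) (gauss0 * _) (normc_ge0 (f s)) (mulr_ge0 g00 (expR_ge0 (- (pi * (s - Re z) ^+ 2)))) => a b a0 b0.
    have := sqr_ge0 (a - b); nra.
have z1 : (0 <= (gauss0 ^+ 2)%:E)%E by rewrite lee_fin sqr_ge0.
rewrite ge0_integralD //.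
- rewrite ge0_integralZl //; last by apply/measurable_EFinP; exact: measurable_gauss.
  by rewrite integral_gauss // -/(sqn f) sqE -EFinM -EFinD.
- by move=> s _; rewrite lee_fin sqr_ge0.
- by apply/measurable_EFinP; exact: measurable_funX.
- by move=> s _; rewrite mule_ge0 // lee_fin expR_ge0.
- by apply: emeasurable_funM => //; apply/measurable_EFinP; exact: measurable_gauss.
Qed.

Lemma stft_expansion : exists2 C : R, 0 < C & forall q (f : R -> R[i]), 0 < q -> q < 1 ->
  cmeas f -> (sqn f < +oo)%E -> forall z,
  ((normc (stft f z))%:E <= C%:E * \int[cnt2]_p
     (expR (- (pi / 2 * (1 - q ^+ 2) * normc u ^+ 2 * normc (lat p - z / (q%:C * u)) ^+ 2)) * normc (stft f (q%:C * u * lat p)))%:E)%E.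
Proof.
have [C C0 HC] := key_expansion t y2; exists C => // q f q0 q1 mf ff z.
have qn : q%:C != 0 :> R[i] by rewrite -normc_gt0 normcR gtr0_norm.
have qun : q%:C * u != 0 by rewrite mulf_neq0.
pose w := z / (q%:C * u); have zE : z = q%:C * u * w by rewrite /w mulrCA divff // mulr1.
have [k [kle kE]] := HC w.
have uE : normc u ^+ 2 = y^-1 by rewrite -[RHS]mul1r -uy mulfK // gt_eqF.
have q2 : 0 < 1 - q ^+ 2 by rewrite subr_gt0 exprn_ilt1 // ltW.
(* The atom at z has the non-holomorphic factor exp(- pi (Re z)^2), and pi (Re z)^2 = (pi/2) (|z|^2
   + Re(z^2)). The factor exp(b l^2) removes the part Re(z^2); |b| = beta q^2 < beta is where q < 1
   enters. *)
pose b : R[i] := - ((pi / 2 * q ^+ 2)%:C * u ^+ 2).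
have bb : normc b < beta.
  rewrite /b normcN normcM normcX normcR ger0_norm; last by rewrite mulr_ge0 ?sqr_ge0 // divr_ge0 // ltW.
  have -> : pi / 2 * q ^+ 2 * normc u ^+ 2 = beta * q ^+ 2 by rewrite uE /beta invfM; ring.
  by rewrite -[ltRHS]mulr1 ltr_pM2l ?beta_gt0 // exprn_ilt1 // ltW.
(* The first summand is the exponent of the atom at time s. The second completes the square, so that
   the spare Gaussian of exponent proportional to 1 - q^2 is centred at w instead of 0. *)
pose a s : R[i] := (2 * pi * s)%:C * (q%:C * u) + (pi * (1 - q ^+ 2) * normc u ^+ 2)%:C * conjc w.
pose al : R := pi / 2 * (1 - q ^+ 2) * normc u ^+ 2.
have al0 : 0 < al by rewrite mulr_gt0 // mulr_gt0 // divr_gt0.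
pose e p := expR (- (al * normc (lat p - w) ^+ 2)).
(* The coefficients of the atom at z in the atoms at the points q u l_p; the time s has
   cancelled. *)
pose c p := k p * cexp ((pi * (1 - q ^+ 2) * normc u ^+ 2)%:C * conjc w * lat p + b * lat p ^+ 2
   - (pi * (1 - q ^+ 2) * normc u ^+ 2)%:C * conjc w * w - b * w ^+ 2
   + (pi * Re (q%:C * u * lat p) ^+ 2 - pi * Re z ^+ 2)%:C).
have cle p : normc (c p) <= C * e p.
  rewrite /c normcM normc_cexp; apply: le_trans (ler_wpM2r (expR_ge0 _) (kle p)) _.
  rewrite -[leLHS]mulrA -expRD le_eqVlt; apply/orP; left; apply/eqP; congr (_ * expR _).
  have bE : beta = pi / 2 * normc u ^+ 2 by rewrite uE /beta invfM; ring.
  rewrite bE /al /b zE !normc_sqr.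
  case: (w) (lat p) (u) => w1 w2 [m1 m2] [u1 u2]; rewrite !expr2 !ReImE /=.
  by move: (pi : R) => p'; field.
pose l p := q%:C * u * lat p.
pose K0 : R[i] := - (pi * (1 - q ^+ 2) * normc u ^+ 2)%:C * conjc w * w - b * w ^+ 2.
pose h s : R[i] := (gauss0 * expR (- (pi * s ^+ 2) - pi * Re z ^+ 2))%:C * cexp K0.
have gE X : (gauss0 * expR X)%:C = gauss0%:C * cexp X%:C :> R[i] by rewrite cexp_real -rmorphM.
have csum s p : c p * atom (l p) s = h s * (k p * cexp (a s * lat p + b * lat p ^+ 2)).
  rewrite /c /atom /h !gE.
  have -> (e1 e2 e3 : R[i]) : k p * cexp e1 * (gauss0%:C * cexp e2 * cexp e3) = gauss0%:C * k p * cexp (e1 + e2 + e3).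
    by rewrite !cexpD; ring.
  have -> (e1 e2 e3 : R[i]) : gauss0%:C * cexp e1 * cexp e2 * (k p * cexp e3) = gauss0%:C * k p * cexp (e1 + e2 + e3).
    by rewrite !cexpD; ring.
  congr (_ * cexp _); rewrite /a /K0 /l.
  move: (Re (q%:C * u * lat p)) (Re z) (conjc w) (normc u) (b) => r1 r2 w' nu b'.
  ring.
have asum s : atom z s = h s * cexp (a s * w + b * w ^+ 2).
  rewrite /atom /h -[RHS]mulrA -cexpD; congr (_ * cexp _); rewrite /a /K0 [in LHS]zE; ring.
have al1 : cnt2.-integrable setT (fun p => (C * e p)%:E).
  exact: (integrableZl measurableT C (integrable_lgauss t y0 w al0)).
pose f2 (v : (int * int) * R) := f v.2 * conjc (c v.1 * atom (l v.1) v.2).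
have [N N0 HN] := atom_bound mf ff.
have If z' : cintg leb (fun s => f s * conjc (atom z' s)).
  apply: cintg_lty; last exact: le_lt_trans (HN z') (ltry _).
  by apply: cmeasM => //; apply: cmeasJ; exact: cmeas_atom.
have f2E p s : f2 (p, s) = conjc (c p) * (f s * conjc (atom (l p) s)).
  by rewrite /f2 /= conjcM mulrCA.
have I1 p : cintg leb (fun s => f2 (p, s)).
  by have := cintgZ (conjc (c p)) (If (l p)); congr cintg; apply/funext => s; rewrite f2E.
have I2 s : cintg cnt2 (fun p => f2 (p, s)).
  have := cintgZ (f s) (cintgJ (cintgZ (h s) (kE (a s) b bb).1)); congr cintg; apply/funext => p.
  by rewrite /f2 csum.
have mf2 : cmeas f2.
  have I1m p := cintg_meas (I1 p).
  by split; (apply: measurable_fun_countable_prod; [exact: countable_int2|exact: measurable_int2|]) => p; case: (I1m p).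
have fin : (\int[cnt2]_p \int[leb]_s (normc (f2 (p, s)))%:E < +oo)%E.
  have /integrableP[_] := integrableZl measurableT N al1; apply: le_lt_trans.
  apply: ge0_le_integral => //.
  - by move=> p _; apply: integral_ge0 => s _; rewrite lee_fin normc_ge0.
  - by apply: measurable_fun_int2.
  - by apply: measurable_fun_int2.
  move=> p _; rewrite gee0_abs; last by rewrite mule_ge0 ?lee_fin // mulr_ge0 ?expR_ge0 // ltW.
  under eq_integral do rewrite f2E normcM normcJ EFinM.
  rewrite ge0_integralZl ?lee_fin ?normc_ge0 //.
  - rewrite muleC; apply: lee_pmul; rewrite ?lee_fin ?normc_ge0 //.
    by apply: integral_ge0 => s _; rewrite lee_fin normc_ge0.
  - exact: (cmeas_normE (cintg_meas (If (l p)))).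
  - by move=> s _; rewrite lee_fin normc_ge0.
have [_ J1 _ sw _] := @cint_fubini _ _ _ _ R (@zcount2 R) leb f2 mf2 I1 I2 fin.
have E1 p : cint leb (fun s => f2 (p, s)) = conjc (c p) * stft f (l p).
  by rewrite (eq_cint leb (f2E p)) (cintZ _ (If (l p))).
have E2 s : cint cnt2 (fun p => f2 (p, s)) = f s * conjc (atom z s).
  have P1 : cintg cnt2 (fun p => h s * (k p * cexp (a s * lat p + b * lat p ^+ 2))) := cintgZ (h s) (kE (a s) b bb).1.
  rewrite asum -(kE (a s) b bb).2 -(cintZ _ (kE (a s) b bb).1) -(cintJ P1) -(cintZ _ (cintgJ P1)).
  by apply: eq_cint => p; rewrite /f2 csum.
have FE : stft f z = cint cnt2 (fun p => conjc (c p) * stft f (l p)).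
  by rewrite /stft -(eq_cint leb E2) -[LHS]sw; exact: (eq_cint cnt2 E1).
have J : cintg cnt2 (fun p => conjc (c p) * stft f (l p)).
  by move: J1; congr cintg; apply/funext => p; exact: E1.
have NJ := normc_cint J; rewrite -FE -lee_fin in NJ.
rewrite fineK in NJ; last exact: (integrable_fin_num measurableT (cintg_norm J)).
apply: le_trans NJ _; rewrite -ge0_integralZl; last 4 first.
- by [].
- by apply: measurable_fun_int2.
- by move=> p _; rewrite lee_fin mulr_ge0 ?expR_ge0 ?normc_ge0.
- by rewrite lee_fin ltW.
apply: ge0_le_integral => //.
- by move=> p _; rewrite lee_fin normc_ge0.
- by apply: measurable_fun_int2.
- by apply: measurable_fun_int2.
move=> p _; rewrite -EFinM lee_fin normcM normcJ mulrA; apply: ler_wpM2r; first exact: normc_ge0.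
exact: cle.
Qed.

End FrameBound.

(** * Lattice bases, covolume and Gauss reduction *)

Section Lattices.
Context (R : realType).
Implicit Types (A B : 'M[R]_2) (L : set 'cV[R]_2).

Lemma lattice_of_sub A B : lattice_of B `<=` lattice_of A -> exists U : 'M[int]_2, B = A *m map_mx intr U.
Proof.
move=> BA.
have H (j : 'I_2) : exists k : 'cV[int]_2, A *m map_mx intr k = col j B.
  have : lattice_of B (col j B).
    exists (delta_mx j 0) => //; rewrite colE; congr (_ *m _).
    by apply/matrixP => a b; rewrite !mxE; case: (_ && _).
  by move=> /BA [k _ kE]; exists k.
pose k j := sval (cid (H j)).
exists (\matrix_(i, j) k j i 0); apply/matrixP => i j.
have := svalP (cid (H j)); rewrite -/(k j) => /matrixP /(_ i 0); rewrite !mxE => <-.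
by apply: eq_bigr => l _; rewrite !mxE.
Qed.

(** The two changes of basis are integral matrices whose determinants have product 1. *)
Lemma lattice_of_det A B : A \in unitmx -> B \in unitmx -> lattice_of A = lattice_of B ->
  `|\det A| = `|\det B|.
Proof.
move=> uA uB E.
have [U BU] : exists U : 'M[int]_2, B = A *m map_mx intr U by apply: lattice_of_sub; rewrite E.
have [V AV] : exists V : 'M[int]_2, A = B *m map_mx intr V by apply: lattice_of_sub; rewrite E.
have dA : \det A != 0 by rewrite -unitfE -unitmxE.
have dU : \det B = \det A * (\det U)%:~R by rewrite {1}BU det_mulmx det_map_mx.
have dV : \det A = \det B * (\det V)%:~R by rewrite {1}AV det_mulmx det_map_mx.
have UV : \det U * \det V = 1.
  apply: (@intr_inj R); rewrite intrM; apply: (mulfI dA); rewrite mulr1.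
  by rewrite mulrA -dU -dV.
have nU : `|\det U| = 1.
  have /eqP := congr1 (fun z : int => `|z|%N) UV; rewrite abszM muln_eq1 => /andP[/eqP h _].
  by rewrite -abszE h.
by rewrite dU normrM -intr_norm nU mulr1.
Qed.

Lemma covolumeE A : A \in unitmx -> covolume (lattice_of A) = `|\det A|.
Proof.
move=> uA; rewrite /covolume; case: xgetP => [s _ [B [uB E ->]]|/(_ `|\det A|) H].
  exact/esym/lattice_of_det.
by exfalso; apply: H; exists A.
Qed.

Lemma scale_lattice (q : R) A : scale_set q (lattice_of A) = lattice_of (q *: A).
Proof.
apply/seteqP; split => [_ [_ [k _ <-] <-]|_ [k _ <-]].
  by exists k => //; rewrite scalemxAl.
by exists (A *m map_mx intr k); [exists k|rewrite scalemxAl].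
Qed.

Lemma scale_unitmx (q : R) A : q != 0 -> A \in unitmx -> q *: A \in unitmx.
Proof. by move=> q0 uA; rewrite unitmxZ ?unitfE. Qed.

Lemma covolume_scale (q : R) A : 0 < q -> A \in unitmx ->
  covolume (scale_set q (lattice_of A)) = q ^+ 2 * covolume (lattice_of A).
Proof.
move=> q0 uA; rewrite scale_lattice !covolumeE ?scale_unitmx ?gt_eqF //.
by rewrite detZ normrM ger0_norm // exprn_ge0 // ltW.
Qed.

(* One step of Gauss reduction, which doubles [y] as long as [y < 1/2]. *)
Lemma complex_step (u : R[i]) (t y : R) : u != 0 -> 0 < y ->
  exists (u' : R[i]) (t' y' : R), [/\ u' != 0, normc u' ^+ 2 * y' = normc u ^+ 2 * y,
    (forall z, (exists p : int * int, z = u * lat t y p) <-> (exists p : int * int, z = u' * lat t' y' p)) &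
    0 < y' /\ (2^-1 <= y' \/ 2 * y <= y')].
Proof.
(* The nearest integer to t, to be subtracted from tau so that its real part is at most 1/2 in
   modulus. *)
move=> un y0; pose m := Num.floor (t + 2^-1).
have /andP[m1 m2] := floor_itv (t + 2^-1); rewrite -/m intrD1 in m1 m2.
pose t1 := t - m%:~R.
have t1h : `|t1| <= 2^-1 by rewrite ler_norml /t1; apply/andP; split; lra.
have t2 : t1 ^+ 2 <= 4^-1.
  have : `|t1| ^+ 2 <= 2^-1 ^+ 2 by apply: lerXn2r; rewrite ?nnegrE ?invr_ge0.
  by rewrite real_normK ?num_real // exprVn -natrX.
pose r := t1 ^+ 2 + y ^+ 2.
have r0 : 0 < r by rewrite ltr_wpDl ?sqr_ge0 ?exprn_gt0.
have yn : y != 0 by rewrite gt_eqF.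
have rn : r != 0 by rewrite gt_eqF.
have [yh|yh] := leP 2^-1 y.
  exists u, t, y; split => //; split => //; by left.
have n0 : t1 +i* y != 0 by rewrite eq_complex /= negb_and yn orbT.
(* The basis u, u tau_1 with tau_1 = t1 + i y is replaced by u tau_1, - u, so that tau_1 becomes -1
   / tau_1, of imaginary part y / r. *)
exists (u * (t1 +i* y)), (- t1 / r), (y / r); split.
- exact: mulf_neq0.
- by rewrite normcM exprMn [normc (_ +i* _) ^+ 2]normc_sqr /= -/r -mulrA; congr (_ * _); field.
- have E (a b : int) : lat t y (a, b) = (t1 +i* y) * lat (- t1 / r) (y / r) (b, - (a + b * m)).
    have tE : t = t1 + m%:~R by rewrite /t1 subrK.
    rewrite /lat /= mulrNz intrD intrM; move: rn tE; rewrite /r; move: (t1) (m%:~R) => s k rn' ->.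
    by apply: complexP; rewrite !ReImE /=; field; exact: rn'.
  move=> z; split => [[[a b] ->]|[[a b] ->]].
    by exists (b, - (a + b * m)); rewrite E mulrA.
  exists (- (b + a * m), a); rewrite E mulrA; congr (_ * lat _ _ (_, _)); ring.
- split; first exact: divr_gt0.
  have ry : r <= 2^-1.
    have : y ^+ 2 <= 2^-1 ^+ 2 by apply: lerXn2r; rewrite ?nnegrE ?invr_ge0 // ltW.
    rewrite exprVn -natrX /r; lra.
  right; rewrite ler_pdivlMr //; nra.
Qed.

(** Iterate the step: 2^N y >= 1 once N >= 1/y, so 1/2 is reached after finitely many doublings. *)
Lemma complex_reduction (u : R[i]) (t y : R) : u != 0 -> 0 < y ->
  exists (u' : R[i]) (t' y' : R), [/\ u' != 0, normc u' ^+ 2 * y' = normc u ^+ 2 * y,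
    (forall z, (exists p : int * int, z = u * lat t y p) <-> (exists p : int * int, z = u' * lat t' y' p)) &
    2^-1 <= y'].
Proof.
move=> un y0.
have H (n : nat) : exists (u' : R[i]) (t' y' : R), [/\ u' != 0, normc u' ^+ 2 * y' = normc u ^+ 2 * y,
    (forall z, (exists p : int * int, z = u * lat t y p) <-> (exists p : int * int, z = u' * lat t' y' p)) &
    0 < y' /\ (2^-1 <= y' \/ 2 ^+ n * y <= y')].
  elim: n => [|n [u' [t' [y' [un' nE S [yp yh]]]]]].
    exists u, t, y; split => //; split => //; by right; rewrite expr0 mul1r.
  have [u2 [t2 [y2 [un2 nE2 S2 [yp2 yh2]]]]] := complex_step t' un' yp.
  case: yh => [h|h].
    by exists u', t', y'; split => //; split => //; left.
  exists u2, t2, y2; split => //; first by rewrite nE2.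
    by move=> z; rewrite S S2.
  split => //; case: yh2 => [|h2]; [by left|right].
  by rewrite exprS -mulrA; apply: le_trans _ h2; apply: ler_wpM2l.
pose N := Num.bound y^-1.
have [u' [t' [y' [un' nE S [yp yh]]]]] := H N.
exists u', t', y'; split => //; case: yh => // h.
apply: le_trans _ h; apply: le_trans (_ : 1 <= _); first by rewrite invf_le1 // ler1n.
rewrite -ler_pdivrMr // mul1r.
apply: le_trans (ltW (archi_boundP _)) _; first by rewrite invr_ge0 ltW.
by rewrite -natrX ler_nat; exact: ltnW (ltn_expl _ _).
Qed.

End Lattices.

Lemma gauss0_sqr (R : realType) : gauss0 R ^+ 2 = Num.sqrt 2.
Proof.
rewrite /gauss0 -powR_mulrn ?powR_ge0 // -powRrM.
by rewrite (_ : 4^-1 * 2%:R = 2^-1) ?powR12_sqrt //; field.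
Qed.

(** Tonelli. It will be used once for each coordinate of the plane, each time yielding the factor
    sqrt(pi / a). *)
Lemma integral_lattice_gauss (R : realType) (a : R) (c w : int * int -> R) : 0 < a -> (forall p, 0 <= w p) ->
  measurable_fun setT (fun x : R => (\int[zcount2 R]_p (w p * expR (- (a * (x - c p) ^+ 2)))%:E)%E) /\
  (\int[@lebesgue_measure R]_x \int[zcount2 R]_p (w p * expR (- (a * (x - c p) ^+ 2)))%:E =
   (Num.sqrt (pi / a))%:E * \int[zcount2 R]_p (w p)%:E)%E.
Proof.
move=> a0 w0; pose F (z : (int * int) * R) : \bar R := (w z.1 * expR (- (a * (z.2 - c z.1) ^+ 2)))%:E.
have F0 z : (0 <= F z)%E by rewrite lee_fin mulr_ge0 ?expR_ge0.
have mE p : measurable_fun setT (fun x : R => (expR (- (a * (x - c p) ^+ 2)))%:E).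
  by apply/measurable_EFinP; exact: measurable_gauss.
have mF : measurable_fun setT F.
  apply: measurable_fun_countable_prod; [exact: countable_int2|exact: measurable_int2|] => p.
  apply/measurable_EFinP; change (measurable_fun setT (fun x : R => w p * expR (- (a * (x - c p) ^+ 2)))).
  by apply: measurable_funM; [exact: measurable_cst|exact: measurable_gauss].
split; first exact: (@measurable_fun_fubini_tonelli_G _ _ _ _ R (zcount2 R) F).
rewrite -(@fubini_tonelli _ _ _ _ R (zcount2 R) lebesgue_measure F mF F0) -ge0_integralZl //;
  try (by apply: measurable_fun_int2); try (by move=> p _; rewrite lee_fin); try by rewrite lee_fin sqrtr_ge0.
apply: eq_integral => p _; have mg := mE p.
transitivity (\int[lebesgue_measure]_x ((w p)%:E * (expR (- (a * (x - c p) ^+ 2)))%:E))%E.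
  by apply: eq_integral => x _; rewrite /F EFinM.
by rewrite ge0_integralZl ?lee_fin // integral_gauss // muleC.
Qed.

(** * The frame inequality with explicit dependence on q *)

Section FrameInequality.
Context (R : realType) (t y : R) (y2 : 2^-1 <= y) (u : R[i]) (uy : normc u ^+ 2 * y = 1).
Local Notation leb := (@lebesgue_measure R).
Local Notation cnt2 := (@zcount2 R).
Local Notation lat := (lat t y).
Local Notation sqn f := (\int[leb]_s (normc (f s) ^+ 2)%:E)%E.

Let y0 : 0 < y. Proof. by apply: lt_le_trans y2; rewrite invr_gt0. Qed.
Let u0 : 0 < normc u ^+ 2. Proof. by rewrite -(pmulr_lgt0 _ y0) uy. Qed.
Let un : u != 0. Proof. by move: u0; rewrite exprn_even_gt0 //= normc_eq0. Qed.
Let pi0 : 0 < (pi : R). Proof. exact: pi_gt0. Qed.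

Definition window (f : R -> R[i]) (x s : R) : R[i] := f s * (gauss0 R * expR (- (pi * (s - x) ^+ 2)))%:C.

(** At fixed time x the transform is an ordinary Fourier transform in xi, to which [plancherel_le]
    applies. *)
Lemma stft_window (f : R -> R[i]) x xi : stft f (x +i* xi) = ft (window f x) xi.
Proof.
apply: eq_cint => s; rewrite /window /atom.
set r := gauss0 R * expR (- (pi * s ^+ 2) - pi * Re (x +i* xi) ^+ 2).
have cE : conjc (r%:C * cexp ((2 * pi * s)%:C * (x +i* xi))) = r%:C * ((expR (2 * pi * s * x))%:C * e2pi (- (xi * s))).
  rewrite conjcM -cexpJ; congr (_ * _); first by apply: complexP; rewrite !ReImE /= ?oppr0.
  by rewrite -cexp_real /e2pi -cexpD; congr cexp; apply: complexP; rewrite !ReImE /=; ring.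
have rE : r * expR (2 * pi * s * x) = gauss0 R * expR (- (pi * (s - x) ^+ 2)).
  by rewrite /r -[LHS]mulrA -expRD; congr (_ * expR _); rewrite /=; ring.
by rewrite cE [r%:C * _]mulrA -rmorphM rE mulrA.
Qed.

Lemma cmeas_window f x : cmeas f -> cmeas (window f x).
Proof. by move=> mf; apply: cmeasM => //; apply: cmeas_real; rmeas. Qed.

Lemma cintg_window f x : cmeas f -> (sqn f < +oo)%E -> cintg leb (window f x).
Proof.
move=> mf ff; have [N N0 HN] := atom_bound mf ff.
apply: cintg_lty; first exact: cmeas_window.
apply: le_lt_trans (_ : _ <= N%:E)%E (ltry _); apply: le_trans _ (HN (x%:C)).
rewrite le_eqVlt; apply/orP; left; apply/eqP; apply: eq_integral => s _.
rewrite /window !normcM normcJ normc_atom normcR ger0_norm // mulr_ge0 ?expR_ge0 //.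
exact: powR_ge0.
Qed.

(** Tonelli, as the Gaussian window has norm one. *)
Lemma window_norm f : cmeas f -> (\int[leb]_x sqn (window f x) = sqn f)%E.
Proof.
move=> mf; have mn := cmeas_norm mf.
pose F (z : R * R) : \bar R := ((normc (f z.2) ^+ 2)%:E * (gauss0 R ^+ 2 * expR (- (2 * pi * (z.1 - z.2) ^+ 2)))%:E)%E.
have mF : measurable_fun setT F.
  apply: emeasurable_funM; apply/measurable_EFinP; last by rmeas.
  by apply: measurable_funX; apply: (measurableT_comp mn).
have F0 z : (0 <= F z)%E.
  by rewrite mule_ge0 // lee_fin ?sqr_ge0 // mulr_ge0 ?sqr_ge0 ?expR_ge0.
have E x s : (normc (window f x s) ^+ 2)%:E = F (x, s).
  rewrite /F -EFinM /window normcM normcR exprMn real_normK ?num_real // exprMn -expRM_natl.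
  by congr (_ * (_ * expR _))%:E; rewrite /=; ring.
under eq_integral do under eq_integral do rewrite E.
rewrite (@fubini_tonelli _ _ _ _ R leb leb F mF F0).
apply: eq_integral => s _; rewrite /F /=.
have p2 : 0 < 2 * pi :> R by rewrite mulr_gt0.
have mg : measurable_fun setT (fun x : R => (expR (- (2 * pi * (x - s) ^+ 2)))%:E).
  by apply/measurable_EFinP; exact: measurable_gauss.
rewrite ge0_integralZl ?lee_fin ?sqr_ge0 //.
- under eq_integral do rewrite EFinM.
  rewrite ge0_integralZl ?lee_fin ?sqr_ge0 // integral_gauss // gauss0_sqr -EFinM -sqrtrM //.
  have -> : 2 * (pi / (2 * pi)) = 1 :> R.
    by move: (pi : R) pi0 => p p0; field; rewrite gt_eqF.
  by rewrite sqrtr1 ?mule1 ?mulr1.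
- by apply/measurable_EFinP; rmeas.
- by move=> x _; rewrite lee_fin mulr_ge0 ?sqr_ge0 ?expR_ge0.
Qed.

Lemma frame_inequality : exists2 K : R, 0 < K & forall q (f : R -> R[i]), 0 < q -> q < 1 ->
  cmeas f -> (sqn f < +oo)%E ->
  (sqn f <= (K / (1 - q ^+ 2) ^+ 2)%:E * \int[cnt2]_p (normc (stft f (q%:C * u * lat p)) ^+ 2)%:E)%E.
Proof.
have [C C0 HC] := stft_expansion t y2 uy.
pose E0 := expR (pi / (2 * y) * (1 + y ^+ 2)).
(* The factor 8 is 4 times 2: S is at most E0 * 4 / (1 - q^2), and the two Gaussian integrals give
   pi / gm, at most 2 / (1 - q^2). *)
exists (8 * C ^+ 2 * E0) => [|q f q0 q1 mf ff].
  by apply: mulr_gt0 (expR_gt0 _); apply: mulr_gt0 => //; exact: exprn_gt0.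
have q2 : 0 < 1 - q ^+ 2 by rewrite subr_gt0 exprn_ilt1 // ltW.
have qn : q%:C != 0 :> R[i] by rewrite -normc_gt0 normcR gtr0_norm.
pose G p := normc (stft f (q%:C * u * lat p)).
have G0 p : 0 <= G p := normc_ge0 _.
pose al : R := pi / 2 * (1 - q ^+ 2) * normc u ^+ 2.
have al0 : 0 < al by rewrite mulr_gt0 // mulr_gt0 // divr_gt0.
(* The exponent [al] expressed in the variable z instead of z / (q u), that is al / (q^2 |u|^2). *)
pose gm : R := pi / 2 * (1 - q ^+ 2) / q ^+ 2.
have gm0 : 0 < gm by rewrite divr_gt0 ?exprn_gt0 // mulr_gt0 // divr_gt0.
pose S := expR (al * (1 + y ^+ 2)) * (2 * pi / (al * y)).
have S0 : 0 < S := mulr_gt0 (expR_gt0 _) (divr_gt0 (mulr_gt0 (ltr0n R 2) pi0) (mulr_gt0 al0 y0)).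
pose l p := q%:C * u * lat p.
pose ex p (z : R[i]) := expR (- (gm * (Re z - Re (l p)) ^+ 2)) * expR (- (gm * (Im z - Im (l p)) ^+ 2)).
have exE p z : expR (- (al * normc (lat p - z / (q%:C * u)) ^+ 2)) = ex p z.
  have qun : q%:C * u != 0 by rewrite mulf_neq0.
  have -> : lat p - z / (q%:C * u) = (l p - z) / (q%:C * u) by rewrite mulrBl [l p]mulrC mulfK.
  rewrite /ex -expRD normcM normcV exprMn exprVn normcM exprMn normcR real_normK ?num_real // normc_sqr !ReImE.
  have qq : q != 0 by rewrite gt_eqF.
  have nu : normc u ^+ 2 != 0 by rewrite gt_eqF.
  congr expR; rewrite /al /gm; move: (normc u ^+ 2) nu (pi : R) => U Un p'; field.
  by rewrite Un qq.
(* Cauchy-Schwarz against the Gaussian weights, whose total S does not depend on z. *)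
have point z : ((normc (stft f z) ^+ 2)%:E <= (C ^+ 2 * S)%:E * \int[cnt2]_p (ex p z * G p ^+ 2)%:E)%E.
  pose X := normc (stft f z) / C.
  have X0 : 0 <= X by rewrite divr_ge0 ?normc_ge0 // ltW.
  have eS : (\int[cnt2]_p (ex p z)%:E <= S%:E)%E.
    have := lgauss_le t y0 (z / (q%:C * u)) al0.
    by under eq_integral do rewrite exE.
  have Xea : (X%:E <= \int[cnt2]_p (ex p z * G p)%:E)%E.
    have := HC q f q0 q1 mf ff z; under eq_integral do rewrite exE.
    move=> h; rewrite /X mulrC EFinM.
    have -> : (\int[cnt2]_p (ex p z * G p)%:E = C^-1%:E * (C%:E * \int[cnt2]_p (ex p z * G p)%:E))%E.
      by rewrite muleA -EFinM mulVf ?mul1e // gt_eqF.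
    by apply: lee_wpmul2l => //; rewrite lee_fin invr_ge0 ltW.
  have := weighted_cauchy (mu := cnt2) (measurable_fun_int2 _) (measurable_fun_int2 _) (fun p => mulr_ge0 (expR_ge0 _) (expR_ge0 _)) G0 S0 X0 eS Xea.
  move=> h; rewrite [(C ^+ 2 * S)%:E]EFinM -muleA.
  have -> : normc (stft f z) ^+ 2 = C ^+ 2 * X ^+ 2 by rewrite /X exprMn exprVn mulrC mulfVK // expf_neq0 // gt_eqF.
  by rewrite [(C ^+ 2 * X ^+ 2)%:E]EFinM; apply: lee_wpmul2l => //; rewrite lee_fin sqr_ge0.
pose B := Num.sqrt (pi / gm).
have swap c w := @integral_lattice_gauss R gm c w gm0.
have C20 : (0 <= (C ^+ 2 * S)%:E)%E by rewrite lee_fin mulr_ge0 ?sqr_ge0 // ltW.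
(* Plancherel in xi at fixed x; integrating the pointwise bound over xi costs B. The integral over x
   costs B once more. *)
have fx x : (sqn (window f x) <= (C ^+ 2 * S)%:E * (B%:E * \int[cnt2]_p (G p ^+ 2 * expR (- (gm * (x - Re (l p)) ^+ 2)))%:E))%E.
  apply: le_trans (plancherel_le (cintg_window x mf ff)) _.
  pose w p := G p ^+ 2 * expR (- (gm * (x - Re (l p)) ^+ 2)).
  have w0 p : 0 <= w p by rewrite mulr_ge0 ?sqr_ge0 ?expR_ge0.
  have [mw <-] := swap (fun p => Im (l p)) w w0.
  rewrite -ge0_integralZl //; last by move=> xi _; apply: integral_ge0 => p _; rewrite lee_fin mulr_ge0 ?expR_ge0.
  apply: (@ge0_le_integral _ _ _ leb setT measurableT).
  - by move=> xi _; rewrite lee_fin sqr_ge0.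
  - apply/measurable_EFinP; apply: measurable_funX; apply: cmeas_norm.
    exact: (cmeas_ft (cintg_window x mf ff) ltr01).
  - by apply: emeasurable_funM => //; exact: measurable_cst.
  move=> xi _; rewrite -stft_window; apply: le_trans (point _) _.
  rewrite le_eqVlt; apply/orP; left; apply/eqP; congr (_ * _)%E; apply: eq_integral => p _.
  by rewrite /ex /w /= mulrC mulrA.
rewrite -(window_norm mf).
have [mw Ew] := swap (fun p => Re (l p)) (fun p => G p ^+ 2) (fun p => sqr_ge0 _).
apply: (@le_trans _ _ (\int[leb]_x ((C ^+ 2 * S * B)%:E * \int[cnt2]_p (G p ^+ 2 * expR (- (gm * (x - Re (l p)) ^+ 2)))%:E))%E).
  apply: (@ge0_le_integral _ _ _ leb setT measurableT).
  - by move=> x _; apply: integral_ge0 => s _; rewrite lee_fin sqr_ge0.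
  - pose F (z : R * R) : \bar R := (normc (window f z.1 z.2) ^+ 2)%:E.
    have mF : measurable_fun setT F.
      apply/measurable_EFinP; apply: measurable_funX; apply: cmeas_norm; apply: cmeasM.
        by case: mf => m1 m2; split; [apply: (measurableT_comp m1)|apply: (measurableT_comp m2)].
      by apply: cmeas_real; rmeas.
    apply: (@measurable_fun_fubini_tonelli_F _ _ _ _ R leb F mF).
    by move=> z; rewrite lee_fin sqr_ge0.
  - by apply: emeasurable_funM => //; exact: measurable_cst.
  - by move=> x _; rewrite (EFinM (C ^+ 2 * S)) -muleA; exact: fx.
rewrite ge0_integralZl //; last 2 first.
- by move=> x _; apply: integral_ge0 => p _; rewrite lee_fin mulr_ge0 ?sqr_ge0 ?expR_ge0.
- by rewrite lee_fin; exact: mulr_ge0 (mulr_ge0 (sqr_ge0 _) (ltW S0)) (sqrtr_ge0 _).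
rewrite Ew muleA -EFinM; apply: lee_wpmul2r.
  by apply: integral_ge0 => p _; rewrite lee_fin sqr_ge0.
have BB : B * B = pi / gm by rewrite -expr2 sqr_sqrtr // divr_ge0 // ltW.
rewrite lee_fin -[leLHS]mulrA BB.
have uE : normc u ^+ 2 = y^-1 by rewrite -[RHS]mul1r -uy mulfK // gt_eqF.
have alE : al = pi / (2 * y) * (1 - q ^+ 2) by rewrite /al uE invfM; ring.
have Sle : S <= E0 * (4 / (1 - q ^+ 2)).
  have z0 : 0 <= 2 * pi / (al * y) := divr_ge0 (mulr_ge0 (ler0n R 2) (ltW pi0)) (mulr_ge0 (ltW al0) (ltW y0)).
  rewrite /S; apply: (ler_pM (expR_ge0 _) z0).
    rewrite /E0 ler_expR alE; apply: ler_wpM2r; first by rewrite addr_ge0 ?sqr_ge0.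
    by rewrite ler_piMr ?gerBl ?sqr_ge0 // divr_ge0 ?mulr_ge0 // ltW.
  rewrite alE le_eqVlt; apply/orP; left; apply/eqP.
  move: (pi : R) pi0 (y) y0 (1 - q ^+ 2) q2 => p p0 v v0 r r0; field.
  by rewrite !gt_eqF.
have gle : pi / gm <= 2 / (1 - q ^+ 2).
  have -> : pi / gm = 2 / (1 - q ^+ 2) * q ^+ 2.
    rewrite /gm; move: (pi : R) pi0 q0 (1 - q ^+ 2) q2 => p p0 qq0 r r0; field.
    by rewrite !gt_eqF.
  by rewrite ler_piMr ?divr_ge0 ?(ltW q2) // exprn_ile1 // ltW.
have -> : 8 * C ^+ 2 * E0 / (1 - q ^+ 2) ^+ 2 = C ^+ 2 * (E0 * (4 / (1 - q ^+ 2))) * (2 / (1 - q ^+ 2)).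
  by move: (1 - q ^+ 2) q2 => r r0; field; rewrite gt_eqF.
apply: (ler_pM (mulr_ge0 (sqr_ge0 C) (ltW S0)) (divr_ge0 (ltW pi0) (ltW gm0)) _ gle).
exact: (ler_wpM2l (sqr_ge0 C) Sle).
Qed.

End FrameInequality.

(** * The optimal bound as a supremum *)

Section Optimal.
Context (R : realType).
Local Notation leb := (@lebesgue_measure R).
Local Notation cnt2 := (@zcount2 R).

Definition cpt (v : 'cV[R]_2) : R[i] := time_coord v +i* freq_coord v.

Lemma innerL2_stft (f : R -> R[i]) (v : 'cV[R]_2) : innerL2 f (tfshift v (@gaussian R)) = stft f (cpt v).
Proof.
rewrite /innerL2 /stft; apply: (eq_cint leb) => s; congr (_ * conjc _).
rewrite /tfshift /gaussian /atom expi_cexp /cpt.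
set x := time_coord v; set w := freq_coord v.
have -> : (2 `^ 4^-1 * expR (- pi * (s - x) ^+ 2))%:C = (gauss0 R * expR (- (pi * s ^+ 2) - pi * x ^+ 2))%:C * (expR (2 * pi * s * x))%:C :> R[i].
  rewrite -rmorphM -[X in _ = X%:C]mulrA -expRD; congr ((_ * expR _)%:C); ring.
rewrite [LHS]mulrC -[LHS]mulrA; congr (_ * _); rewrite -cexp_real -cexpD; congr cexp.
by apply: complexP; rewrite !ReImE /=; ring.
Qed.

Lemma cpt_inj : injective cpt.
Proof.
move=> v w [h1 h2]; apply/matrixP => i j; rewrite (ord1 j).
have : i \in [:: ord0; ord_max : 'I_2] by rewrite !inE -!val_eqE /=; case: i => -[|[|]].
by rewrite !inE => /orP[/eqP ->|/eqP ->].
Qed.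

Lemma lattice_esum (L : set 'cV[R]_2) (u : R[i]) (t y : R) (F : R[i] -> \bar R) : u != 0 -> 0 < y ->
  (forall z, (0 <= F z)%E) ->
  (forall z, (exists2 v, L v & cpt v = z) <-> (exists p : int * int, z = u * lat t y p)) ->
  (\esum_(v in L) F (cpt v) = \int[cnt2]_p F (u * lat t y p)%R)%E.
Proof.
move=> un y0 F0 HL.
have li : injective (fun p => u * lat t y p).
  move=> [a b] [c d] /(mulfI un) [] h1 h2.
  have yn : y != 0 by rewrite gt_eqF.
  have bd : b = d by apply: (@intr_inj R); exact: (mulIf yn h2).
  by move: h1; rewrite bd => /addIr /intr_inj ->.
have E : cpt @` L = (fun p => u * lat t y p) @` [set: int * int].
  apply/seteqP; split => z /=.
    by move=> [v Lv vz]; have [|p ->] := (HL z).1; [exists v|exists p].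
  by move=> [p _ <-]; have [|v Lv vz] := (HL (u * lat t y p)).2; [exists p|exists v].
transitivity (\esum_(z in cpt @` L) F z)%E.
  by rewrite esum_image // => v w _ _; exact: cpt_inj.
rewrite E esum_image; last by move=> p p' _ _; exact: li.
by rewrite -(integral_cnt2_esum (f := fun p => F (u * lat t y p))).
Qed.

Lemma inL2_gaussian : inL2 (@gaussian R) /\ sqnormL2 (@gaussian R) = 1%E.
Proof.
have pi0 := pi_gt0 R.
have p2 : 0 < 2 * pi :> R by rewrite mulr_gt0.
have mg : measurable_fun setT (fun s : R => 2 `^ 4^-1 * expR (- pi * s ^+ 2)) by rmeas.
have E : sqnormL2 (@gaussian R) = 1%E.
  rewrite /sqnormL2; transitivity (\int[leb]_s ((Num.sqrt 2)%:E * (expR (- (2 * pi * (s - 0) ^+ 2)))%:E))%E.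
    apply: eq_integral => s _; rewrite /gaussian normcR real_normK ?num_real // exprMn -/(gauss0 R) gauss0_sqr -expRM_natl -EFinM.
    by congr ((_ * expR _)%:E); rewrite subr0; ring.
  rewrite ge0_integralZl ?lee_fin ?sqrtr_ge0 //; last by apply/measurable_EFinP; exact: measurable_gauss.
  rewrite integral_gauss // -EFinM -sqrtrM //.
  have -> : 2 * (pi / (2 * pi)) = 1 :> R.
    by move: (pi : R) pi0 => p p0; field; rewrite gt_eqF.
  by rewrite sqrtr1.
split => //; split => //; last by rewrite E ltry.
Qed.

(** The product of the two Gaussians is centred at half the time coordinate. The decay in z makes
    the frame sum of the Gaussian itself finite. *)
Lemma normc_stft_gaussian z : normc (stft (@gaussian R) z) = expR (- (pi / 2 * normc z ^+ 2)).
Proof.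
have pi0 := pi_gt0 R; have pin : (pi : R) != 0 by rewrite gt_eqF.
have p2 : 0 < 2 * pi :> R by rewrite mulr_gt0.
case: z => x w.
have E s : gaussian s * conjc (atom (x +i* w) s) =
   ((Num.sqrt 2 * expR (- (pi / 2 * x ^+ 2)))%:C * cexp (0 +i* (- (pi * x * w)))) *
   ((expR (- (2 * pi * (s - x / 2) ^+ 2)))%:C * cexp (0 +i* (- (2 * pi * w) * (s - x / 2)))).
  have -> : gaussian s * conjc (atom (x +i* w) s) = (gauss0 R ^+ 2)%:C * cexp ((- (2 * pi * s ^+ 2) - pi * x ^+ 2)%:C + (2 * pi * s)%:C * (x -i* w)).
    rewrite /gaussian /atom conjcM -cexpJ cexpD cexp_real.
    rewrite [(gauss0 R * _)%:C]rmorphM [(2 `^ 4^-1 * _)%:C]rmorphM -/(gauss0 R) [(gauss0 R ^+ 2)%:C]rmorphXn.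
    have -> : conjc ((gauss0 R)%:C * (expR (- (pi * s ^+ 2) - pi * Re (x +i* w) ^+ 2))%:C) = (gauss0 R)%:C * (expR (- (pi * s ^+ 2) - pi * x ^+ 2))%:C.
      by apply: complexP; rewrite !ReImE /=; ring.
    have -> : conjc ((2 * pi * s)%:C * (x +i* w)) = (2 * pi * s)%:C * (x -i* w).
      by apply: complexP; rewrite !ReImE /=; ring.
    have -> : - (2 * pi * s ^+ 2) - pi * x ^+ 2 = - pi * s ^+ 2 + (- (pi * s ^+ 2) - pi * x ^+ 2) by ring.
    rewrite [expR (- pi * s ^+ 2 + _)]expRD [(expR _ * expR _)%:C]rmorphM; ring.
  have cM (a b : R) : (a * b)%:C = a%:C * b%:C := rmorphM _ a b.
  rewrite gauss0_sqr [(Num.sqrt 2 * _)%:C]cM -!cexp_real.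
  have aux (g e1 e2 e3 e4 : R[i]) : g * cexp e1 * cexp e2 * (cexp e3 * cexp e4) = g * cexp (e1 + e2 + e3 + e4).
    by rewrite !cexpD; ring.
  rewrite aux; congr (_ * cexp _); apply: complexP; rewrite !ReImE /=; by move: (pi : R) => p; field.
pose g s : R[i] := (expR (- (2 * pi * s ^+ 2)))%:C * cexp (0 +i* (- (2 * pi * w) * s)).
have Ig : cintg leb g := cintg_gauss_cexp (- (2 * pi * w)) p2.
have [Is Es] := cint_shift (- (x / 2)) Ig.
rewrite /stft (eq_cint leb E) (cintZ _ Is) Es (cint_gauss_cexp _ p2).
rewrite !normcM normc_cexp [complex.Re _]/= expR0 mulr1 !normcR !ger0_norm ?mulr_ge0 ?expR_ge0 ?sqrtr_ge0 //.
rewrite mulrACA -sqrtrM //.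
have -> : 2 * (pi / (2 * pi)) = 1 :> R by move: (pi : R) pin => p pn; field.
rewrite sqrtr1 mul1r -expRD normc_sqr /=; congr expR.
by move: (pi : R) pin => p pn; field.
Qed.

(** [optimal_lower_frame_bound] defaults to 0 unless a largest bound exists. The bounds have a
    supremum because the Gaussian is a test function, and this supremum is itself a lower frame
    bound. *)
Lemma optimal_ge (L : set 'cV[R]_2) (u : R[i]) (t y c : R) : u != 0 -> 0 < y ->
  (forall z, (exists2 v, L v & cpt v = z) <-> (exists p : int * int, z = u * lat t y p)) ->
  lower_frame_bound (@gaussian R) L c -> c <= optimal_lower_frame_bound (@gaussian R) L.
Proof.
move=> un y0 HL Lc.
pose Bs := [set b | lower_frame_bound (@gaussian R) L b].
have [ig ng] := inL2_gaussian.
have pu : 0 < pi / 2 * normc u ^+ 2 by rewrite mulr_gt0 ?divr_gt0 ?pi_gt0 // exprn_gt0 // normc_gt0.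
have FE : (\esum_(l in L) (normc (innerL2 (@gaussian R) (tfshift l (@gaussian R))) ^+ 2)%:E < +oo)%E.
  rewrite (eq_esum (b := fun l => (fun z => (normc (stft (@gaussian R) z) ^+ 2)%:E) (cpt l))); last first.
    by move=> l _; rewrite innerL2_stft.
  rewrite (lattice_esum (F := fun z => (normc (stft (@gaussian R) z) ^+ 2)%:E) un y0 _ HL); last first.
    by move=> z; rewrite lee_fin sqr_ge0.
  have /integrableP[_] := integrable_lgauss0 t y0 pu; apply: le_lt_trans; apply: ge0_le_integral => //.
  - by move=> p _; rewrite lee_fin sqr_ge0.
  - by apply: measurable_fun_int2.
  - by apply: measurable_fun_int2.
  move=> p _; rewrite gee0_abs ?lee_fin ?expR_ge0 // normc_stft_gaussian -expRM_natl ler_expR normcM exprMn.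
  have n0 : 0 <= pi * normc u ^+ 2 * normc (lat t y p) ^+ 2.
    by apply: mulr_ge0 (sqr_ge0 _); apply: mulr_ge0 (sqr_ge0 _); exact: pi_ge0.
  move: (normc u ^+ 2) (normc (lat t y p) ^+ 2) (pi : R) n0 => U V P n0.
  lra.
set S := (\esum_(l in L) _)%E in FE.
have S0 : (0 <= S)%E by apply: esum_ge0 => l _; rewrite lee_fin sqr_ge0.
(* The Gaussian has norm one, so its finite frame sum S majorizes every lower frame bound. *)
have ub : ubound Bs (fine S).
  move=> b [b0 /(_ _ ig)]; rewrite ng mule1 => h.
  by rewrite -lee_fin fineK // ge0_fin_numE.
have hs : has_sup Bs by split; [exists c|exists (fine S)].
have top : lower_frame_bound (@gaussian R) L (sup Bs).
  have c0 := Lc.1; split; first by apply: le_trans c0 _; exact: ub_le_sup hs.2 c Lc.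
  move=> f fL; have sq0 : (0 <= sqnormL2 f)%E by apply: integral_ge0 => s _; rewrite lee_fin sqr_ge0.
  have [_ _ sqf] := fL; have sqE : sqnormL2 f = (fine (sqnormL2 f))%:E by rewrite fineK // ge0_fin_numE.
  set T := (\esum_(l in L) _)%E; rewrite sqE; move: (fine (sqnormL2 f)) (fine_ge0 sq0) sqE => n n0 sqE.
  have HT b : Bs b -> ((b * n)%:E <= T)%E by move=> [b0 /(_ f fL)]; rewrite sqE -EFinM.
  have T0 : (0 <= T)%E by apply: esum_ge0 => l _; rewrite lee_fin sqr_ge0.
  move: n0; rewrite le_eqVlt => /predU1P[<-|n0]; first by rewrite mule0.
  rewrite -EFinM; move: T0 HT; case: (T) => [r| |] // r0 HT; last by rewrite leey.
  rewrite lee_fin -ler_pdivlMr //; apply: ge_sup; first by exists c.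
  by move=> b Bb; rewrite ler_pdivlMr //; have := HT b Bb; rewrite lee_fin.
rewrite /optimal_lower_frame_bound; case: xgetP => [s _ [_ smax]|/(_ (sup Bs)) H].
  exact: smax.
by exfalso; apply: H; split => // b Bb; exact: ub_le_sup hs.2 b Bb.
Qed.

End Optimal.

(** * Lattices in the plane in the form u (Z + tau Z) *)

Section Parametrization.
Context (R : realType).

Lemma cptZ (q : R) (v : 'cV[R]_2) : cpt (q *: v) = q%:C * cpt v.
Proof. by rewrite /cpt /time_coord /freq_coord !mxE; apply: complexP; rewrite !ReImE /=; ring. Qed.

Lemma cpt_mul (A : 'M[R]_2) (k : 'cV[int]_2) :
  cpt (A *m map_mx intr k) = (k ord0 ord0)%:~R%:C * cpt (col ord0 A) + (k ord_max ord0)%:~R%:C * cpt (col ord_max A).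
Proof.
have e : lift ord0 (ord0 : 'I_1) = ord_max by apply: val_inj.
rewrite /cpt /time_coord /freq_coord !mxE !big_ord_recl !big_ord0 !mxE !e.
by apply: complexP; rewrite !ReImE /=; ring.
Qed.

Lemma normc_Im_div (u v : R[i]) : u != 0 -> normc u ^+ 2 * Im (v / u) = Re u * Im v - Im u * Re v.
Proof.
move=> un; have vE : v = v / u * u by rewrite mulfVK.
by rewrite {2 3}vE; move: (v / u) => w; rewrite normc_sqr !ReImE; ring.
Qed.

(** The columns of A are complex numbers u and v; tau is v / u up to a sign, and det A is |u|^2 Im(v
    / u). *)
Lemma lattice_param (A : 'M[R]_2) : A \in unitmx ->
  exists (u : R[i]) (t y : R), [/\ u != 0, 0 < y, normc u ^+ 2 * y = `|\det A| &
    forall z, (exists2 v, lattice_of A v & cpt v = z) <-> (exists p : int * int, z = u * lat t y p)].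
Proof.
move=> uA; pose u := cpt (col ord0 A); pose v := cpt (col ord_max A).
have e : lift ord0 (ord0 : 'I_1) = ord_max by apply: val_inj.
have e' : lift ord_max (ord0 : 'I_1) = ord0 by apply: val_inj.
have dE : \det A = Re u * Im v - Im u * Re v.
  by rewrite /u /v /cpt /time_coord /freq_coord !mxE (expand_det_row A ord0) !big_ord_recl big_ord0 /cofactor !det_mx11 !mxE !e ?e' /=; ring.
have dn : \det A != 0 by rewrite -unitfE -unitmxE.
have un : u != 0.
  by apply: contra_neq dn => u0; rewrite dE u0 /= !mul0r subrr.
have nu := normc_Im_div v un; rewrite -dE in nu.
pose a := v / u; have vE : v = u * a by rewrite /a mulrCA divff // mulr1.
have an : Im a != 0 by apply: contra_neq dn => a0; rewrite -nu -/a a0 mulr0.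
(* The sign that makes the imaginary part of tau positive; it is absorbed into the second lattice
   coordinate. *)
have [s ss sa] : exists2 s : int, s * s = 1 & 0 < s%:~R * Im a.
  move: an; rewrite neq_lt => /orP[h|h]; [exists (-1)|exists 1] => //; rewrite ?mulN1r ?oppr_gt0 ?mul1r //.
have sR : s%:~R * s%:~R = 1 :> R by rewrite -intrM ss.
have latE m n : lat (s%:~R * Re a) (s%:~R * Im a) (m, n) = m%:~R%:C + (n * s)%:~R%:C * a.
  by rewrite /lat intrM; apply: complexP; rewrite !ReImE /=; ring.
exists u, (s%:~R * Re a), (s%:~R * Im a); split => //.
  have n0 : 0 <= normc u ^+ 2 * (s%:~R * Im a) by rewrite mulr_ge0 ?sqr_ge0 // ltW.
  have s1 : `|s%:~R| = 1 :> R.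
    have : `|s%:~R| ^+ 2 = 1 :> R by rewrite -normrX expr2 sR normr1.
    by move/eqP; rewrite sqrp_eq1 // => /eqP.
  by rewrite -(ger0_norm n0) mulrCA normrM s1 mul1r nu.
move=> z; split=> [[_ [k _ <-] <-]|[[m n] ->]].
  exists (k ord0 ord0, k ord_max ord0 * s); rewrite latE cpt_mul -/u -/v vE -mulrA ss mulr1 [RHS]mulrDr.
  by congr (_ + _); [exact: mulrC|exact: mulrCA].
exists (A *m map_mx intr (\col_i if i == ord0 then m else n * s)); first by eexists.
by rewrite latE cpt_mul !mxE /= -/u -/v vE [RHS]mulrDr; congr (_ + _); [exact: mulrC|exact: mulrCA].
Qed.

End Parametrization.

Theorem proposition4p5 (R : realType) (L : set 'cV[R]_2)
    (hL : is_lattice L) (hs : covolume L = 1) :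
  exists c : R, 0 < c /\
    forall q : R, 0 < q -> q < 1 ->
      c * (1 - q ^+ 2) ^+ 2
        <= optimal_lower_frame_bound (@gaussian R) (scale_set q L)
      /\ c * (1 - q ^+ 2) ^+ 2 = c * (1 - covolume (scale_set q L)) ^+ 2.
Proof.
have [A uA LE] := hL; move: hs; rewrite {hL}LE => hs.
have [u [t [y [un y0 nu HA]]]] := lattice_param uA.
(* The reduction concerns the unscaled lattice, so the constant K obtained from it is independent of
   q. *)
have [u' [t' [y' [un' nu' S y2]]]] := complex_reduction t un y0.
have uy : normc u' ^+ 2 * y' = 1 by rewrite nu' nu -covolumeE.
have [K K0 HK] := frame_inequality t' y2 uy.
exists K^-1; split; first by rewrite invr_gt0.
move=> q q0 q1; split; last by rewrite covolume_scale // hs mulr1.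
have HLq z : (exists2 v, scale_set q (lattice_of A) v & cpt v = z) <->
    (exists p : int * int, z = q%:C * u' * lat t' y' p).
  split => [[_ [l Ll <-] <-]|[p ->]].
    have [p pE] := (S (cpt l)).1 ((HA _).1 (ex_intro2 _ _ l Ll erefl)).
    by exists p; rewrite cptZ pE mulrA.
  have [l Ll lE] := (HA _).2 ((S _).2 (ex_intro _ p erefl)).
  by exists (q *: l); [exists l|rewrite cptZ lE mulrA].
have y0' : 0 < y' by apply: lt_le_trans y2; rewrite invr_gt0.
have un2 : q%:C * u' != 0.
  by apply: mulf_neq0 => //; rewrite -normc_gt0 normcR gtr0_norm.
have d0 : 0 < 1 - q ^+ 2 by rewrite subr_gt0 exprn_ilt1 // ltW.
have c0 : 0 <= K^-1 * (1 - q ^+ 2) ^+ 2 by rewrite mulr_ge0 ?invr_ge0 ?sqr_ge0 // ltW.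
apply: (optimal_ge un2 y0' HLq); split => // f [m1 m2 ff].
rewrite (eq_esum (b := fun l => (fun z => (normc (stft f z) ^+ 2)%:E) (cpt l))); last first.
  by move=> l _; rewrite innerL2_stft.
rewrite (lattice_esum (F := fun z => (normc (stft f z) ^+ 2)%:E) un2 y0' _ HLq); last first.
  by move=> z; rewrite lee_fin sqr_ge0.
have c0E : (0 <= (K^-1 * (1 - q ^+ 2) ^+ 2)%:E)%E by rewrite lee_fin.
(* Multiplying the frame inequality by (1 - q^2)^2 / K turns its constant into 1. *)
have := lee_wpmul2l c0E (HK q f q0 q1 (conj m1 m2) ff).
by rewrite muleA -EFinM mulrACA mulVf ?gt_eqF // mul1r divff ?mul1e // expf_neq0 // gt_eqF.
Qed.
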